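(* Let $\Omega\subset\mathbb{R}^2$ be a domain and let $\beta>-1$. If $v\in W^{1,1}_{\rm loc}(\Omega)$ and $|Dv|^\beta Dv\in W^{1,2}_{\rm loc}(\Omega)$, then for all $\psi\in C_c^\infty(\Omega)$, $$\int_\Omega-\det D\big[|Dv|^\beta Dv\big]\psi\,dx=-\frac12\int_\Omega|Dv|^{2\beta}(D^2\psi Dv\cdot Dv)\,dx+\frac1{2\beta+2}\int_\Omega|Dv|^{2\beta+2}\Delta\psi\,dx-\frac{\beta}{\beta+1}\int_\Omega\big[D|Dv|^{\beta+1}\cdot Dv\big](Dv\cdot D\psi)|Dv|^{\beta-1}\,dx .$$
   Context: Here $-\det D[|Dv|^\beta Dv]\in L^1_{\rm loc}(\Omega)$ is the pointwise a.e. defined (minus) determinant of the weak derivative matrix of the vector field $|Dv|^\beta Dv\in W^{1,2}_{\rm loc}(\Omega;\mathbb{R}^2)$. The quantities $|Dv|^\beta Dv$, $|Dv|^{2\beta}Dv\otimes Dv$ and $|Dv|^{\beta-1}Dv\otimes Dv$ are interpreted as $0$ where $Dv=0$. Note that the hypothesis implies $|Dv|^{\beta+1}\in W^{1,2}_{\rm loc}(\Omega)$. *)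

(* Defs.v *)
From HB Require Import structures.
From mathcomp Require Import all_boot all_order all_algebra.
From mathcomp Require Import all_classical all_reals all_analysis.
Import Order.TTheory GRing.Theory Num.Theory.
Import numFieldNormedType.Exports.

Set Implicit Arguments.
Unset Strict Implicit.
Unset Printing Implicit Defensive.

Local Open Scope classical_set_scope.
Local Open Scope ring_scope.

(* Points of the plane are pairs, so that Lebesgue measure is a library product
   measure. Vectors and matrices of values are 'cV[R]_2 and 'M[R]_2.
   Measurability is with respect to the product (Borel) sigma-algebra, i.e. one
   works with Borel representatives of Lebesgue measurable functions. *)
Definition leb2 (R : realType) :
    {measure set (measurableTypeR R * measurableTypeR R) -> \bar R} :=
  (@lebesgue_measure R \x @lebesgue_measure R)%E.
Arguments leb2 R : clear implicits.

Definition is_domain (R : realType) (Omega : set (R * R)) : Prop :=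
  [/\ open Omega, connected Omega & Omega !=set0].

Definition ebase (R : realType) (i : 'I_2) : R * R :=
  ((i == 0%N :> nat)%:R, (i == 1%N :> nat)%:R).

(* Euclidean structure: the library norm on 'cV[R]_2 is the sup norm. *)
Definition dotp (R : realType) (u w : 'cV[R]_2) : R := \sum_i u i 0 * w i 0.

Definition enorm (R : realType) (u : 'cV[R]_2) : R := Num.sqrt (dotp u u).

Definition partial (R : realType) (i : 'I_2) (f : R * R -> R) : R * R -> R :=
  'D_(ebase R i) f.

Definition grad (R : realType) (f : R * R -> R) (x : R * R) : 'cV[R]_2 :=
  \col_i partial i f x.

Definition hessian (R : realType) (f : R * R -> R) (x : R * R) : 'M[R]_2 :=
  \matrix_(i, j) partial i (partial j f) x.

Definition laplacian (R : realType) (f : R * R -> R) (x : R * R) : R :=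
  \sum_i partial i (partial i f) x.

Fixpoint Ck (R : realType) (k : nat) (f : R * R -> R) : Prop :=
  continuous f /\
  match k with
  | 0%N => True
  | k'.+1 => forall i : 'I_2,
      (forall x : R * R, derivable f x (ebase R i)) /\ Ck k' (partial i f)
  end.

Definition tsupp (R : realType) (f : R * R -> R) : set (R * R) :=
  closure [set x | f x != 0].

(* A function on Omega is identified with its extension by 0 to the plane. *)
Definition test_fun (R : realType) (Omega : set (R * R)) (psi : R * R -> R) :
    Prop :=
  [/\ forall k, Ck k psi, compact (tsupp psi) & tsupp psi `<=` Omega].

(* Values of f outside Omega play no role. *)
Definition Lploc (R : realType) (p : \bar R) (Omega : set (R * R))
    (f : R * R -> R) : Prop :=
  forall K : set (R * R), compact K -> K `<=` Omega ->
    f \_ K \in Lfun (leb2 R) p.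

Definition is_wpartial (R : realType) (Omega : set (R * R)) (i : 'I_2)
    (f g : R * R -> R) : Prop :=
  [/\ Lploc 1%E Omega f, Lploc 1%E Omega g &
      forall phi, test_fun Omega phi ->
        \int[leb2 R]_(x in Omega) (f x * partial i phi x) =
        - \int[leb2 R]_(x in Omega) (g x * phi x)].

Definition W1loc (R : realType) (p : \bar R) (Omega : set (R * R))
    (f : R * R -> R) : Prop :=
  Lploc p Omega f /\
  forall i, exists2 g, is_wpartial Omega i f g & Lploc p Omega g.

Definition W1loc_vec (R : realType) (p : \bar R) (Omega : set (R * R))
    (F : R * R -> 'cV[R]_2) : Prop :=
  forall i, W1loc p Omega (fun x => F x i 0).

(* A chosen representative of the weak derivative, which is unique up to null
   sets in Omega; junk value 0 when there is no weak derivative. *)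
Definition wpartial (R : realType) (Omega : set (R * R)) (i : 'I_2)
    (f : R * R -> R) : R * R -> R :=
  xget (fun=> 0) [set g | is_wpartial Omega i f g].

Definition wgrad (R : realType) (Omega : set (R * R)) (f : R * R -> R)
    (x : R * R) : 'cV[R]_2 :=
  \col_i wpartial Omega i f x.

Definition wjac (R : realType) (Omega : set (R * R)) (F : R * R -> 'cV[R]_2)
    (x : R * R) : 'M[R]_2 :=
  \matrix_(i, j) wpartial Omega j (fun y => F y i 0) x.

(* Main.v *)
(* Let gam = beta / (beta + 1) and w_j = F . d_j F, so that Dv = |F|^(-gam) F. Where F <> 0,
   the equality d_0 d_1 v = d_1 d_0 v reads
     d_1 F_0 - d_0 F_1 = gam (F_0 w_1 - F_1 w_0) / |F|^2,
   and d_j |F| = w_j / |F|. Every term of the claim is an integral over the plane of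
   expressions in F, DF and psi. The Jacobian identities for (psi F_0, F_1) and (psi F_1, F_0)
   and integration by parts of F_i against F_j d_k psi turn the claim into a sum of two
   integrals of d_i psi times an expression in F and DF which vanishes by the curl relation.

   The calculus uses derivatives that are L2 limits of difference quotients: for these, chain
   rule, integration by parts and the Jacobian identity follow from discrete identities and
   translation invariance. Weak derivatives with L2 values are of this kind, since a weakly
   differentiable function is almost everywhere the integral of its derivative along lines.
   The curl relation needs Dv in L2_loc although only |Dv|^(beta + 1) is in W^{1,2}_loc: by
   Gagliardo-Nirenberg in the plane and Moser iteration, F is in L^p_loc for every p. *)

Require Import Defs.
From HB Require Import structures.
From mathcomp Require Import all_boot all_order all_algebra.
From mathcomp Require Import all_classical all_reals all_analysis.
From mathcomp Require Import measurable_realfun ring lra.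
Import Order.TTheory GRing.Theory Num.Theory.
Import numFieldNormedType.Exports.

Local Open Scope classical_set_scope.
Local Open Scope ring_scope.

Set Implicit Arguments.
Unset Strict Implicit.
Unset Printing Implicit Defensive.

(** [v] has no second derivatives, so the equality of its mixed derivatives is only available in
    integrated form: the Jacobian of (u, v) integrates to 0 for compactly supported u with square
    integrable gradient. This asks for Dv in L2, and |Dv| = |F|^(1 / (beta + 1)) is a high power of
    |F| when beta is close to -1; hence the need for every exponent p. The derivative of |F|^(-gam)
    F is unbounded near F = 0 if gam > 0 and at infinity if gam < 0. The relation is therefore
    multiplied by powers of q = 1 / (1 + |F|^2) and of 1 - q, which vanish at infinity and at F = 0,
    and the weight is divided out where F <> 0. At F = 0 every term of the claim except the
    determinant vanishes, so the curl relation has to be known only where F <> 0. Difference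
    quotients replace mollification: products of two L2-convergent sequences converge in L1, and the
    analytic input is the continuity of translations in L2. *)

(** * Square integrable functions *)

(** Only an upper bound is asked for. The sequences are values of [I1] and [I2], which are
    nonnegative but may be infinite at first, so comparison needs no finiteness proof. *)
Definition to0 (R : realType) (u : nat -> \bar R) :=
  forall e : R, 0 < e -> \forall n \near \oo, (u n <= e%:E)%E.

Section ToZero.
Variable R : realType.

(** The [+ 1] makes [e / (c + 1)] an admissible tolerance also for [c = 0]. *)
Lemma mul_div_add1_le (c e : R) : 0 <= c -> 0 < e -> c * (e / (c + 1)) <= e.
Proof.
move=> c0 e0; rewrite mulrA ler_pdivrMr ?ltr_pwDr// mulrC ler_wpM2l ?ltW//.
by rewrite ltr_pwDr.
Qed.

Implicit Types u v : nat -> \bar R.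
Local Open Scope ereal_scope.

Lemma to0_le u v : (forall n, u n <= v n) -> to0 v -> to0 u.
Proof.
move=> uv v0 e e0; near=> n; apply: (le_trans (uv n)).
by near: n; exact: v0.
Unshelve. all: by end_near. Qed.

Lemma to0D u v : to0 u -> to0 v -> to0 (fun n => u n + v n).
Proof.
move=> u0 v0 e e0; have e2 : (0 < e / 2)%R by rewrite divr_gt0.
near=> n; rewrite (splitr e) EFinD; apply: leeD.
- by near: n; exact: u0.
- by near: n; exact: v0.
Unshelve. all: by end_near. Qed.

Lemma to0Z (c : R) u : (0 <= c)%R -> to0 u -> to0 (fun n => c%:E * u n).
Proof.
move=> c0 u0 e e0; have c1 : (0 < c + 1)%R by rewrite ltr_pwDr.
have ec : (0 < e / (c + 1))%R by rewrite divr_gt0.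
have : \forall n \near \oo, u n <= (e / (c + 1))%:E by exact: u0.
apply: filterS => n un.
apply: (@le_trans _ _ (c%:E * (e / (c + 1))%:E)).
  by apply: lee_wpmul2l => //; rewrite lee_fin.
by rewrite -EFinM lee_fin mul_div_add1_le// sqr_ge0.
Qed.

Lemma to0_cst (x : R) u : (forall n, `|x|%:E <= u n) -> to0 u -> x = 0%R.
Proof.
move=> xu u0; apply/eqP; rewrite -normr_eq0 eq_le normr_ge0 andbT.
apply/ler_addgt0Pr => e e0; rewrite add0r.
have [n _ un] := u0 _ e0; rewrite -lee_fin.
by apply: le_trans (xu n) (un n _) => /=.
Qed.

Lemma cvg0_to0 u : u @ \oo --> 0 -> to0 u.
Proof.
move=> /fine_cvgP[fu /cvgrPdist_lt h] e e0; have := h _ e0.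
apply: filterS2 fu => n fn; rewrite /= sub0r normrN => nu.
by rewrite -(fineK fn) lee_fin ltW// (le_lt_trans (ler_norm _)).
Qed.

End ToZero.

Section I2.
Context d (T : measurableType d) (R : realType).
Variable mu : {measure set T -> \bar R}.
Implicit Types f g h b : T -> R.
Local Open Scope ereal_scope.

Definition I1 f : \bar R := \int[mu]_x (`|f x|)%:E.
(** The squared norm is used throughout: the triangle inequality becomes (a + b)^2 <= 2 a^2 + 2 b^2,
    and no roots of extended reals occur. *)
Definition I2 f : \bar R := \int[mu]_x ((f x) ^+ 2)%:E.

Definition L2 f := measurable_fun setT f /\ I2 f < +oo.

Lemma ge0_intle f g : measurable_fun setT f -> measurable_fun setT g ->
  (forall x, 0 <= f x)%R -> (forall x, f x <= g x)%R ->
  \int[mu]_x (f x)%:E <= \int[mu]_x (g x)%:E.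
Proof.
move=> mf mg f0 fg; apply: ge0_le_integral => //.
- by move=> x _; rewrite lee_fin.
- exact/measurable_EFinP.
- exact/measurable_EFinP.
- by move=> x _; rewrite lee_fin.
Qed.

Lemma ge0_intlin (a b : R) f g :
  measurable_fun setT f -> measurable_fun setT g ->
  (0 <= a)%R -> (0 <= b)%R -> (forall x, 0 <= f x)%R -> (forall x, 0 <= g x)%R ->
  \int[mu]_x (a * f x + b * g x)%:E =
  a%:E * \int[mu]_x (f x)%:E + b%:E * \int[mu]_x (g x)%:E.
Proof.
move=> mf mg a0 b0 f0 g0.
rewrite -!ge0_integralZl_EFin//; last first.
- exact/measurable_EFinP.
- by move=> x _; rewrite lee_fin.
- exact/measurable_EFinP.
- by move=> x _; rewrite lee_fin.
rewrite -ge0_integralD//.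
- by move=> x _; rewrite -EFinM lee_fin mulr_ge0.
- by apply/measurable_EFinP; exact: measurable_funM.
- by move=> x _; rewrite -EFinM lee_fin mulr_ge0.
- by apply/measurable_EFinP; exact: measurable_funM.
Qed.

Lemma I2_ge0 f : 0 <= I2 f.
Proof. by apply: integral_ge0 => x _; rewrite lee_fin sqr_ge0. Qed.

Lemma I1_ge0 f : 0 <= I1 f.
Proof. by apply: integral_ge0 => x _; rewrite lee_fin. Qed.

Lemma I2_le f g : measurable_fun setT f -> measurable_fun setT g ->
  (forall x, `|f x| <= `|g x|)%R -> I2 f <= I2 g.
Proof.
move=> mf mg fg; apply: ge0_intle => //.
- exact: measurable_funX.
- exact: measurable_funX.
- by move=> x; exact: sqr_ge0.
- by move=> x; rewrite -(real_normK (num_real (f x))) -(real_normK (num_real (g x))) lerXn2r ?nnegrE.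
Qed.

(** Reduces L2 estimates to pointwise quadratic inequalities, which are then left to real
    arithmetic. *)
Lemma I2_lin (a b : R) f g h :
  measurable_fun setT f -> measurable_fun setT g -> measurable_fun setT h ->
  (0 <= a)%R -> (0 <= b)%R ->
  (forall x, (h x) ^+ 2 <= a * (f x) ^+ 2 + b * (g x) ^+ 2)%R ->
  I2 h <= a%:E * I2 f + b%:E * I2 g.
Proof.
move=> mf mg mh a0 b0 fgh.
rewrite -ge0_intlin//; try exact: measurable_funX; last 2 first.
- by move=> x; exact: sqr_ge0.
- by move=> x; exact: sqr_ge0.
apply: ge0_intle => //; first exact: measurable_funX.
  by apply: measurable_funD; apply: measurable_funM => //; exact: measurable_funX.
by move=> x; exact: sqr_ge0.
Qed.

Lemma I2D f g : measurable_fun setT f -> measurable_fun setT g ->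
  I2 (fun x => f x + g x)%R <= 2%:E * I2 f + 2%:E * I2 g.
Proof.
move=> mf mg; apply: I2_lin => //; first exact: measurable_funD.
by move=> x; have := sqr_ge0 (f x - g x); lra.
Qed.

Lemma I2Z (c : R) f : measurable_fun setT f ->
  I2 (fun x => c * f x)%R = (c ^+ 2)%:E * I2 f.
Proof.
move=> mf; rewrite /I2 -ge0_integralZl_EFin ?sqr_ge0//.
- by apply: eq_integral => x _; rewrite exprMn EFinM.
- by move=> x _; rewrite lee_fin sqr_ge0.
- by apply/measurable_EFinP; exact: measurable_funX.
Qed.

Lemma L2D f g : L2 f -> L2 g -> L2 (fun x => f x + g x)%R.
Proof.
move=> [mf f2] [mg g2]; split; first exact: measurable_funD.
by apply: le_lt_trans (I2D mf mg) _; rewrite lte_add_pinfty// lte_mul_pinfty.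
Qed.

Lemma L2Z (c : R) f : L2 f -> L2 (fun x => c * f x)%R.
Proof.
move=> [mf f2]; split; first exact: measurable_funM.
by rewrite I2Z// lte_mul_pinfty// lee_fin sqr_ge0.
Qed.

Lemma L2B f g : L2 f -> L2 g -> L2 (fun x => f x - g x)%R.
Proof.
move=> f2 /(L2Z (-1)) g2; have := L2D f2 g2.
by congr L2; apply/funext => x; rewrite mulN1r.
Qed.

Lemma L2_le f g : measurable_fun setT f -> L2 g ->
  (forall x, `|f x| <= `|g x|)%R -> L2 f.
Proof.
move=> mf [mg g2] fg; split => //.
by apply: le_lt_trans (I2_le mf mg fg) _.
Qed.

Lemma L2Mb (B : R) f b : L2 f -> measurable_fun setT b ->
  (forall x, `|b x| <= B)%R -> L2 (fun x => f x * b x)%R.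
Proof.
move=> f2 mb bB; apply: (L2_le _ (L2Z `|B|%R f2)).
  by apply: measurable_funM => //; case: f2.
move=> x; rewrite !normrM normr_id mulrC ler_wpM2r//.
by apply: (le_trans (bB x)); exact: ler_norm.
Qed.

(** Young's inequality in place of Cauchy-Schwarz: the free weight [t] is chosen in [to0_I1M]
    according to the size of the fixed factor. *)
Lemma I1M (t : R) f g : measurable_fun setT f -> measurable_fun setT g ->
  (0 < t)%R -> I1 (fun x => f x * g x)%R <= t%:E * I2 f + t^-1%:E * I2 g.
Proof.
move=> mf mg t0; have ti0 : (0 <= t^-1)%R by rewrite invr_ge0 ltW.
rewrite -ge0_intlin//; try exact: measurable_funX; last 3 first.
- exact: ltW.
- by move=> x; exact: sqr_ge0.
- by move=> x; exact: sqr_ge0.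
apply: ge0_intle => //.
- by apply: measurableT_comp => //; exact: measurable_funM.
- by apply: measurable_funD; apply: measurable_funM => //; exact: measurable_funX.
move=> x; rewrite -(real_normK (num_real (f x))) -(real_normK (num_real (g x))).
rewrite normrM; set a := `|f x|%R; set b := `|g x|%R.
have -> : (t * a ^+ 2 + t^-1 * b ^+ 2 = t^-1 * ((t * a) ^+ 2 + b ^+ 2))%R.
  by field; rewrite gt_eqF.
have -> : (a * b = t^-1 * (t * a * b))%R by field; rewrite gt_eqF.
apply: ler_wpM2l => //.
have := sqr_ge0 (t * a - b)%R; have := sqr_ge0 (t * a + b)%R; lra.
Qed.

Lemma L2_integrableM f g : L2 f -> L2 g ->
  mu.-integrable setT (EFin \o (fun x => f x * g x)%R).
Proof.
move=> [mf f2] [mg g2]; apply/integrableP; split.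
  by apply/measurable_EFinP; exact: measurable_funM.
apply: le_lt_trans (I1M mf mg ltr01) _.
by rewrite lte_add_pinfty// lte_mul_pinfty// ?lee_fin ?invr1// I2_ge0.
Qed.

Lemma integrable_I1 f :
  measurable_fun setT f -> I1 f < +oo -> mu.-integrable setT (EFin \o f).
Proof. by move=> mf f1; apply/integrableP; split => //; exact/measurable_EFinP. Qed.

Lemma to0_I1M (c : nat -> T -> R) b :
  (forall n, measurable_fun setT (c n)) -> L2 b -> to0 (fun n => I2 (c n)) ->
  to0 (fun n => I1 (fun x => c n x * b x)%R).
Proof.
move=> mc [mb b2] c0 e e0.
have := I2_ge0 b; have : I2 b \is a fin_num by rewrite ge0_fin_numE ?I2_ge0.
move=> /fineK <-; rewrite lee_fin; set B := fine _ => B0.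
have B1 : (0 < 2 * (B + 1))%R by lra.
(* This weight makes the term of the fixed function, [B / t], at most [e / 2]. *)
pose t := (2 * (B + 1) / e)%R; have t0 : (0 < t)%R by rewrite divr_gt0.
have et0 : (0 < e / (2 * t))%R by rewrite divr_gt0// mulr_gt0.
have := c0 _ et0; apply: filterS => n cn.
apply: (le_trans (I1M (mc n) mb t0)).
have : t%:E * I2 (c n) <= (e / 2)%:E.
  apply: (@le_trans _ _ (t%:E * (e / (2 * t))%:E)).
    by apply: lee_wpmul2l => //; rewrite lee_fin ltW.
  by rewrite -EFinM lee_fin le_eqVlt; apply/orP; left; apply/eqP; field; rewrite gt_eqF.
move=> h; rewrite (splitr e) EFinD; apply: leeD => //.
have <- : B%:E = I2 b by rewrite /B fineK// ge0_fin_numE ?I2_ge0.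
rewrite -EFinM lee_fin /t invf_div mulrAC ler_pdivrMr// .
by have := mulr_ge0 (ltW e0) B0; lra.
Qed.

Lemma to0_I1MM (c b : nat -> T -> R) :
  (forall n, measurable_fun setT (c n)) -> (forall n, measurable_fun setT (b n)) ->
  to0 (fun n => I2 (c n)) -> to0 (fun n => I2 (b n)) ->
  to0 (fun n => I1 (fun x => c n x * b n x)%R).
Proof.
move=> mc mb c0 b0; apply: to0_le.
  by move=> n; apply: (I1M (mc n) (mb n) ltr01).
by apply: to0D; apply: to0Z => //; rewrite invr_ge0.
Qed.

Lemma I2_tail f (e : R) : L2 f -> (0 < e)%R ->
  exists K : nat, I2 (fun x => if (K%:R < `|f x|)%R then f x else 0%R) <= e%:E.
Proof.
move=> [mf f2] e0.
pose g n x := ((if (n%:R < `|f x|)%R then f x else 0%R) ^+ 2)%:E.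
have mg0 n : measurable_fun setT (fun x => if (n%:R < `|f x|)%R then f x else 0%R).
  apply: measurable_fun_ifT => //.
  by apply: measurable_fun_ltr => //; exact: measurableT_comp.
have mg n : measurable_fun setT (g n).
  by apply/measurable_EFinP; exact: measurable_funX.
have gcvg x : g^~ x @ \oo --> 0.
  apply: cvg_near_cst.
  exists (Num.bound `|f x|) => // n /= nx.
  rewrite /g ltNge (_ : `|f x| <= n%:R)%R /= ?expr0n//.
  by apply: ltW; apply: (lt_le_trans (archi_boundP (normr_ge0 _))); rewrite ler_nat.
have [] := @dominated_convergence _ T R mu setT measurableT g (cst 0)
  (fun x => ((f x) ^+ 2)%:E) mg.
- exact: measurable_cst.
- by apply: aeW => x _; exact: gcvg.
- apply/integrableP; split; first by apply/measurable_EFinP; exact: measurable_funX.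
  apply: le_lt_trans f2; rewrite le_eqVlt; apply/orP; left; apply/eqP.
  by apply: eq_integral => x _; rewrite gee0_abs// lee_fin sqr_ge0.
- apply: aeW => x n _; rewrite /g abse_EFin lee_fin ger0_norm ?sqr_ge0//.
  by case: ifP => // _; rewrite expr0n/= sqr_ge0.
move=> _ _; rewrite integral0 => /cvg0_to0 /(_ _ e0) [K _ /(_ K (leqnn K)) h].
by exists K; exact: h.
Qed.

(** Since [f] may be unbounded, it is cut at a level K: where |f| <= K the bound is K^2 times
    [I2 (b n)], which tends to 0, and where |f| > K the uniform bound B meets a small tail of f. *)
Lemma to0_I2M (B : R) f (b : nat -> T -> R) : L2 f ->
  (forall n, measurable_fun setT (b n)) -> (forall n x, `|b n x| <= B)%R ->
  to0 (fun n => I2 (b n)) -> to0 (fun n => I2 (fun x => b n x * f x)%R).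
Proof.
move=> f2 mb bB b0 e e0; have [mf _] := f2.
have e2 : (0 < e / 2)%R by rewrite divr_gt0.
have B1 : (0 < B ^+ 2 + 1)%R by rewrite ltr_wpDl// sqr_ge0.
have eB : (0 < e / 2 / (B ^+ 2 + 1))%R by rewrite divr_gt0.
have [K hK] := I2_tail f2 eB.
set g := (fun x => _) in hK.
have mg : measurable_fun setT g.
  apply: measurable_fun_ifT => //.
  by apply: measurable_fun_ltr => //; exact: measurableT_comp.
have K2 : (0 <= K%:R ^+ 2 :> R)%R by rewrite sqr_ge0.
have := to0Z K2 b0 e2; apply: filterS => n bn.
have := @I2_lin (K%:R ^+ 2)%R (B ^+ 2)%R (b n) g (fun x => b n x * f x)%R (mb n) mg.
move=> /(_ (measurable_funM (mb n) mf) K2 (sqr_ge0 _)) h.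
apply: (le_trans (h _)) => [x|].
  rewrite exprMn /g; case: ltP => h1.
    rewrite -[leLHS]add0r lerD//; first by rewrite mulr_ge0// sqr_ge0.
    rewrite ler_wpM2r ?sqr_ge0// -(real_normK (num_real (b n x))) lerXn2r ?nnegrE//.
    by apply: le_trans (bB n x).
  rewrite expr0n/= mulr0 addr0 mulrC ler_wpM2r ?sqr_ge0//.
  by rewrite -(real_normK (num_real (f x))) lerXn2r ?nnegrE.
rewrite (splitr e) EFinD; apply: leeD => //.
apply: (@le_trans _ _ ((B ^+ 2)%:E * (e / 2 / (B ^+ 2 + 1))%:E)).
  by apply: lee_wpmul2l => //; rewrite lee_fin sqr_ge0.
by rewrite -EFinM lee_fin mul_div_add1_le// sqr_ge0.
Qed.

(** The limit passage shared by integration by parts and by the Jacobian identity, both of which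
    hold exactly at the discrete level as a vanishing sum of two products. *)
Lemma L2_cv_eq0 (a b : nat -> T -> R) f g (f1 f2 : nat -> T -> R) g1 g2 :
  (forall n, measurable_fun setT (a n)) -> (forall n, measurable_fun setT (b n)) ->
  (forall n, measurable_fun setT (f1 n)) -> (forall n, measurable_fun setT (f2 n)) ->
  L2 f -> L2 g -> L2 g1 -> L2 g2 ->
  to0 (fun n => I2 (fun x => a n x - f x)%R) ->
  to0 (fun n => I2 (fun x => b n x - g x)%R) ->
  to0 (fun n => I2 (fun x => f1 n x - g1 x)%R) ->
  to0 (fun n => I2 (fun x => f2 n x - g2 x)%R) ->
  (forall n, \int[mu]_x (a n x * b n x + f1 n x * f2 n x)%:E = 0) ->
  (forall n, mu.-integrable setT (fun x => (a n x * b n x + f1 n x * f2 n x)%:E)) ->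
  (\int[mu]_x (f x * g x + g1 x * g2 x) = 0)%R.
Proof.
move=> ma mb mf1 mf2 Lf Lg Lg1 Lg2 af bg f1g f2g int0 int1.
have [mf _] := Lf; have [mg _] := Lg; have [mg1 _] := Lg1; have [mg2 _] := Lg2.
pose h x := (f x * g x + g1 x * g2 x)%R.
have ih : mu.-integrable setT (EFin \o h).
  rewrite /h; have := integrableD measurableT (L2_integrableM Lf Lg) (L2_integrableM Lg1 Lg2).
  by apply: eq_integrable => // x _ /=; rewrite EFinD.
(* The discrete integrand minus its limit, expanded so that each product has a factor that tends to
   0 in L2. *)
pose dd n x := ((a n x - f x) * (b n x - g x) + ((a n x - f x) * g x + (b n x - g x) * f x) +
   ((f1 n x - g1 x) * (f2 n x - g2 x) + ((f1 n x - g1 x) * g2 x + (f2 n x - g2 x) * g1 x)))%R.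
have I1D (u v : T -> R) : measurable_fun setT u -> measurable_fun setT v ->
    I1 (fun x => u x + v x)%R <= I1 u + I1 v.
  move=> m1 m2; rewrite -[X in X + _]mul1e -[X in _ + X]mul1e.
  rewrite -ge0_intlin//; try exact: measurableT_comp.
  apply: ge0_intle => //.
  - by apply: measurableT_comp => //; exact: measurable_funD.
  - by apply: measurable_funD; apply: measurable_funM => //; exact: measurableT_comp.
  - by move=> x; rewrite !mul1r ler_normD.
have dd0 : to0 (fun n => I1 (dd n)).
  apply: to0_le; first move=> n.
    apply: (le_trans (I1D _ _ _ _)).
    - by apply: measurable_funD; [|apply: measurable_funD];
        apply: measurable_funM => //; exact: measurable_funB.
    - by apply: measurable_funD; [|apply: measurable_funD];
        apply: measurable_funM => //; exact: measurable_funB.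
    apply: leeD; apply: (le_trans (I1D _ _ _ _)).
    - by apply: measurable_funM => //; exact: measurable_funB.
    - by apply: measurable_funD; apply: measurable_funM => //; exact: measurable_funB.
    - apply: leeD; first exact: lexx.
      apply: (I1D).
      + by apply: measurable_funM => //; exact: measurable_funB.
      + by apply: measurable_funM => //; exact: measurable_funB.
    - by apply: measurable_funM => //; exact: measurable_funB.
    - by apply: measurable_funD; apply: measurable_funM => //; exact: measurable_funB.
    - apply: leeD; first exact: lexx.
      apply: (I1D).
      + by apply: measurable_funM => //; exact: measurable_funB.
      + by apply: measurable_funM => //; exact: measurable_funB.
  apply: to0D; apply: to0D; [|apply: to0D| |apply: to0D].
  - by apply: to0_I1MM => // n; exact: measurable_funB.
  - by apply: to0_I1M => // n; exact: measurable_funB.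
  - by apply: to0_I1M => // n; exact: measurable_funB.
  - by apply: to0_I1MM => // n; exact: measurable_funB.
  - by apply: to0_I1M => // n; exact: measurable_funB.
  - by apply: to0_I1M => // n; exact: measurable_funB.
apply: (to0_cst _ dd0) => n.
have ia : mu.-integrable setT (EFin \o (fun x => a n x * b n x + f1 n x * f2 n x)%R) by exact: int1.
have E : - (\int[mu]_x (h x)%:E) = \int[mu]_x (dd n x)%:E.
  rewrite -[LHS]add0e -(int0 n) -integralB_EFin//.
  by apply: eq_integral => x _; rewrite /= -EFinB /dd /h; congr EFin; ring.
have -> : (`|\int[mu]_x h x|)%:E = `|\int[mu]_x (h x)%:E|.
  by rewrite EFin_normr_Rintegral.
rewrite -abseN E; apply: le_abse_integral => //.
apply/measurable_EFinP; rewrite /dd; apply: measurable_funD; apply: measurable_funD.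
- by apply: measurable_funM => //; exact: measurable_funB.
- by apply: measurable_funD; apply: measurable_funM => //; exact: measurable_funB.
- by apply: measurable_funM => //; exact: measurable_funB.
- by apply: measurable_funD; apply: measurable_funM => //; exact: measurable_funB.
Qed.

End I2.

(** * Translation invariance and Borel sets of the plane *)

Notation plane R := (measurableTypeR R * measurableTypeR R)%type.
Notation mfun2 f := (@measurable_fun _ _ (plane _) _ setT f).

Section Plane.
Variable R : realType.
Implicit Types (f g : R * R -> R) (h : R * R).

Lemma measurable_fst2 : mfun2 (fst : R * R -> R).
Proof. exact: measurable_fst. Qed.

Lemma measurable_snd2 : mfun2 (snd : R * R -> R).
Proof. exact: measurable_snd. Qed.

Definition shift2 h (x : R * R) : R * R := x + h.

Lemma measurable_shift h : @measurable_fun _ _ (plane R) (plane R) setT (shift2 h).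
Proof.
apply/measurable_fun_pairP; split.
- have -> : fst \o shift2 h = fun x => x.1 + h.1 by [].
  by apply: measurable_funD => //; exact: measurable_fst2.
- have -> : snd \o shift2 h = fun x => x.2 + h.2 by [].
  by apply: measurable_funD => //; exact: measurable_snd2.
Qed.

(** The translated measure agrees with Lebesgue measure on half-open intervals, which determine it;
    the planar case follows in the same way from measurable rectangles. *)
Lemma lebesgue_measure_shift (a : R) (A : set R) : measurable A ->
  lebesgue_measure ((fun x : measurableTypeR R => x + a : measurableTypeR R) @^-1` A) = lebesgue_measure A.
Proof.
move=> mA; rewrite -/(pushforward lebesgue_measure (fun x : measurableTypeR R => x + a : measurableTypeR R) A).
apply/esym/lebesgue_measure_unique => //=; first exact: measurable_funD.
move=> mf _ [[c d] _ <-]; rewrite /pushforward /=.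
have -> : (fun x : measurableTypeR R => x + a) @^-1` `]c, d] = `]c - a, d - a]%classic.
  by apply/seteqP; split=> x /=; rewrite !in_itv/= ltrBlDr lerBrDr.
rewrite !lebesgue_measure_itv/= !lte_fin ltrD2r.
by rewrite -!EFinB opprD addrACA subrr addr0.
Qed.

Lemma leb2_shift h (A : set (R * R)) : @measurable _ (plane R) A ->
  leb2 R (shift2 h @^-1` A) = leb2 R A.
Proof.
move=> mA; rewrite -/(pushforward (leb2 R) (shift2 h : plane R -> plane R) A).
apply/esym/product_measure_unique => //=; first exact: measurable_shift.
move=> mf B C mB mC; rewrite /pushforward /=.
have -> : (shift2 h : plane R -> plane R) @^-1` (B `*` C) =
  ((fun x : measurableTypeR R => x + h.1 : measurableTypeR R) @^-1` B) `*` ((fun x : measurableTypeR R => x + h.2 : measurableTypeR R) @^-1` C) by [].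
rewrite /leb2 product_measure1E; first by congr (_ * _)%E; exact: lebesgue_measure_shift.
- rewrite -[X in measurable X]setTI; apply: (measurable_funD _ _ _ mB) => //.
- rewrite -[X in measurable X]setTI; apply: (measurable_funD _ _ _ mC) => //.
Qed.

Lemma ge0_integral_shift h (F : R * R -> \bar R) : mfun2 F -> (forall x, 0 <= F x)%E ->
  (\int[leb2 R]_x F (shift2 h x) = \int[leb2 R]_x F x)%E.
Proof.
move=> mF F0.
have := @ge0_integral_pushforward _ _ (plane R) (plane R) R _ (measurable_shift h) (leb2 R) setT F
  measurableT mF (fun x _ => F0 x).
rewrite preimage_setT => <-.
by apply: eq_measure_integral => /=; [exact: measurable_shift|move=> mf A mA _; exact: leb2_shift].
Qed.

Lemma measurable_fun_shift d (T : measurableType d) h (F : R * R -> T) : mfun2 F -> mfun2 (fun x => F (shift2 h x)).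
Proof. by move=> mF; apply: (measurableT_comp mF); exact: measurable_shift. Qed.

Lemma integrable_shift h (F : R * R -> \bar R) : (leb2 R).-integrable setT F ->
  (leb2 R).-integrable setT (fun x => F (shift2 h x)).
Proof.
move=> /integrableP[mF iF]; apply/integrableP; split.
  exact: measurable_fun_shift.
rewrite (ge0_integral_shift h (F := fun x => `|F x|%E))//.
exact: measurableT_comp.
Qed.

Lemma integral_shift h (F : R * R -> \bar R) : mfun2 F ->
  (\int[leb2 R]_x F (shift2 h x) = \int[leb2 R]_x F x)%E.
Proof.
move=> mF; rewrite integralE [RHS]integralE; congr (_ - _)%E.
- transitivity (\int[leb2 R]_x (F^\+%E (shift2 h x)))%E; first by apply: eq_integral => x _; rewrite !funepos.unlock.
  by apply: ge0_integral_shift => //; exact: measurable_funepos.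
- transitivity (\int[leb2 R]_x (F^\-%E (shift2 h x)))%E; first by apply: eq_integral => x _; rewrite !funeneg.unlock.
  by apply: ge0_integral_shift => //; exact: measurable_funeneg.
Qed.

Lemma I2_shift h f : mfun2 f -> I2 (leb2 R) (fun x => f (shift2 h x)) = I2 (leb2 R) f.
Proof.
move=> mf; rewrite /I2 -(ge0_integral_shift h (F := fun x => ((f x) ^+ 2)%:E))//.
- by apply/measurable_EFinP; exact: measurable_funX.
- by move=> x; rewrite lee_fin sqr_ge0.
Qed.

Lemma L2_shift h f : L2 (leb2 R) f -> L2 (leb2 R) (fun x => f (shift2 h x)).
Proof. by move=> [mf f2]; split; [exact: measurable_fun_shift|rewrite I2_shift]. Qed.

Lemma measurable_box (I J : interval R) : @measurable _ (plane R) ([set` I] `*` [set` J]).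
Proof. by apply: measurableX; exact: measurable_itv. Qed.

(** The sigma-algebra is a product of one-dimensional ones, so an open set is written as a countable
    union of the open boxes with rational corners that it contains. *)
Lemma measurable_open2 (U : set (R * R)) : open U -> @measurable _ (plane R) U.
Proof.
move=> oU.
pose B (a b c d : rat) : set (plane R) := `](ratr a), (ratr b)[ `*` `](ratr c), (ratr d)[.
have -> : U = \bigcup_a \bigcup_b \bigcup_c \bigcup_d
    (if `[< B a b c d `<=` U >] then B a b c d else set0).
  apply/seteqP; split=> [x Ux|x [a _ [b _ [c _ [d _]]]]]; last first.
    by case: ifP => // /asboolP h /h.
  have /nbhs_ballP[e /= e0 xeU] : nbhs x U by exact: open_nbhs_nbhs.
  have [a] := @rat_in_itvoo R (x.1 - e) x.1 ltac:(lra); rewrite in_itv/= => /andP[a1 a2].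
  have [b] := @rat_in_itvoo R x.1 (x.1 + e) ltac:(lra); rewrite in_itv/= => /andP[b1 b2].
  have [c] := @rat_in_itvoo R (x.2 - e) x.2 ltac:(lra); rewrite in_itv/= => /andP[c1 c2].
  have [d] := @rat_in_itvoo R x.2 (x.2 + e) ltac:(lra); rewrite in_itv/= => /andP[d1 d2].
  exists a => //; exists b => //; exists c => //; exists d => //.
  rewrite ifT; first by split => /=; rewrite in_itv/=; apply/andP; split.
  apply/asboolP => y [/=]; rewrite !in_itv/= => /andP[y1 y2] /andP[y3 y4].
  by apply: xeU; split; rewrite /ball/= ltr_norml; apply/andP; split; lra.
do 4 (apply: bigcupT_measurable_rat => ?).
by case: ifP => // _; exact: measurable_box.
Qed.

Lemma continuous_mfun2 f : continuous f -> mfun2 f.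
Proof.
move=> /continuousP cf mD; apply: (measurability _ (RGenOInfty.measurableE R)) => //.
move=> _ [_ [a ->] <-]; rewrite setTI; apply: measurable_open2.
by apply: cf; exact: interval_open.
Qed.

(* Half-open boxes form a pi-system generating the Borel sets of the plane. *)
Lemma box_induction (P : set (set (R * R))) :
  P setT ->
  (forall a b c d : R, P (`]a, b] `*` `]c, d])) ->
  (forall A, @measurable _ (plane R) A -> P A -> P (~` A)) ->
  (forall F : (set (R * R))^nat, (forall n, @measurable _ (plane R) (F n)) ->
     trivIset setT F -> (forall n, P (F n)) -> P (\bigcup_k F k)) ->
  forall A, @measurable _ (plane R) A -> P A.
Proof.
move=> PT Pbox PC PU.
pose G : set (set (plane R)) := [set A `*` B | A in @ocitv R & B in @ocitv R].
(* The whole line is not a bounded half-open interval, so a cylinder over one coordinate is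
   exhausted by the boxes with second side [I_ n]. *)
pose I_ (n : nat) : set R := `](- n%:R), n%:R]%classic.
have GE : @measurable _ (plane R) = <<s G >>.
  rewrite measurable_prod_measurableType; apply/seteqP; split; last first.
    apply: smallest_sub; first exact: smallest_sigma_algebra.
    move=> _ [A mA [B mB <-]]; apply: sub_sigma_algebra; exists A.
      exact: sub_sigma_algebra.
    by exists B => //; exact: sub_sigma_algebra.
  apply: smallest_sub; first exact: smallest_sigma_algebra.
  have UT : \bigcup_n I_ n = setT.
    apply/seteqP; split=> // x _; exists (Num.bound `|x|) => //=.
    have := archi_boundP (normr_ge0 x); rewrite ltr_norml => /andP[h1 h2].
    by rewrite /I_ /= in_itv/= h1 ltW.
  have m1 : @measurable_fun _ _ (g_sigma_algebraType G) (measurableTypeR R) setT fst.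
    move=> mD; apply: (measurability (@ocitv R)) => //.
    move=> _ [A oA <-]; rewrite setTI.
    have -> : fst @^-1` A = \bigcup_n (A `*` I_ n).
      by rewrite -setX_bigcupr UT setXT.
    apply: bigcupT_measurable => n; apply: sub_sigma_algebra.
    by exists A => //; exists (I_ n) => //; exact: is_ocitv.
  have m2 : @measurable_fun _ _ (g_sigma_algebraType G) (measurableTypeR R) setT snd.
    move=> mD; apply: (measurability (@ocitv R)) => //.
    move=> _ [A oA <-]; rewrite setTI.
    have -> : snd @^-1` A = \bigcup_n (I_ n `*` A).
      by rewrite -setX_bigcupl UT setTX.
    apply: bigcupT_measurable => n; apply: sub_sigma_algebra.
    by exists (I_ n); [exact: is_ocitv|exists A].
  move=> _ [A mA [B mB <-]].
  have -> : A `*` B = (fst @^-1` A) `&` (snd @^-1` B) by [].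
  apply: (@measurableI _ (g_sigma_algebraType G)).
  - by rewrite -[X in measurable X]setTI; exact: m1.
  - by rewrite -[X in measurable X]setTI; exact: m2.
move=> A; rewrite GE; apply: (dynkin_induction GE) => //.
- move=> _ _ [A1 o1 [B1 o2 <-]] [A2 o3 [B2 o4 <-]].
  rewrite -setXI; exists (A1 `&` A2); first exact: ocitvI.
  by exists (B1 `&` B2) => //; exact: ocitvI.
- by move=> _ [_ [[a b] _ <-] [_ [[c d] _ <-] <-]]; exact: Pbox.
Qed.

End Plane.

Import HBNNSimple.

(** * Continuity of translations in L2 *)

Section Translation.
Variable R : realType.
Implicit Types (f g : R * R -> R) (h : R * R).
Notation mu := (leb2 R).

Definition translation_continuous g := forall e : R, 0 < e ->
  exists2 d : R, 0 < d & forall h, `|h.1| < d -> `|h.2| < d ->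
    (I2 mu (fun x => g (shift2 h x) - g x)%R <= e%:E)%E.

Notation TC := translation_continuous.

Lemma TC_lim g : mfun2 g ->
  (forall e : R, 0 < e -> exists g', [/\ mfun2 g', TC g' & (I2 mu (fun x => g x - g' x)%R <= e%:E)%E]) ->
  TC g.
Proof.
(* The error g - g' and its translate have the same norm. Applying [I2D] twice gives at most 2 (2
   e/16 + 2 e/16) + 2 e/16 <= e. *)
move=> mg H e e0; have e8 : 0 < e / 16 by lra.
have [g' [mg' tg' gg']] := H _ e8; have [d d0 hd] := tg' _ e8.
exists d => // h h1 h2; have := hd h h1 h2 => H1.
pose a x := g x - g' x; have ma : mfun2 a by exact: measurable_funB.
pose b x := g' (shift2 h x) - g' x.
have mb : mfun2 b by apply: measurable_funB => //; exact: measurable_fun_shift.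
have mas : mfun2 (fun x => a (shift2 h x)) by exact: measurable_fun_shift.
have -> : (fun x => g (shift2 h x) - g x) = (fun x => (a (shift2 h x) - a x) + b x).
  by apply/funext => x; rewrite /a /b; ring.
apply: (le_trans (I2D _ _ _)) => //; first exact: measurable_funB.
have mna : mfun2 (fun x => - a x) by exact: measurableT_comp.
have h3 := I2D mu mas mna; rewrite (I2_shift h ma) in h3.
have h4 : (I2 mu (fun x => - a x)%R <= (e / 16)%:E)%E.
  by apply: le_trans gg'; apply: I2_le => // x; rewrite normrN.
have h5 : (I2 mu (fun x => a (shift2 h x) - a x)%R <= (e / 4)%:E)%E.
  apply: (le_trans h3).
  rewrite (_ : (e / 4)%:E = 2%:E * (e / 16)%:E + 2%:E * (e / 16)%:E)%E; last first.
    by rewrite -!EFinM -EFinD; congr EFin; lra.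
  by apply: leeD; apply: lee_wpmul2l.
rewrite (_ : e%:E = 2%:E * (e / 4)%:E + 2%:E * (e / 4)%:E)%E; last first.
  by rewrite -!EFinM -EFinD; congr EFin; lra.
apply: leeD; apply: lee_wpmul2l => //.
by apply: (le_trans H1); rewrite lee_fin; lra.
Qed.

Lemma TC_lin (a b : R) f g : mfun2 f -> mfun2 g -> TC f -> TC g ->
  TC (fun x => a * f x + b * g x).
Proof.
move=> mf mg tf tg e e0.
have A0 : 0 <= 2 * a ^+ 2 by rewrite mulr_ge0// sqr_ge0.
have B0 : 0 <= 2 * b ^+ 2 by rewrite mulr_ge0// sqr_ge0.
have e2 : 0 < e / 2 by lra.
have [d1 d10 h1] := tf (e / 2 / (2 * a ^+ 2 + 1)) ltac:(by rewrite divr_gt0// ltr_wpDl).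
have [d2 d20 h2] := tg (e / 2 / (2 * b ^+ 2 + 1)) ltac:(by rewrite divr_gt0// ltr_wpDl).
exists (Num.min d1 d2); first by rewrite lt_min d10.
move=> h; rewrite !lt_min => /andP[h11 h12] /andP[h21 h22].
have ms (k : R * R -> R) : mfun2 k -> mfun2 (fun x => k (shift2 h x) - k x).
  by move=> mk; apply: measurable_funB => //; exact: measurable_fun_shift.
have mk : mfun2 (fun x => a * f x + b * g x).
  by apply: measurable_funD; exact: measurable_funM.
have := @I2_lin _ _ _ mu (2 * a ^+ 2) (2 * b ^+ 2) _ _ _ (ms _ mf) (ms _ mg) (ms _ mk) A0 B0.
move=> H; apply: (le_trans (H _)) => [x|].
  set u := f (shift2 h x); set u' := f x; set v := g (shift2 h x); set v' := g x.
  have := sqr_ge0 (a * (u - u') - b * (v - v')); nra.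
rewrite (splitr e) EFinD; apply: leeD.
- apply: (@le_trans _ _ ((2 * a ^+ 2)%:E * (e / 2 / (2 * a ^+ 2 + 1))%:E)%E).
    by apply: lee_wpmul2l; [rewrite lee_fin|exact: h1].
  by rewrite -EFinM lee_fin mul_div_add1_le.
- apply: (@le_trans _ _ ((2 * b ^+ 2)%:E * (e / 2 / (2 * b ^+ 2 + 1))%:E)%E).
    by apply: lee_wpmul2l; [rewrite lee_fin|exact: h2].
  by rewrite -EFinM lee_fin mul_div_add1_le.
Qed.

Lemma leb2_box (a b c d : R) (x1 x2 x3 x4 : bool) : a <= b -> c <= d ->
  mu ([set` Interval (BSide x1 a) (BSide x2 b)] `*` [set` Interval (BSide x3 c) (BSide x4 d)])
  = ((b - a) * (d - c))%:E.
Proof.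
move=> ab cd.
transitivity (lebesgue_measure [set` Interval (BSide x1 a) (BSide x2 b)] *
  lebesgue_measure [set` Interval (BSide x3 c) (BSide x4 d)])%E.
  by apply: product_measure1E; exact: measurable_itv.
rewrite !lebesgue_measure_itv /= !lte_fin EFinM; congr (_ * _)%E.
- by case: ltgtP ab => // -> _; rewrite subrr.
- by case: ltgtP cd => // -> _; rewrite subrr.
Qed.

Lemma int_indic (A : set (R * R)) : @measurable _ (plane R) A ->
  (\int[mu]_x (\1_A x)%:E = mu A)%E.
Proof. by move=> mA; have := integral_indic mu measurableT mA; rewrite setIT. Qed.

Lemma int_indicD (A B C D : set (R * R)) :
  @measurable _ (plane R) A -> @measurable _ (plane R) B ->
  @measurable _ (plane R) C -> @measurable _ (plane R) D ->
  (\int[mu]_x ((\1_A x + \1_B x) + (\1_C x + \1_D x))%R%:E = (mu A + mu B) + (mu C + mu D))%E.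
Proof.
have mi (E : set (plane R)) : @measurable _ (plane R) E -> mfun2 (\1_E : _ -> R).
  by move=> mE; exact: measurable_indic.
have i0 (E : set (plane R)) x : 0 <= \1_E x :> R by rewrite indicE.
have add (f g : R * R -> R) : mfun2 f -> mfun2 g -> (forall x, 0 <= f x) ->
    (forall x, 0 <= g x) ->
    (\int[mu]_x (f x + g x)%R%:E = \int[mu]_x (f x)%:E + \int[mu]_x (g x)%:E)%E.
  move=> mf mg f0 g0; have := @ge0_intlin _ _ _ mu 1 1 f g mf mg ler01 ler01 f0 g0.
  by rewrite !mul1e => <-; apply: eq_integral => x _; rewrite !mul1r.
move=> mA mB mC mD.
rewrite add; last 4 first.
- by apply: measurable_funD; exact: mi.
- by apply: measurable_funD; exact: mi.
- by move=> x; rewrite addr_ge0.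
- by move=> x; rewrite addr_ge0.
by rewrite !add ?int_indic//; exact: mi.
Qed.

Lemma I2_indic (A : set (R * R)) : @measurable _ (plane R) A -> I2 mu \1_A = mu A.
Proof.
move=> mA; rewrite -(int_indic mA); apply: eq_integral => x _.
by rewrite indicE; case: (x \in A); rewrite ?expr1n// expr0n.
Qed.

(** The four excluded rectangles are strips of half-width [D] around the sides of the box with
    corners (a, c) and (b, d). *)
Lemma frame_inner (a b c d D x y : R) :
  ~~ ((a - D <= x <= a + D) && (c - D <= y <= d + D)) ->
  ~~ ((b - D <= x <= b + D) && (c - D <= y <= d + D)) ->
  ~~ ((a - D <= x <= b + D) && (c - D <= y <= c + D)) ->
  ~~ ((a - D <= x <= b + D) && (d - D <= y <= d + D)) ->
  a - D <= x <= b + D -> c - D <= y <= d + D ->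
  (a + D < x < b - D) && (c + D < y < d - D).
Proof.
move=> n1 n2 n3 n4 /andP[x1 x2] /andP[y1 y2].
apply/andP; split; apply/andP; split; rewrite ltNge.
- by apply: contra n1 => ?; rewrite x1 y1 y2 !andbT.
- by apply: contra n2 => ?; rewrite x2 y1 y2 !andbT.
- by apply: contra n3 => ?; rewrite x1 x2 y1.
- by apply: contra n4 => ?; rewrite x1 x2 y2 !andbT.
Qed.

(** A point off the strips is too far from the sides for a shift shorter than [D] to carry it across
    one of them. *)
Lemma frame_mem (a b c d D x y h k : R) : - D < h < D -> - D < k < D ->
  ~~ ((a - D <= x <= a + D) && (c - D <= y <= d + D)) ->
  ~~ ((b - D <= x <= b + D) && (c - D <= y <= d + D)) ->
  ~~ ((a - D <= x <= b + D) && (c - D <= y <= c + D)) ->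
  ~~ ((a - D <= x <= b + D) && (d - D <= y <= d + D)) ->
  (a < x + h <= b) && (c < y + k <= d) = (a < x <= b) && (c < y <= d).
Proof.
move=> /andP[h1 h2] /andP[k1 k2] n1 n2 n3 n4.
have I := frame_inner n1 n2 n3 n4; clear n1 n2 n3 n4.
apply/idP/idP => /andP[/andP[y1 y2] /andP[y3 y4]].
- have /andP[/andP[z1 z2] /andP[z3 z4]] : (a + D < x < b - D) && (c + D < y < d - D).
    by apply: I; clear -h1 h2 k1 k2 y1 y2 y3 y4; apply/andP; split; lra.
  by clear -z1 z2 z3 z4 h1 h2 k1 k2; apply/andP; split; apply/andP; split; lra.
- have /andP[/andP[z1 z2] /andP[z3 z4]] : (a + D < x < b - D) && (c + D < y < d - D).
    by apply: I; clear -h1 h2 k1 k2 y1 y2 y3 y4; apply/andP; split; lra.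
  by clear -z1 z2 z3 z4 h1 h2 k1 k2; apply/andP; split; apply/andP; split; lra.
Qed.

(** The left side equals 4 D ((b - a) + (d - c)) + 16 D^2, and [D <= 1] turns D^2 into D. *)
Lemma frame_area (a b c d D e : R) : 0 < D -> D <= 1 -> a < b -> c < d ->
  8 * D * ((b - a) + (d - c) + 2) <= e ->
  (a + D - (a - D)) * (d + D - (c - D)) + (b + D - (b - D)) * (d + D - (c - D)) +
  ((b + D - (a - D)) * (c + D - (c - D)) + (b + D - (a - D)) * (d + D - (d - D))) <= e.
Proof.
move=> D0 D1 ab cd; apply: le_trans.
have p0 : 0 <= D * ((b - a) + (d - c)) by apply: mulr_ge0; lra.
have p1 : D * D <= D by rewrite -[leRHS]mulr1 ler_wpM2l// ltW.
lra.
Qed.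

(** The indicator and its translate differ only in a thin frame around the boundary, so the squared
    difference is at most the sum of the indicators of four strips, whose areas are of the order of
    the shift. *)
Lemma TC_box (a b c d : R) : TC \1_(`]a, b] `*` `]c, d]).
Proof.
set B := _ `*` _; have mB : @measurable _ (plane R) B by exact: measurable_box.
have [ab|ba] := ltP a b; last first.
  have -> : B = set0 by rewrite /B set_itv_ge ?set0X// bnd_simp -leNgt.
  move=> e e0; exists 1 => // h _ _; rewrite indic0 /I2.
  by rewrite (eq_integral (cst 0%E)) ?integral0 ?lee_fin ?ltW// => x _; rewrite subr0 expr0n.
have [cd|dc] := ltP c d; last first.
  have -> : B = set0 by rewrite /B [X in _ `*` X]set_itv_ge ?setX0// bnd_simp -leNgt.
  move=> e e0; exists 1 => // h _ _; rewrite indic0 /I2.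
  by rewrite (eq_integral (cst 0%E)) ?integral0 ?lee_fin ?ltW// => x _; rewrite subr0 expr0n.
move=> e e0; pose L := (b - a) + (d - c) + 2.
have L0 : 0 < 8 * L + 1 by rewrite /L; lra.
(* [8 * L] is the constant in [frame_area], which also asks for a width of at most 1. *)
exists (Num.min 1 (e / (8 * L + 1))); first by rewrite lt_min ltr01 divr_gt0.
move=> h; set D := Num.min _ _ => h1 h2.
have D1 : D <= 1 by rewrite ge_min lexx.
have D0 : 0 < D by apply: le_lt_trans h1.
have De : 8 * D * L <= e.
  have : D <= e / (8 * L + 1) by rewrite ge_min lexx orbT.
  rewrite ler_pdivlMr//; rewrite /L in L0 *; nra.
pose s1 : set (plane R) := `[a - D, a + D] `*` `[c - D, d + D].
pose s2 : set (plane R) := `[b - D, b + D] `*` `[c - D, d + D].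
pose s3 : set (plane R) := `[a - D, b + D] `*` `[c - D, c + D].
pose s4 : set (plane R) := `[a - D, b + D] `*` `[d - D, d + D].
have ms i : @measurable _ (plane R) (nth set0 [:: s1; s2; s3; s4] i).
  by do 4?[case: i => [|i]//; first exact: measurable_box]; rewrite /= nth_nil.
have mi (A : set (plane R)) : @measurable _ (plane R) A -> mfun2 (\1_A : _ -> R).
  by move=> mA; exact: measurable_indic.
pose k x : R := (1 * \1_s1 x + 1 * \1_s2 x) + (1 * \1_s3 x + 1 * \1_s4 x).
have i0 (A : set (plane R)) x : 0 <= \1_A x :> R by rewrite indicE.
have memB (y : R * R) : (y \in B) = (a < y.1 <= b) && (c < y.2 <= d).
  by rewrite in_setX !mem_setE !in_itv.
have bnd x : (\1_B (shift2 h x) - \1_B x) ^+ 2 <= k x :> R.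
  have le1 : (\1_B (shift2 h x) - \1_B x) ^+ 2 <= 1 :> R.
    by rewrite !indicE; case: (_ \in _); case: (_ \in _);
      rewrite ?subrr ?subr0 ?sub0r ?sqrrN ?expr1n ?expr0n.
  have p1 := i0 s1 x; have p2 := i0 s2 x; have p3 := i0 s3 x; have p4 := i0 s4 x.
  have k1 : x \in s1 -> 1 <= k x.
    by move=> sx; rewrite /k !mul1r [X in X + _ + _]indicE sx -addrA lerDl !addr_ge0.
  have k2 : x \in s2 -> 1 <= k x.
    by move=> sx; rewrite /k !mul1r [X in _ + X + _]indicE sx addrAC lerDr !addr_ge0.
  have k3 : x \in s3 -> 1 <= k x.
    by move=> sx; rewrite /k !mul1r [X in _ + (X + _)]indicE sx addrCA lerDl !addr_ge0.
  have k4 : x \in s4 -> 1 <= k x.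
    by move=> sx; rewrite /k !mul1r [X in _ + (_ + X)]indicE sx addrA lerDr !addr_ge0.
  have [s1x|s1x] := boolP (x \in s1); first exact: le_trans (k1 s1x).
  have [s2x|s2x] := boolP (x \in s2); first exact: le_trans (k2 s2x).
  have [s3x|s3x] := boolP (x \in s3); first exact: le_trans (k3 s3x).
  have [s4x|s4x] := boolP (x \in s4); first exact: le_trans (k4 s4x).
  suff -> : \1_B (shift2 h x) = \1_B x :> R.
    by rewrite subrr expr0n /k !mul1r !addr_ge0.
  have E1 : (shift2 h x).1 = x.1 + h.1 by [].
  have E2 : (shift2 h x).2 = x.2 + h.2 by [].
  rewrite !indicE !memB E1 E2; congr (_ %:R); congr nat_of_bool.
  rewrite !in_setX !mem_setE !in_itv/= in s1x s2x s3x s4x.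
  by apply: frame_mem s1x s2x s3x s4x; rewrite -ltr_norml.
have m1 : @measurable _ (plane R) s1 := ms 0%N.
have m2 : @measurable _ (plane R) s2 := ms 1%N.
have m3 : @measurable _ (plane R) s3 := ms 2%N.
have m4 : @measurable _ (plane R) s4 := ms 3%N.
apply: (@le_trans _ _ (\int[mu]_x ((\1_s1 x + \1_s2 x) + (\1_s3 x + \1_s4 x))%R%:E)%E).
  apply: ge0_intle.
  - apply: measurable_funX; apply: measurable_funB; last exact: mi.
    exact: (measurable_fun_shift h (mi _ mB)).
  - by apply: measurable_funD; apply: measurable_funD; exact: mi.
  - by move=> x; exact: sqr_ge0.
  - by move=> x; have := bnd x; rewrite /k !mul1r.
rewrite (int_indicD m1 m2 m3 m4).
have DD : - D <= D by rewrite (le_trans _ (ltW D0))// oppr_le0 ltW.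
have ab1 := ltW ab; have cd1 := ltW cd.
rewrite !leb2_box ?lerD//.
by rewrite -!EFinD lee_fin frame_area.
Qed.

Lemma TC_cst0 : TC (fun=> 0).
Proof.
move=> e e0; exists 1 => // h _ _; rewrite /I2.
by rewrite (eq_integral (cst 0%E)) ?integral0 ?lee_fin ?ltW// => x _; rewrite subrr expr0n.
Qed.

(** Continuity is asked for only where the coefficient is nonzero: the level set of the value 0 of a
    simple function may have infinite measure. *)
Lemma TC_sum n (c : 'I_n -> R) (F : 'I_n -> R * R -> R) :
  (forall i, mfun2 (F i)) -> (forall i, c i != 0 -> TC (F i)) ->
  TC (fun x => \sum_(i < n) c i * F i x).
Proof.
elim: n c F => [|n IH] c F mF TF.
  rewrite [X in TC X](_ : _ = fun=> 0); first exact: TC_cst0.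
  by apply/funext => x; rewrite big_ord0.
rewrite [X in TC X](_ : _ = fun x => 1 * (\sum_(i < n) c (widen_ord (leqnSn n) i) * F (widen_ord (leqnSn n) i) x) + c ord_max * F ord_max x); last first.
  by apply/funext => x; rewrite big_ord_recr /= mul1r.
have ms : mfun2 (fun x => \sum_(i < n) c (widen_ord (leqnSn n) i) * F (widen_ord (leqnSn n) i) x).
  by apply: measurable_sum => i; exact: measurable_funM.
have [c0|c0] := eqVneq (c ord_max) 0.
  rewrite c0 [X in TC X](_ : _ = fun x => \sum_(i < n) c (widen_ord (leqnSn n) i) * F (widen_ord (leqnSn n) i) x); last first.
    by apply/funext => x; rewrite mul1r mul0r addr0.
  by apply: IH => // i; exact: TF.
apply: TC_lin => //; last exact: TF.
by apply: IH => // i; exact: TF.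
Qed.

(** Half-open, so that it is one of the boxes of [box_induction] and [TC_box]. *)
Definition square n : set (plane R) := `]- n%:R, n%:R] `*` `]- n%:R, n%:R].

Lemma measurable_square n : @measurable _ (plane R) (square n).
Proof. exact: measurable_box. Qed.

Lemma square_cvg (x : R * R) : \forall n \near \oo, x \in square n.
Proof.
exists (Num.bound (`|x.1| + `|x.2|)) => // n /= nx; rewrite inE.
have : `|x.1| + `|x.2| < n%:R.
  by apply: (lt_le_trans (archi_boundP _)); rewrite ?addr_ge0// ler_nat.
have := normr_ge0 x.1; have := normr_ge0 x.2 => h1 h2 h3.
have : `|x.1| < n%:R by lra. rewrite ltr_norml => /andP[? ?].
have : `|x.2| < n%:R by lra. rewrite ltr_norml => /andP[? ?].
by split; rewrite /= in_itv/=; apply/andP; split; lra.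
Qed.

Lemma L2_dominated g (u : nat -> R * R -> R) : L2 mu g -> (forall n, mfun2 (u n)) ->
  (forall n x, `|g x - u n x| <= `|g x|) -> (forall x, u n x @[n --> \oo] --> g x) ->
  to0 (fun n => I2 mu (fun x => g x - u n x)).
Proof.
move=> [mg g2] mu_ ug ucv; apply: cvg0_to0.
have [] := @dominated_convergence _ _ R mu setT measurableT
  (fun n x => ((g x - u n x) ^+ 2)%:E) (cst 0%E) (fun x => ((g x) ^+ 2)%:E).
- by move=> n; apply/measurable_EFinP; apply: measurable_funX; exact: measurable_funB.
- exact: measurable_cst.
- apply: aeW => x _; apply: cvg_EFin; first by near=> n.
  rewrite [X in _ --> X](_ : _ = (g x - g x) ^+ 2); last by rewrite subrr expr0n.
  under eq_fun do rewrite /= expr2; rewrite expr2.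
  have h : (g x - u n x) @[n --> \oo] --> g x - g x by apply: cvgB => //; exact: cvg_cst.
  exact: (cvgM h h).
- apply/integrableP; split; first by apply/measurable_EFinP; exact: measurable_funX.
  apply: le_lt_trans g2; rewrite le_eqVlt; apply/orP; left; apply/eqP.
  by apply: eq_integral => x _; rewrite gee0_abs// lee_fin sqr_ge0.
- apply: aeW => x n _; rewrite abse_EFin lee_fin ger0_norm ?sqr_ge0//.
  by rewrite -(real_normK (num_real (g x - u n x))) -(real_normK (num_real (g x))) lerXn2r ?nnegrE.
by move=> _ _; rewrite integral0.
Unshelve. all: by end_near. Qed.

Lemma TC_dominated g (u : nat -> R * R -> R) : L2 mu g -> (forall n, mfun2 (u n)) ->
  (forall n x, `|g x - u n x| <= `|g x|) -> (forall x, u n x @[n --> \oo] --> g x) ->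
  (forall n, TC (u n)) -> TC g.
Proof.
move=> g2 mu_ ug ucv tu; apply: TC_lim => [|e e0]; first by case: g2.
have [n _ hn] := L2_dominated g2 mu_ ug ucv e0.
by exists (u n); split => //; exact: (hn n (leqnn n)).
Qed.

Lemma L2_indic (A : set (plane R)) : measurable A -> (mu A < +oo)%E -> L2 mu \1_A.
Proof. by move=> mA fA; split; [exact: measurable_indic|rewrite I2_indic]. Qed.

Lemma square_fin n : (mu (square n) < +oo)%E.
Proof.
have h : - n%:R <= n%:R :> R by have := ler0n R n; lra.
by rewrite leb2_box// ltry.
Qed.

Lemma boxI_square n (a b c d : R) : exists a' b' c' d' : R,
  (`]a, b] `*` `]c, d]) `&` square n = `]a', b'] `*` `]c', d'].
Proof.
have [[a' b'] _ /= E1] : ocitv (`]a, b] `&` `](- n%:R : R), n%:R]) by apply: ocitvI; exact: is_ocitv.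
have [[c' d'] _ /= E2] : ocitv (`]c, d] `&` `](- n%:R : R), n%:R]) by apply: ocitvI; exact: is_ocitv.
by exists a', b', c', d'; rewrite E1 E2 -setXI.
Qed.

(** Inside a square of finite measure a complement is a difference of two indicators, and a disjoint
    union is an L2 limit of finite sums, so the sets with this property are closed under the
    operations of [box_induction]. *)
Lemma TC_indic_square n (A : set (plane R)) : measurable A -> TC \1_(A `&` square n).
Proof.
have mQ := measurable_square n.
move: A; apply: box_induction.
- by rewrite setTI; exact: TC_box.
- move=> a b c d; have [a' [b' [c' [d' ->]]]] := boxI_square n a b c d.
  exact: TC_box.
- move=> A mA tA; rewrite [X in TC X](_ : _ = fun x => 1 * \1_(square n) x + (-1) * \1_(A `&` square n) x); last first.
    apply/funext => x; rewrite !indicE !in_setI in_setC; case: (x \in A); case: (x \in square n) => /=; ring.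
  have m1 : mfun2 (\1_(square n) : _ -> R) by exact: measurable_indic.
  have m2 : mfun2 (\1_(A `&` square n) : _ -> R).
    by apply: measurable_indic; exact: measurableI.
  by apply: (TC_lin _ _ m1 m2 _ tA); exact: TC_box.
- move=> F mF tF TF.
  have mU : @measurable _ (plane R) (\bigcup_k F k) by exact: bigcupT_measurable.
  pose u m (x : R * R) : R := \sum_(i < m) 1 * \1_(F i `&` square n) x.
  (* By disjointness [x] lies in at most one [F i0], so its partial sums change at most once, at
     [m = i0 + 1]. *)
  have U01 x : (exists i0, u^~ x = fun m => ((i0 < m)%N && (x \in square n))%:R) /\ x \in \bigcup_k F k
      \/ u^~ x = (fun=> 0) /\ x \notin \bigcup_k F k.
    have [[i0 _ xi0]|nU] := pselect ((\bigcup_k F k) x); [left|right]; split; last 2 first.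
    - apply/funext => m; rewrite /u big1// => i _.
      rewrite indicE in_setI memNset ?mulr0// => Fx; apply: nU; by exists i.
    - by apply/negP; rewrite inE.
    - exists i0; apply/funext => m; rewrite /u.
      have E (i : 'I_m) : 1 * \1_(F i `&` square n) x = ((val i == i0) && (x \in square n))%:R :> R.
        rewrite mul1r indicE in_setI; congr (_ && _)%:R.
        have [->|ne] := eqVneq (val i) i0; first by rewrite mem_set.
        apply/negP; rewrite inE => xi; move/trivIsetP : tF => /(_ _ _ I I ne).
        by apply/eqP/set0P; exists x.
      under eq_bigr do rewrite E.
      have [im|im] := ltnP i0 m.
        rewrite (bigD1 (Ordinal im))//= eqxx big1 ?addr0// => i /eqP ne.
        by case: eqP => // ii; case: ne; apply/val_inj.
      rewrite big1// => i _; case: eqP => // ii.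
      by have := ltn_ord i; rewrite ii ltnNge im.
    - by rewrite inE; exists i0.
  apply: (@TC_dominated _ u).
  + apply: L2_indic; first exact: measurableI.
    apply: le_lt_trans (square_fin n); apply: le_measure; rewrite ?inE//; exact: measurableI.
  + by move=> m; apply: measurable_sum => i; apply: measurable_funM => //; apply: measurable_indic; exact: measurableI.
  + move=> m x; rewrite indicE in_setI.
    case: (U01 x) => [[[i0 /(congr1 (@^~ m)) /= ->] ->]|[/(congr1 (@^~ m)) /= -> /negbTE ->]].
      by case: (i0 < m)%N; case: (x \in square n); rewrite /= ?mulr1n ?mulr0n ?subrr ?subr0 ?normr0 ?normr_ge0 ?lexx.
    by rewrite /= ?mulr0n subrr normr0.
  + move=> x; apply: cvg_near_cst; rewrite indicE in_setI.
    case: (U01 x) => [[[i0 uE] ->]|[uE /negbTE ->]].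
      exists i0.+1 => // m im; have /= -> := congr1 (@^~ m) uE.
      by rewrite (leq_trans _ im).
    by apply: nearW => m; have /= -> := congr1 (@^~ m) uE.
  + move=> m; apply: TC_sum => [i|i _]; last exact: TF.
    by apply: measurable_indic; exact: measurableI.
Qed.

Lemma TC_indic (A : set (plane R)) : measurable A -> (mu A < +oo)%E -> TC \1_A.
Proof.
move=> mA fA; apply: (@TC_dominated _ (fun n => \1_(A `&` square n))).
- exact: L2_indic.
- by move=> n; apply: measurable_indic; apply: measurableI => //; exact: measurable_square.
- move=> n x; rewrite !indicE in_setI; case: (x \in A); case: (x \in square n) => /=;
  by rewrite ?subrr ?subr0 ?normr0.
- move=> x; apply: cvg_near_cst; have := square_cvg x; apply: filterS => n xn.
  by rewrite !indicE in_setI xn andbT.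
- by move=> n; exact: TC_indic_square.
Qed.

Lemma TC_ge0 g : L2 mu g -> (forall x, 0 <= g x) -> TC g.
Proof.
move=> g2 g0; have [mg _] := g2.
have mgE : measurable_fun [set: plane R] (EFin \o g) by exact/measurable_EFinP.
pose u := nnsfun_approx measurableT mgE.
have gE0 x : [set: plane R] x -> (0 <= (EFin \o g) x)%E by rewrite lee_fin.
have ug n x : u n x <= g x.
  by rewrite -lee_fin /u nnsfun_approxE; exact: le_approx.
apply: (@TC_dominated _ u) => //.
- by move=> n x; rewrite !ger0_norm ?subr_ge0// gerBl.
- by move=> x; have /fine_cvgP[_] := cvg_nnsfun_approx measurableT mgE gE0 (x := x) I.
- move=> n; rewrite [X in TC X](funext (fimfunEord (u n))).
  apply: TC_sum => [i|i c0].
    by apply: measurable_indic; exact: measurable_sfunP.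
  set A := _ @^-1` _; have mA : @measurable _ (plane R) A by exact: measurable_sfunP.
  apply: TC_indic => //; rewrite -I2_indic//.
  move: c0 @A mA; set c := _`_i => c0 A mA.
  suff [] : L2 mu \1_A by [].
  (* Chebyshev: on the level set of the value c > 0 one has g >= c, so the indicator is at most g /
     c. *)
  apply: (L2_le _ (L2Z c^-1 g2)) => [|x]; first exact: measurable_indic.
  rewrite indicE; have [|] := boolP (x \in A); rewrite ?normr0// inE /A /= => ux.
  have cg : c <= g x by rewrite -ux.
  have c1 : 0 < c by rewrite lt_def c0 -ux; exact: fun_ge0.
  have h1 : 1 <= c^-1 * g x by rewrite mulrC ler_pdivlMr// mul1r.
  by rewrite normr1 (le_trans h1)// ler_norm.
Qed.

Theorem L2_translation_continuous g : L2 mu g -> TC g.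
Proof.
move=> g2; have [mg _] := g2.
have mp : mfun2 (fun x => Num.max (g x) 0) by exact: measurable_maxr.
have mn : mfun2 (fun x => Num.max (- g x) 0).
  by apply: measurable_maxr => //; exact: measurableT_comp.
rewrite [X in TC X](_ : _ = fun x => 1 * Num.max (g x) 0 + (-1) * Num.max (- g x) 0); last first.
  by apply/funext => x; rewrite /Num.max; do 2 case: ltP => ?; lra.
have le z : `|Num.max z 0| <= `|z| :> R.
  by rewrite /Num.max; case: ltP => ?; rewrite ?normr0.
apply: TC_lin => //; apply: TC_ge0.
- exact: L2_le mp g2 _.
- by move=> x; rewrite le_max lexx orbT.
- by apply: (L2_le mn g2) => x; rewrite -(normrN (g x)).
- by move=> x; rewrite le_max lexx orbT.
Qed.

End Translation.

(** * Smooth functions and cutoffs *)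

(** Gives directional derivatives access to the one-variable chain rule and to the fundamental
    theorem of calculus. *)
Lemma is_derive_line (R : numFieldType) (V W : normedModType R) (f : V -> W)
    (x v : V) (t : R) (df : W) :
  is_derive (t *: v + x) v f df <-> is_derive t 1 (fun h : R => f (h *: v + x)) df.
Proof.
have E : (fun h : R => h^-1 *: ((f \o shift (t *: v + x)) (h *: v) - f (t *: v + x))) =
    (fun h => h^-1 *: (((fun h : R => f (h *: v + x)) \o shift t) (h *: 1) - f (t *: v + x))).
  apply/funext => h /=; congr (_ *: (f _ - _)).
  by rewrite addrA scalerDl [_%:A]mulr1.
by split=> -[d1 d2]; apply: DeriveDef; rewrite /derivable /derive ?E // -?E.
Qed.

Section CkCalculus.
Variable R : realType.
Implicit Types (f g : R * R -> R) (k : nat) (i : 'I_2).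

Lemma Ck_continuous k f : Ck k f -> continuous f.
Proof. by case: k => [|k] []. Qed.

Lemma Ck_derivable k f i x : Ck k.+1 f -> derivable f x (ebase R i).
Proof. by move=> [_ /(_ i)[]]. Qed.

Lemma Ck_partial k f i : Ck k.+1 f -> Ck k (partial i f).
Proof. by move=> [_ /(_ i)[]]. Qed.

Lemma Ck_pred k f : Ck k.+1 f -> Ck k f.
Proof.
elim: k f => [|k IH] f [cf df]; first by split.
by split=> // i; have [d1 d2] := df i; split => //; exact: IH.
Qed.

Lemma Ck_cst k (c : R) : Ck k (fun=> c).
Proof.
elim: k c => [|k IH] c; first by split => // ?; exact: cvg_cst.
split; first by move=> ?; exact: cvg_cst.
move=> i; split => [x|]; first exact: derivable_cst.
have -> : partial i (fun=> c : R) = fun=> 0.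
  by apply/funext => x; rewrite /partial derive_cst.
exact: IH.
Qed.

Lemma CkD k f g : Ck k f -> Ck k g -> Ck k (fun x => f x + g x).
Proof.
elim: k f g => [|k IH] f g [cf df] [cg dg].
  by split => // x; apply: cvgD; [exact: cf|exact: cg].
split; first by move=> x; apply: cvgD; [exact: cf|exact: cg].
move=> i; have [f1 f2] := df i; have [g1 g2] := dg i.
split => [x|]; first exact: derivableD.
have -> : partial i (fun x => f x + g x) = fun x => partial i f x + partial i g x.
  by apply/funext => x; rewrite /partial -deriveD.
exact: IH.
Qed.

Lemma partialM f g i x : derivable f x (ebase R i) -> derivable g x (ebase R i) ->
  partial i (fun x => f x * g x) x = f x * partial i g x + partial i f x * g x.
Proof. by move=> df dg; rewrite /partial (deriveM df dg) [X in _ + X]mulrC. Qed.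

Lemma CkM k f g : Ck k f -> Ck k g -> Ck k (fun x => f x * g x).
Proof.
elim: k f g => [|k IH] f g cf cg.
  by split => // x; apply: cvgM; [exact: cf.1|exact: cg.1].
split; first by move=> x; apply: cvgM; [exact: cf.1|exact: cg.1].
move=> i; have [f1 f2] := cf.2 i; have [g1 g2] := cg.2 i.
split => [x|]; first exact: derivableM.
have -> : partial i (fun x => f x * g x) = fun x => f x * partial i g x + partial i f x * g x.
  by apply/funext => x; exact: partialM.
by apply: CkD; apply: IH => //; exact: Ck_pred.
Qed.

Lemma CkV k f : (forall x, f x != 0) -> Ck k f -> Ck k (fun x => (f x)^-1).
Proof.
move=> f0; elim: k => [|k IH] cf.
  by split => // x; apply: cvgV => //; exact: cf.1.
split; first by move=> x; apply: cvgV => //; exact: cf.1.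
move=> i; have [f1 f2] := cf.2 i.
split => [x|]; first exact: derivableV.
have -> : partial i (fun x => (f x)^-1) = fun x => (-1) * ((f x)^-1 * (f x)^-1) * partial i f x.
  by apply/funext => x; rewrite /partial deriveV// expr2 invfM mulN1r.
have iV : Ck k (fun x => (f x)^-1) by apply: IH; exact: Ck_pred.
by apply: CkM => //; apply: CkM; [exact: Ck_cst|exact: CkM].
Qed.

Definition linf (c : R * R) (d : R) (x : R * R) : R := c.1 * x.1 + c.2 * x.2 + d.

Lemma continuous_linf c d : continuous (linf c d).
Proof.
move=> x; apply: cvgD; last exact: cvg_cst.
apply: cvgD; apply: cvgM; try exact: cvg_cst.
- exact: cvg_fst.
- exact: cvg_snd.
Qed.

(** The functions p(1/x) exp(-1/x), extended by 0 to x <= 0. The polynomial factor makes the family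
    stable under differentiation, with p replaced by X^2 (p - p'), so smoothness is an induction. *)
Definition flat (p : {poly R}) (x : R) : R :=
  if 0 < x then p.[x^-1] * expR (- x^-1) else 0.

(** Each monomial satisfies y^i exp(-y) <= i! for y >= 0. Boundedness is what yields the derivative
    at 0. *)
Lemma flat_le (p : {poly R}) : exists2 C : R, 0 <= C & forall x, `|flat p x| <= C.
Proof.
exists (\sum_(i < size p) `|p`_i| * i`!%:R).
  by apply: sumr_ge0 => i _; rewrite mulr_ge0// ler0n.
move=> x; rewrite /flat; case: ltP => x0; last first.
  by rewrite normr0; apply: sumr_ge0 => i _; rewrite mulr_ge0// ler0n.
have y0 : 0 <= x^-1 by rewrite invr_ge0 ltW.
move: (x^-1) y0 => y y0; rewrite horner_coef mulr_suml.
apply: (le_trans (ler_norm_sum _ _ _)); apply: ler_sum => i _.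
rewrite -mulrA normrM ler_wpM2l// ger0_norm; last first.
  by rewrite mulr_ge0 ?expR_ge0// exprn_ge0.
rewrite expRN ler_pdivrMr ?expR_gt0//.
case: (nat_of_ord i) => [|n]; first by rewrite expr0 fact0 mul1r (le_trans _ (expR_ge1Dx y))// lerDl.
have := expR_ge1Dxn n y0 => h.
rewrite -ler_pdivrMl ?ltr0n ?fact_gt0//; rewrite mulrC; apply: le_trans h.
by rewrite lerDr.
Qed.

Lemma is_derive_flat (p : {poly R}) (x : R) :
  is_derive x 1 (flat p) (flat ('X^2 * (p - p^`())) x).
Proof.
have [x0|x0|x0] := ltgtP x 0.
- rewrite [X in is_derive _ _ _ X](_ : _ = 0); last by rewrite /flat ltNge ltW.
  apply: (@near_eq_is_derive _ _ _ (cst 0)).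
  near=> y; rewrite /flat ltNge ltW//=.
  by near: y; exact: lt_nbhsl.
- have xn0 : x != 0 by rewrite gt_eqF.
  have dV : is_derive x 1 (fun y : R => y^-1) (- x ^- 2 *: 1) by exact: is_deriveV.
  have d1 : is_derive x 1 (horner p \o (fun y : R => y^-1)) (p^`().[x^-1] * (- x ^- 2 *: 1)).
    exact: is_derive1_comp.
  have d2 : is_derive x 1 (expR \o (fun y : R => - y^-1)) (expR (- x^-1) * (- (- x ^- 2 *: 1))).
    by apply: is_derive1_comp.
  have d3 := is_deriveM d1 d2.
  rewrite [X in is_derive _ _ _ X](_ : _ = (horner p \o (fun y : R => y^-1)) x *: (expR (- x^-1) * (- (- x ^- 2 *: 1))) +
     (expR \o (fun y : R => - y^-1)) x *: (p^`().[x^-1] * (- x ^- 2 *: 1))); last first.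
    by rewrite /flat x0 !hornerE /GRing.scale /=; field.
  apply: near_eq_is_derive d3.
  near=> y; rewrite /flat (_ : 0 < y)//.
  by near: y; exact: lt_nbhsr.
- rewrite x0; have -> : flat ('X^2 * (p - p^`())) 0 = 0 by rewrite /flat ltxx.
  have f0 : flat p 0 = 0 by rewrite /flat ltxx.
  (* The difference quotient at 0 is h^(-1) [flat p h] = h [flat (X^2 p) h], a bounded function
     times h. *)
  have [C C0 hC] := flat_le ('X^2 * p).
  have lim : (fun h => h^-1 *: ((flat p \o shift 0) (h *: 1) - flat p 0)) @ 0^' --> (0 : R).
    apply/cvgr0Pnorm_lt => e e0; near=> h.
    rewrite f0 subr0 /= addr0 /GRing.scale /= mulr1.
    have hn0 : h != 0 by near: h; exact: nbhs_dnbhs_neq.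
    have -> : h^-1 * flat p h = h * flat ('X^2 * p) h.
      rewrite /flat; case: ltP => h0; last by rewrite !mulr0.
      by rewrite hornerM hornerXn; field.
    rewrite normrM; apply: (@le_lt_trans _ _ (`|h| * C)).
      by rewrite ler_wpM2l.
    apply: (@le_lt_trans _ _ (`|h| * (C + 1))); first by rewrite ler_wpM2l// lerDl.
    rewrite -ltr_pdivlMr ?ltr_pwDr//.
    by near: h; apply: dnbhs0_lt; rewrite divr_gt0// ltr_pwDr.
  apply: DeriveDef; first by apply/cvg_ex; exists 0.
  exact: cvg_lim.
Unshelve. all: by end_near. Qed.

Lemma continuous_flat p : continuous (flat p).
Proof.
by move=> x; apply: differentiable_continuous; apply/derivable1_diffP; case: (is_derive_flat p x).
Qed.

Lemma Ck_flat k p c d : Ck k (fun x => flat p (linf c d x)).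
Proof.
have cl q : continuous (fun x => flat q (linf c d x)).
  move=> x; apply: (@continuous_comp _ _ _ (linf c d) (flat q)).
    exact: continuous_linf.
  exact: continuous_flat.
elim: k p => [|k IH] p; first by split.
split => // i.
pose s := c.1 * (ebase R i).1 + c.2 * (ebase R i).2.
have D x : is_derive x (ebase R i) (fun x => flat p (linf c d x))
    (flat ('X^2 * (p - p^`())) (linf c d x) * s).
  have E : (fun h : R => flat p (linf c d (h *: ebase R i + x))) =
      flat p \o (fun h => linf c d x + h * s).
    apply/funext => h /=; congr flat; rewrite /linf /s.
    rewrite /= /GRing.scale /=; ring.
  have d0 : is_derive (0 : R) 1 (fun h : R => linf c d x + h * s) s.
    have h1 : is_derive (0 : R) 1 (fun h : R => h * s) s.
      have := @is_deriveM _ _ id (cst s) (0 : R) 1 1 0 (is_derive_id _ _) (is_derive_cst _ _ _).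
      by rewrite /GRing.scale /= mulr0 add0r mulr1.
    have := @is_deriveD _ _ _ (cst (linf c d x)) _ _ _ 0 _ (is_derive_cst _ _ _) h1.
    by rewrite add0r.
  have d1 : is_derive (linf c d x + 0 * s) 1 (flat p) (flat ('X^2 * (p - p^`())) (linf c d x)).
    by rewrite mul0r addr0; exact: is_derive_flat.
  have := @is_derive1_comp R (flat p) (fun h : R => linf c d x + h * s) 0 _ _ d1 d0.
  rewrite -E => d2.
  by have := (is_derive_line (fun x => flat p (linf c d x)) x (ebase R i) 0 _).2 d2; rewrite scale0r add0r.
split => [x|]; first by case: (D x).
have -> : partial i (fun x => flat p (linf c d x)) =
    (fun x => flat ('X^2 * (p - p^`())) (linf c d x) * s).
  by apply/funext => x; rewrite /partial; case: (D x).
by apply: CkM; [exact: IH|exact: Ck_cst].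
Qed.

(** A smooth transition from 0 for z <= 0 to 1 for z >= 1. The denominator is positive because z and
    1 - z are never both nonpositive. *)
Definition step (z : R) : R := flat 1 z / (flat 1 z + flat 1 (1 - z)).

Lemma flat1_ge0 z : 0 <= flat 1 z.
Proof. by rewrite /flat; case: ifP => // _; rewrite hornerC mul1r expR_ge0. Qed.

Lemma flat1_gt0 z : 0 < z -> 0 < flat 1 z.
Proof. by move=> z0; rewrite /flat z0 hornerC mul1r expR_gt0. Qed.

Lemma flat1_den z : 0 < flat 1 z + flat 1 (1 - z).
Proof.
have [z0|z0] := ltP 0 z; first by rewrite ltr_pwDl ?flat1_gt0 ?flat1_ge0.
by rewrite ltr_wpDl ?flat1_ge0// flat1_gt0//; lra.
Qed.

Lemma step_ge0 z : 0 <= step z.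
Proof. by rewrite /step divr_ge0 ?flat1_ge0// ltW// flat1_den. Qed.

Lemma step_le1 z : step z <= 1.
Proof. by rewrite /step ler_pdivrMr ?flat1_den// mul1r lerDl flat1_ge0. Qed.

Lemma step_eq0 z : z <= 0 -> step z = 0.
Proof. by move=> z0; rewrite /step {1}/flat ltNge z0 mul0r. Qed.

Lemma step_eq1 z : 1 <= z -> step z = 1.
Proof.
move=> z1; rewrite /step [X in _ / (_ + X)]/flat ltNge subr_le0 z1 /= addr0.
by rewrite divff// gt_eqF// flat1_gt0//; lra.
Qed.

Definition smooth f := forall k, Ck k f.

Lemma smooth_step c d : smooth (fun x => step (linf c d x)).
Proof.
move=> k; apply: CkM; first exact: Ck_flat.
apply: CkV => [x|]; first by rewrite gt_eqF// flat1_den.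
apply: CkD; first exact: Ck_flat.
rewrite (_ : (fun x => flat 1 (1 - linf c d x)) = fun x => flat 1 (linf (- c.1, - c.2) (1 - d) x)).
  exact: Ck_flat.
by apply/funext => x; congr flat; rewrite /linf /=; ring.
Qed.

(* A smooth function equal to 1 on the box shrunk by e, and to 0 off the box. *)
Definition bump (a b c d e : R) (x : R * R) : R :=
  (step ((x.1 - a) / e) * step ((b - x.1) / e)) *
  (step ((x.2 - c) / e) * step ((d - x.2) / e)).

Lemma smooth_bump a b c d e : smooth (bump a b c d e).
Proof.
move=> k; apply: CkM; apply: CkM.
- rewrite (_ : (fun x : R * R => _) = fun x => step (linf (e^-1, 0) (- a / e) x)); first exact: smooth_step.
  by apply/funext => x; congr step; rewrite /linf /=; ring.
- rewrite (_ : (fun x : R * R => _) = fun x => step (linf (- e^-1, 0) (b / e) x)); first exact: smooth_step.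
  by apply/funext => x; congr step; rewrite /linf /=; ring.
- rewrite (_ : (fun x : R * R => _) = fun x => step (linf (0, e^-1) (- c / e) x)); first exact: smooth_step.
  by apply/funext => x; congr step; rewrite /linf /=; ring.
- rewrite (_ : (fun x : R * R => _) = fun x => step (linf (0, - e^-1) (d / e) x)); first exact: smooth_step.
  by apply/funext => x; congr step; rewrite /linf /=; ring.
Qed.

Lemma bump_ge0 a b c d e x : 0 <= bump a b c d e x.
Proof. by rewrite /bump; apply: mulr_ge0; apply: mulr_ge0; exact: step_ge0. Qed.

Lemma bump_le1 a b c d e x : bump a b c d e x <= 1.
Proof.
have h u v : 0 <= step u * step v <= 1.
  by rewrite mulr_ge0 ?step_ge0// mulr_ile1 ?step_ge0 ?step_le1.
rewrite /bump; have /andP[? ?] := h ((x.1 - a) / e) ((b - x.1) / e).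
by have /andP[? ?] := h ((x.2 - c) / e) ((d - x.2) / e); exact: mulr_ile1.
Qed.

Lemma bump_eq1 a b c d e x : 0 < e -> a + e <= x.1 <= b - e -> c + e <= x.2 <= d - e ->
  bump a b c d e x = 1.
Proof.
move=> e0 /andP[h1 h2] /andP[h3 h4]; rewrite /bump !step_eq1 ?mulr1//;
by rewrite ler_pdivlMr// mul1r; lra.
Qed.

Lemma bump_neq0 a b c d e x : 0 < e -> bump a b c d e x != 0 ->
  (a < x.1 < b) && (c < x.2 < d).
Proof.
have nM (u v : R) : u * v != 0 -> u != 0 /\ v != 0.
  by rewrite mulf_eq0 negb_or => /andP.
move=> e0 /nM[/nM[h1 h2] /nM[h3 h4]].
have P z : step (z / e) != 0 -> 0 < z.
  by apply: contra_neqT; rewrite -leNgt => z0; rewrite step_eq0// ler_pdivrMr// mul0r.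
have := P _ h1; have := P _ h2; have := P _ h3; have := P _ h4 => p1 p2 p3 p4.
by apply/andP; split; apply/andP; split; lra.
Qed.

Lemma smoothM f g : smooth f -> smooth g -> smooth (fun x => f x * g x).
Proof. by move=> sf sg k; exact: CkM. Qed.

Lemma smooth_partial f i : smooth f -> smooth (partial i f).
Proof. by move=> sf k; exact: Ck_partial. Qed.

Lemma partial_supp f i x : partial i f x != 0 -> tsupp f x.
Proof.
move=> pf; apply: contrapT => nx; move/eqP: pf; apply.
rewrite /partial (_ : 'D_(ebase R i) f x = 'D_(ebase R i) (cst 0) x); first by rewrite derive_cst.
apply: near_eq_derive.
have oN : open (~` tsupp f) by apply: closed_openC; exact: closed_closure.
have : nbhs x (~` tsupp f) by exact: open_nbhs_nbhs.
apply: filterS => y ny /=.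
by apply: contrapT => /eqP fy; apply: ny; exact: subset_closure.
Qed.

Lemma test_fun_sub (Omega : set (R * R)) f g : test_fun Omega f -> smooth g ->
  (forall x, g x != 0 -> tsupp f x) -> test_fun Omega g.
Proof.
move=> [_ cf fO] sg gf.
have sub : tsupp g `<=` tsupp f.
  rewrite [X in _ `<=` X](closure_id _).1; last exact: closed_closure.
  exact: closure_subset.
split => //; last exact: subset_trans fO.
by apply: subclosed_compact cf sub; exact: closed_closure.
Qed.

Lemma test_fun_partial Omega f i : test_fun Omega f -> test_fun Omega (partial i f).
Proof.
move=> tf; apply: (test_fun_sub tf); last by move=> x; exact: partial_supp.
by apply: smooth_partial; case: tf.
Qed.

Lemma test_funMl Omega f g : test_fun Omega f -> smooth g -> test_fun Omega (fun x => f x * g x).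
Proof.
move=> tf sg; apply: (test_fun_sub tf); first by apply: smoothM => //; case: tf.
by move=> x fg; apply: subset_closure; apply: contraNneq fg => ->; rewrite mul0r.
Qed.

Lemma test_fun0 Omega f x : test_fun Omega f -> ~ Omega x -> f x = 0.
Proof.
move=> [_ _ fO] nx; apply/eqP/negPn/negP => fx; apply: nx; apply: fO.
exact: subset_closure.
Qed.

Lemma compact_box (a b c d : R) : compact (`[a, b] `*` `[c, d]).
Proof. by apply: compact_setX; exact: segment_compact. Qed.

Lemma test_fun_bump a b c d e (Omega : set (R * R)) : 0 < e ->
  `[a, b] `*` `[c, d] `<=` Omega -> test_fun Omega (bump a b c d e).
Proof.
move=> e0 BO.
have cB : closed (`[a, b] `*` `[c, d]).
  by apply: compact_closed; [exact: norm_hausdorff|exact: compact_box].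
have sub : tsupp (bump a b c d e) `<=` `[a, b] `*` `[c, d].
  rewrite [X in _ `<=` X](closure_id _).1//; apply: closure_subset => x /= /(bump_neq0 e0).
  move=> /andP[/andP[x1 x2] /andP[x3 x4]].
  by split; rewrite /= in_itv/= !ltW.
split; first exact: smooth_bump.
- by apply: subclosed_compact (@compact_box a b c d) sub; exact: closed_closure.
- exact: subset_trans BO.
Qed.


Lemma smooth_cst (c : R) : smooth (fun=> c).
Proof. by move=> k; exact: Ck_cst. Qed.

Lemma smoothD f g : smooth f -> smooth g -> smooth (fun x => f x + g x).
Proof. by move=> sf sg k; exact: CkD. Qed.

Lemma smooth_prod (I : Type) (s : seq I) (F : I -> R * R -> R) :
  (forall j, smooth (F j)) -> smooth (fun x => \prod_(j <- s) F j x).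
Proof.
move=> sF; elim: s => [|j s IH].
  rewrite (_ : (fun x => _) = fun=> 1); first exact: smooth_cst.
  by apply/funext => x; rewrite big_nil.
rewrite (_ : (fun x => _) = fun x => F j x * \prod_(l <- s) F l x); first exact: smoothM.
by apply/funext => x; rewrite big_cons.
Qed.

Lemma compact_finite_cover (T : topologicalType) (E : choiceType) (K : set T) (Q : E -> set T) (p : T -> E) :
  compact K -> (forall x, K x -> open_nbhs x (Q (p x))) ->
  exists s : seq E, (forall e, e \in s -> exists2 x, K x & e = p x) /\
    forall y, K y -> exists2 e, e \in s & Q e y.
Proof.
move=> /compact_near_coveringP cK oQ.
(* The filter of all sufficiently large finite index lists: near covering then says that one list
   serves every point of [K]. *)
pose F : set_system (seq E) := [set S | exists s0 : seq E, forall s : seq E, {subset s0 <= s} -> S s].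
have FF : Filter F.
  split; first by exists [::].
  - move=> A B [a Aa] [b Bb]; exists (a ++ b) => s abs; split; [apply: Aa|apply: Bb] => e es;
      by apply: abs; rewrite mem_cat es ?orbT.
  - by move=> A B AB [a Aa]; exists a => s /Aa /AB.
pose P (s : seq E) (y : T) := exists x, [/\ K x, p x \in s & Q (p x) y].
have [|s0 hs] := cK _ F P FF.
  move=> x Kx; exists (Q (p x), [set s : seq E | p x \in s]); last first.
    by move=> [y s] [/= Qy xs]; exists x.
  split; first by apply: open_nbhs_nbhs; exact: oQ.
  by exists [:: p x] => s; apply; rewrite mem_head.
exists [seq e <- s0 | `[< exists2 x, K x & e = p x >]]; split.
  by move=> e; rewrite mem_filter => /andP[/asboolP].
move=> y /(hs s0 (fun _ h => h)) [x [Kx xs Qy]]; exists (p x) => //.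
by rewrite mem_filter xs andbT; apply/asboolP; exists x.
Qed.

(** The value 1 is attained on a neighbourhood of K, and not only on K, so that the derivatives of
    the cutoff vanish on K. *)
Lemma cutoff_exists (Omega K : set (R * R)) : open Omega -> compact K -> K `<=` Omega ->
  exists eta : R * R -> R, [/\ test_fun Omega eta, (forall x, 0 <= eta x <= 1) &
    exists U : set (R * R), [/\ open U, K `<=` U & forall x, U x -> eta x = 1]].
Proof.
move=> oO cK KO.
have rad (x : R * R) : exists r : R, 0 < r /\ (K x ->
    `[x.1 - r, x.1 + r] `*` `[x.2 - r, x.2 + r] `<=` Omega).
  (* Off [K] the radius 1 is a default that makes [r] a total function. *)
  have [Kx|nK] := pselect (K x); last by exists 1.
  have /nbhs_ballP[e /= e0 xeO] : nbhs x Omega by apply: open_nbhs_nbhs; split => //; exact: KO.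
  exists (e / 2); split => [|_ y [/=]]; first by rewrite divr_gt0.
  rewrite !in_itv/= => /andP[y1 y2] /andP[y3 y4]; apply: xeO.
  by split; rewrite /ball/= ltr_norml; apply/andP; split; lra.
have {rad}[r hr] := choice rad.
pose b (x y : R * R) := bump (x.1 - r x) (x.1 + r x) (x.2 - r x) (x.2 + r x) (r x / 2) y.
pose Q (x : R * R) : set (R * R) := `]x.1 - r x / 2, x.1 + r x / 2[ `*` `]x.2 - r x / 2, x.2 + r x / 2[.
have r0 x : 0 < r x by case: (hr x).
have r20 x : 0 < r x / 2 by rewrite divr_gt0.
have oQ x : open (Q x).
  have -> : Q x = (fst @^-1` `]x.1 - r x / 2, x.1 + r x / 2[) `&` (snd @^-1` `]x.2 - r x / 2, x.2 + r x / 2[) by [].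
  apply: openI.
  - by apply: open_comp => [? _|]; [exact: cvg_fst|exact: interval_open].
  - by apply: open_comp => [? _|]; [exact: cvg_snd|exact: interval_open].
have [|D [DK KD]] := @compact_finite_cover _ _ K Q id cK.
  move=> x Kx; split; first exact: oQ.
  by split; rewrite /= in_itv/=; apply/andP; split; have := r20 x; lra.
(* Unlike a sum of bumps, 1 minus the product of 1 - b stays between 0 and 1, equals 1 where some
   bump does, and vanishes where all of them do. *)
pose eta y := 1 + (-1) * \prod_(x <- D) (1 + (-1) * b x y).
have b01 x y : 0 <= 1 + (-1) * b x y <= 1.
  have := bump_ge0 (x.1 - r x) (x.1 + r x) (x.2 - r x) (x.2 + r x) (r x / 2) y.
  have := bump_le1 (x.1 - r x) (x.1 + r x) (x.2 - r x) (x.2 + r x) (r x / 2) y.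
  by rewrite -/(b x y) => h1 h2; apply/andP; split; lra.
have p01 (s : seq (R * R)) y : 0 <= \prod_(x <- s) (1 + (-1) * b x y) <= 1.
  elim: s => [|x s IH]; first by rewrite big_nil ler01 lexx.
  rewrite big_cons; have /andP[h1 h2] := b01 x y; have /andP[h3 h4] := IH.
  by rewrite mulr_ge0//= mulr_ile1.
have seta : smooth eta.
  apply: smoothD; first exact: smooth_cst.
  apply: smoothM; first exact: smooth_cst.
  apply: smooth_prod => x; apply: smoothD; first exact: smooth_cst.
  by apply: smoothM; [exact: smooth_cst|exact: smooth_bump].
pose B (x : R * R) : set (R * R) := `[x.1 - r x, x.1 + r x] `*` `[x.2 - r x, x.2 + r x].
pose C := \big[setU/set0]_(x <- D) B x.
have cC : compact C by apply: bigsetU_compact => x _; exact: compact_box.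
have clC : closed C by apply: compact_closed => //; exact: norm_hausdorff.
have etaC : [set y | eta y != 0] `<=` C.
  move=> y /=; rewrite /eta /C; elim: (D) => [|x s IH].
    by rewrite !big_nil mulr1 subrr eqxx.
  rewrite !big_cons; have [b0|b0] := eqVneq (b x y) 0.
    by rewrite b0 mulr0 addr0 mul1r => /IH h; right.
  move=> _; left; have := bump_neq0 (r20 x) b0 => /andP[/andP[h1 h2] /andP[h3 h4]].
  by split; rewrite /= in_itv/= !ltW.
have CO : C `<=` Omega.
  have : forall x, x \in D -> B x `<=` Omega.
    by move=> x /DK[z Kz ->]; have [_] := hr z; exact.
  rewrite /C; elim: (D) => [|x s IH] H; first by rewrite big_nil.
  rewrite big_cons => y [|]; first by apply: H; rewrite mem_head.
  by apply: IH => z zs; apply: H; rewrite in_cons zs orbT.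
have sub : tsupp eta `<=` C by rewrite [X in _ `<=` X](closure_id _).1//; exact: closure_subset.
exists eta; split.
- split => //; last exact: subset_trans CO.
  by apply: subclosed_compact cC sub; exact: closed_closure.
- by move=> y; have /andP[h1 h2] := p01 (D) y; rewrite /eta; apply/andP; split; lra.
- exists (\bigcup_(x in [set` D]) Q x); split.
  + by apply: bigcup_open => x _.
  + by move=> y /KD[x xD Qy]; exists x.
  + move=> y [x /= xD [/=]]; rewrite !in_itv/= => /andP[y1 y2] /andP[y3 y4].
    have bx : b x y = 1.
      by apply: bump_eq1 => //; apply/andP; split; lra.
    rewrite /eta (_ : \prod_(_ <- _) _ = 0) ?mulr0 ?addr0//.
    by rewrite (big_rem x)//= bx mulN1r subrr mul0r.
Qed.

End CkCalculus.

(** * Weak and strong derivatives on the plane *)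

Section DuBoisReymond.
Variable R : realType.
Implicit Types (f g phi : R * R -> R).
Notation mu := (leb2 R).

(** With transition width h, the plateau in the first variable is [a + h, b + h] and the support
    lies in [a, b + 2 h]. In the limit b is kept and a is lost, which gives the half-open box. *)
Lemma box_bump_cvg (a b c d : R) (x : R * R) :
  bump a (b + 2 * n.+1%:R^-1) c (d + 2 * n.+1%:R^-1) n.+1%:R^-1 x @[n --> \oo] -->
  (\1_(`]a, b] `*` `]c, d]) x : R).
Proof.
apply: cvg_near_cst; rewrite indicE in_setX !mem_setE !in_itv/=.
have ev (e : R) : 0 < e -> \forall n \near \oo, n.+1%:R^-1 <= e.
  by move=> e0; have := near_infty_natSinv_lt (PosNum e0); apply: filterS => n /= /ltW.
have n0 n : 0 < n.+1%:R^-1 :> R by rewrite invr_gt0 ltr0n.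
have [/andP[/andP[h1 h2] /andP[h3 h4]]|] := boolP (_ && _).
  have e1 := ev (x.1 - a) ltac:(lra); have e2 := ev (x.2 - c) ltac:(lra).
  near=> n; have := n0 n => p.
  have q1 : n.+1%:R^-1 <= x.1 - a by near: n; exact: e1.
  have q2 : n.+1%:R^-1 <= x.2 - c by near: n; exact: e2.
  move: (n.+1%:R^-1) p q1 q2 => e p q1 q2.
  by rewrite bump_eq1//; apply/andP; split; lra.
have b0 n : ~~ ((a < x.1 < b + 2 * n.+1%:R^-1) && (c < x.2 < d + 2 * n.+1%:R^-1)) ->
    bump a (b + 2 * n.+1%:R^-1) c (d + 2 * n.+1%:R^-1) n.+1%:R^-1 x = 0.
  by move=> h; apply/eqP; apply: contraNT h => /(bump_neq0 (n0 n)).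
have far (y z : R) : y < z -> \forall n \near \oo, (z < y + 2 * n.+1%:R^-1) = false.
  move=> yz; have := ev ((z - y) / 2) ltac:(lra); apply: filterS => n.
  by move: (n.+1%:R^-1) => e h; apply/negbTE; rewrite -leNgt; lra.
rewrite !negb_and -!ltNge -!leNgt -!orbA => /or4P[] h.
- by apply: nearW => n; apply: b0; rewrite [a < _]ltNge h.
- by have := far _ _ h; apply: filterS => n hn; apply: b0; rewrite hn andbF.
- by apply: nearW => n; apply: b0; rewrite [c < _]ltNge h andbF.
- by have := far _ _ h; apply: filterS => n hn; apply: b0; rewrite hn !andbF.
Unshelve. all: by end_near. Qed.

Lemma smooth_mfun2 f : smooth f -> mfun2 f.
Proof. by move=> sf; apply: continuous_mfun2; exact: (Ck_continuous (sf 0%N)). Qed.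

Lemma integrable_Mb (B : R) f g : mu.-integrable setT (EFin \o f) -> mfun2 g ->
  (forall x, `|g x| <= B) -> mu.-integrable setT (EFin \o (fun x => f x * g x)).
Proof.
move=> fi mg gB; have /integrableP[/measurable_EFinP mf _] := fi.
apply: (le_integrable measurableT _ _ (integrableZl measurableT B fi)).
  by apply/measurable_EFinP; exact: measurable_funM.
move=> x _ /=; rewrite lee_fin !normrM mulrC ler_wpM2r//.
by apply: (le_trans (gB x)); exact: ler_norm.
Qed.

(** Bumps converge boundedly to indicators of half-open boxes, so g has integral 0 over each box,
    and by [box_induction] over each Borel set. *)
Lemma du_bois_reymond g : mu.-integrable setT (EFin \o g) ->
  (forall phi, test_fun setT phi -> \int[mu]_x (g x * phi x) = 0) ->
  {ae mu, forall x, g x = 0}.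
Proof.
move=> gi H; have /integrableP[/measurable_EFinP mg _] := gi.
have giA (A : set (plane R)) : measurable A -> mu.-integrable A (EFin \o g).
  by move=> mA; apply: integrableS gi.
have gind (A : set (plane R)) : measurable A ->
    (\int[mu]_(x in A) (g x)%:E = \int[mu]_x (g x * \1_A x)%:E)%E.
  move=> mA; rewrite [LHS]integral_mkcond; apply: eq_integral => x _.
  by rewrite /patch indicE; case: (x \in A); rewrite ?mulr1 ?mulr0.
have dct (u : nat -> R * R -> R) (A : set (plane R)) : measurable A ->
   (forall n, mfun2 (u n)) -> (forall n x, `|u n x| <= 1) ->
   (forall x, u n x @[n --> \oo] --> (\1_A x : R)) ->
   (forall n, \int[mu]_x (g x * u n x)%:E = 0)%E -> (\int[mu]_(x in A) (g x)%:E = 0)%E.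
  move=> mA mu1 u1 uA u0; rewrite gind//.
  have [] := @dominated_convergence _ _ R mu setT measurableT
    (fun n x => (g x * u n x)%:E) (fun x => (g x * \1_A x)%:E) (fun x => (`|g x|)%:E).
  - by move=> n; apply/measurable_EFinP; exact: measurable_funM.
  - by apply/measurable_EFinP; apply: measurable_funM => //; exact: measurable_indic.
  - apply: aeW => x _; apply: cvg_EFin; first by near=> n.
    by apply: cvgM; [exact: cvg_cst|exact: uA].
  - exact: integrable_norm.
  - apply: aeW => x n _; rewrite abse_EFin lee_fin normrM ler_piMr//.
  by move=> _ _ /=; under eq_fun do rewrite u0; move=> /cvg_lim <-//; rewrite lim_cst.
have box (a b c d : R) : (\int[mu]_(x in `]a, b] `*` `]c, d]) (g x)%:E = 0)%E.
  apply: (dct (fun n => bump a (b + 2 * n.+1%:R^-1) c (d + 2 * n.+1%:R^-1) n.+1%:R^-1)).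
  - exact: measurable_box.
  - by move=> n; apply: smooth_mfun2; exact: smooth_bump.
  - by move=> n x; rewrite ger0_norm ?bump_ge0 ?bump_le1.
  - by move=> x; exact: box_bump_cvg.
  - move=> n; set phi := bump _ _ _ _ _.
    have n0 : 0 < n.+1%:R^-1 :> R by rewrite invr_gt0 ltr0n.
    have tphi : test_fun setT phi by apply: test_fun_bump.
    have := H _ tphi; rewrite /Rintegral => h.
    rewrite -[LHS]fineK ?h//; apply: integrable_fin_num => //.
    apply: (@integrable_Mb 1) => //; first by apply: smooth_mfun2; exact: smooth_bump.
    by move=> x; rewrite ger0_norm ?bump_ge0 ?bump_le1.
(* The plane is a limit of squares, which are boxes. This value is also used for complements. *)
have gT : (\int[mu]_x (g x)%:E = 0)%E.
  refine (dct (fun n => (\1_(square n) : R * R -> R)) setT measurableT _ _ _ _).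
  - by move=> n; apply: measurable_indic; exact: measurable_square.
  - by move=> n x; rewrite indicE; case: (_ \in _); rewrite ?normr1 ?normr0.
  - move=> x; apply: cvg_near_cst; have := square_cvg x; apply: filterS => n xn.
    by rewrite !indicE xn in_setT.
  - by move=> n; rewrite -gind; [exact: box|exact: measurable_square].
have all0 (A : set (R * R)) : @measurable _ (plane R) A -> (\int[mu]_(x in A) (g x)%:E = 0)%E.
  move: A; apply: box_induction => //.
  - move=> A mA gA; have mAC : @measurable _ (plane R) (~` A) by exact: measurableC.
    rewrite gind//.
    have -> : (fun x => (g x * \1_(~` A) x)%:E) = (fun x => (g x - g x * \1_A x)%:E).
      by apply/funext => x; rewrite !indicE in_setC; case: (x \in A); rewrite /= ?mulr1 ?mulr0 ?subrr ?subr0.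
    rewrite integralB_EFin//; last first.
      apply: (@integrable_Mb 1 g (\1_A)) => //.
      by move=> x; rewrite indicE; case: (_ \in _); rewrite ?normr1 ?normr0.
    by rewrite gT -gind// gA sube0.
  - move=> F mF tF F0; rewrite integral_bigcup//.
    + by rewrite eseries0// => n _ _; exact: F0.
    + by apply: giA; exact: bigcupT_measurable.
have : ae_eq mu setT (EFin \o g) (cst 0%E).
  apply: integral_ae_eq => //.
  by move=> E _ mE; rewrite integral0; exact: all0.
by apply: filterS => x /= /(_ I) [].
Unshelve. all: by end_near. Qed.

End DuBoisReymond.

Lemma leb2_sigma_finite (R : realType) : sigma_finite setT (leb2 R).
Proof.
exists (@square R).
  apply/seteqP; split=> // x _; have [n _ hn] := square_cvg x.
  by exists n => //; have := hn n (leqnn n); rewrite inE.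
by move=> n; split; [exact: measurable_square|exact: square_fin].
Qed.

(* The sigma-finite structure of leb2, which is lost in its declared type. *)
Definition leb2sf (R : realType) : set (plane R) -> \bar R := leb2 R.
HB.instance Definition _ (R : realType) := Measure.copy (@leb2sf R) (leb2 R).
HB.instance Definition _ (R : realType) :=
  @Measure_isSigmaFinite.Build _ (plane R) R (@leb2sf R) (leb2_sigma_finite R).

(** * Weak derivatives as integrals along lines *)

Section Lines.
Variable R : realType.
Implicit Types (f g phi : R * R -> R) (i : 'I_2).
Notation mu := (leb2 R).
Notation leb := (@lebesgue_measure R).

Lemma ae_imp (P Q : R * R -> Prop) : (forall x, P x -> Q x) ->
  {ae mu, forall x, P x} -> {ae mu, forall x, Q x}.
Proof.
by move=> PQ; apply: negligibleS => x; apply: contra_not => Px; exact: PQ.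
Qed.

Lemma ae_and (P Q : R * R -> Prop) :
  {ae mu, forall x, P x} -> {ae mu, forall x, Q x} -> {ae mu, forall x, P x /\ Q x}.
Proof.
move=> aP aQ; have := negligibleU aP aQ; apply: negligibleS => x /= nPQ.
by have [Px|?] := pselect (P x); [right => Qx; exact: nPQ|left].
Qed.

Definition along i (t : R) (x : R * R) : R * R := shift2 (t *: ebase R i) x.

Lemma along0 i x : along i 0 x = x.
Proof. by rewrite /along /shift2 scale0r addr0. Qed.

Lemma alongD i s t x : along i s (along i t x) = along i (s + t) x.
Proof. by rewrite /along /shift2 scalerDl addrAC addrA. Qed.

(** The factor [c] covers both orientations: [weak_rep] uses -1, where a translation has been moved
    onto the test function. *)
Lemma is_derive_along phi i (c t : R) x : smooth phi ->
  is_derive t 1 (fun t => phi (along i (c * t) x)) (c * partial i phi (along i (c * t) x)).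
Proof.
move=> sphi.
have d0 : is_derive t 1 (fun t : R => c * t) c.
  have := @is_deriveM _ _ (cst c) id t 1 0 1 (is_derive_cst _ _ _) (is_derive_id _ _).
  by rewrite /GRing.scale /= mulr0 addr0 mulr1.
have d1 : is_derive (c * t) 1 (fun s => phi (s *: ebase R i + x)) (partial i phi (along i (c * t) x)).
  apply/is_derive_line; apply: DeriveDef.
    by apply: (@Ck_derivable _ 0%N); exact: sphi.
  by rewrite /partial /along /shift2 addrC.
have := @is_derive1_comp R (fun s => phi (s *: ebase R i + x)) _ t _ _ d1 d0.
rewrite mulrC; congr (is_derive _ _ _ _); apply/funext => s /=.
by rewrite /along /shift2 addrC.
Qed.

Lemma continuous_along phi i (c : R) x : continuous phi ->
  continuous (fun t => phi (along i (c * t) x)).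
Proof.
move=> cphi t; apply: (@continuous_comp _ _ _ (fun t => along i (c * t) x) phi); last exact: cphi.
rewrite /along /shift2; apply: cvgD; first exact: cvg_cst.
apply: cvgZ; last exact: cvg_cst.
by apply: cvgM; [exact: cvg_cst|exact: cvg_id].
Qed.

Lemma ftc_along phi i (c h : R) x : smooth phi -> 0 < h ->
  phi (along i (c * h) x) - phi x =
  \int[leb]_(t in `[0, h]) (c * partial i phi (along i (c * t) x)).
Proof.
move=> sphi h0.
have cF : continuous (fun t => phi (along i (c * t) x)).
  by apply: continuous_along; exact: (Ck_continuous (sphi 0%N)).
rewrite /Rintegral.
rewrite (@continuous_FTC2 _ _ (fun t => phi (along i (c * t) x))) //.
- by rewrite -EFinB /= mulr0 along0.
- apply: continuous_subspaceT => t.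
  apply: cvgM; first exact: cvg_cst.
  by apply: (continuous_along (phi := partial i phi)); exact: (Ck_continuous (smooth_partial i sphi 0%N)).
- split.
  + by move=> t _; case: (is_derive_along i c t x sphi).
  + by apply: cvg_at_right_filter; exact: cF.
  + by apply: cvg_at_left_filter; exact: cF.
- by move=> t _; rewrite derive1E; case: (is_derive_along i c t x sphi).
Qed.

Lemma test_fun_bounded (Omega : set (R * R)) phi : test_fun Omega phi ->
  exists2 B : R, 0 <= B & forall x, `|phi x| <= B.
Proof.
move=> [sphi cphi _].
have : compact (phi @` tsupp phi).
  apply: continuous_compact => //; apply: continuous_subspaceT.
  exact: (Ck_continuous (sphi 0%N)).
move=> /compact_bounded [M [Mr hM]].
exists (`|M| + 1) => [|x]; first by rewrite addr_ge0.
have [->|p0] := eqVneq (phi x) 0; first by rewrite normr0 addr_ge0.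
apply: (hM (`|M| + 1)); first by rewrite (le_lt_trans (ler_norm _))// ltrDl.
by exists x => //; exact: subset_closure.
Qed.

Lemma derive_shift f (a v x : R * R) :
  (derivable f (shift2 a x) v -> derivable (fun x => f (shift2 a x)) x v) /\
  'D_v (fun x => f (shift2 a x)) x = 'D_v f (shift2 a x).
Proof.
have E : (fun h : R => h^-1 *: (((fun x => f (shift2 a x)) \o shift x) (h *: v) - f (shift2 a x))) =
    (fun h => h^-1 *: ((f \o shift (shift2 a x)) (h *: v) - f (shift2 a x))).
  by apply/funext => h /=; rewrite /shift2 addrA.
by split; rewrite /derivable /derive E.
Qed.

Lemma continuous_shift2 (a : R * R) : continuous (shift2 a).
Proof. by move=> x; apply: cvgD; [exact: cvg_id|exact: cvg_cst]. Qed.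

Lemma smooth_shift phi a : smooth phi -> smooth (fun x => phi (shift2 a x)).
Proof.
move=> sphi k; move: {sphi} (sphi k); elim: k phi => [|k IH] phi [cphi dphi].
  split => // x; apply: (@continuous_comp _ _ _ (shift2 a) phi); first exact: continuous_shift2.
  exact: cphi.
split.
  move=> x; apply: (@continuous_comp _ _ _ (shift2 a) phi); first exact: continuous_shift2.
  exact: cphi.
move=> j; have [d1 d2] := dphi j; split => [x|].
  by apply: (derive_shift phi a (ebase R j) x).1; exact: d1.
rewrite (_ : partial j _ = fun x => partial j phi (shift2 a x)); first exact: IH.
by apply/funext => x; rewrite /partial (derive_shift phi a (ebase R j) x).2.
Qed.

Lemma test_fun_along phi i t : test_fun setT phi ->
  test_fun setT (fun x => phi (along i t x)).
Proof.
move=> [sphi cphi _]; split => //; first exact: smooth_shift.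
pose K := shift2 (- (t *: ebase R i)) @` tsupp phi.
have cK : compact K.
  apply: continuous_compact => //; apply: continuous_subspaceT.
  exact: continuous_shift2.
have clK : closed K by apply: compact_closed => //; exact: norm_hausdorff.
have sub : tsupp (fun x => phi (along i t x)) `<=` K.
  rewrite [X in _ `<=` X](closure_id _).1//; apply: closure_subset => x /= px.
  exists (along i t x); first exact: subset_closure.
  by rewrite /along /shift2 addrK.
by apply: subclosed_compact cK sub; exact: closed_closure.
Qed.

Lemma partial_along phi i j t x :
  partial j (fun x => phi (along i t x)) x = partial j phi (along i t x).
Proof. exact: (derive_shift phi _ _ x).2. Qed.

(** The global notion on the plane. Local weak derivatives are brought to it by multiplying with a
    test function. *)
Definition weak_deriv i f g := [/\ mu.-integrable setT (EFin \o f),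
  mu.-integrable setT (EFin \o g) &
  forall phi, test_fun setT phi ->
    \int[mu]_x (f x * partial i phi x) = - \int[mu]_x (g x * phi x)].

(** The null set may depend on [h]; this is enough because later [h] is either fixed or runs through
    the sequence [hn]. *)
Definition rep i f g := forall h : R, 0 < h ->
  {ae mu, forall x, f (along i h x) - f x = \int[leb]_(t in `[0, h]) g (along i t x)}.

Lemma measurable_along2 d (T : measurableType d) i c (F : R * R -> T) : mfun2 F ->
  @measurable_fun _ _ (plane R * measurableTypeR R)%type T setT (fun z => F (along i (c * z.2) z.1)).
Proof.
move=> mF; apply: (measurableT_comp mF).
apply/measurable_fun_pairP; split.
- have -> : fst \o (fun z : plane R * measurableTypeR R => along i (c * z.2) z.1) =
     (fun z => z.1.1 + c * z.2 * (ebase R i).1) by [].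
  apply: measurable_funD; first by apply: measurableT_comp => //; exact: measurable_fst.
  by apply: measurable_funM => //; apply: measurable_funM => //; exact: measurable_snd.
- have -> : snd \o (fun z : plane R * measurableTypeR R => along i (c * z.2) z.1) =
     (fun z => z.1.2 + c * z.2 * (ebase R i).2) by [].
  apply: measurable_funD; first by apply: measurableT_comp => //; exact: measurable_fst.
  by apply: measurable_funM => //; apply: measurable_funM => //; exact: measurable_snd.
Qed.

(** For functions built from translates, invariance bounds the L1 norms of the slices uniformly in
    t, which makes G integrable over the plane times the segment. *)
Lemma fubini_segment (G : plane R * measurableTypeR R -> R) (h C : R) : 0 < h ->
  measurable_fun setT G ->
  (forall t, (\int[mu]_x (`|G (x, t)|)%:E <= C%:E)%E) ->
  [/\ {ae mu, forall x, leb.-integrable `[0, h] (EFin \o (fun t => G (x, t)))},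
    mu.-integrable setT (EFin \o (fun x => \int[leb]_(t in `[0, h]) G (x, t))) &
    \int[mu]_x (\int[leb]_(t in `[0, h]) G (x, t)) =
    \int[leb]_(t in `[0, h]) (\int[mu]_x G (x, t))].
Proof.
move=> h0 mG GC.
pose S : set (measurableTypeR R) := `[0, h]%classic.
have mS : measurable S by exact: measurable_itv.
pose m1 : {sigma_finite_measure set (plane R) -> \bar R} :=
  @leb2sf R.
pose F (z : plane R * measurableTypeR R) := (G z * \1_S z.2)%:E.
have mF : measurable_fun setT F.
  apply/measurable_EFinP; apply: measurable_funM => //.
  have mi : measurable_fun setT (\1_S : measurableTypeR R -> R) by exact: measurable_indic.
  exact: (measurableT_comp mi measurable_snd).
have mGt t : mfun2 (fun x => G (x, t)).
  exact: measurable_fun_pair1.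
have FS x : (\int[leb]_(t in S) (G (x, t))%:E = \int[leb]_t F (x, t))%E.
  rewrite [LHS]integral_mkcond; apply: eq_integral => t _.
  by rewrite /patch /F indicE /=; case: (t \in S); rewrite ?mulr1 ?mulr0.
have Ft t : (\int[mu]_x F (x, t) = (\int[mu]_x (G (x, t))%:E) * (\1_S t)%:E)%E.
  rewrite /F indicE /=; case: (t \in S) => /=.
    by rewrite mule1; apply: eq_integral => x _; rewrite mulr1.
  by rewrite mule0 integral0_eq// => x _; rewrite mulr0.
have FtA t : (\int[mu]_x `|F (x, t)| = (\int[mu]_x (`|G (x, t)|)%:E) * (\1_S t)%:E)%E.
  rewrite /F indicE /=; case: (t \in S) => /=.
    by rewrite mule1; apply: eq_integral => x _; rewrite mulr1.
  by rewrite mule0 integral0_eq// => x _; rewrite mulr0 normr0.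
have C0 : 0 <= C.
  rewrite -lee_fin; apply: le_trans (GC 0).
  by apply: integral_ge0 => x _; rewrite lee_fin.
have iF : (m1 \x leb)%E.-integrable setT F.
  apply/(integrable21ltyP m1 leb mF).
  apply: (@le_lt_trans _ _ (\int[leb]_t (C%:E * (\1_S t)%:E))%E).
    apply: ge0_le_integral => //.
    - by move=> t _; exact: integral_ge0.
    - have mAF : measurable_fun setT (abse \o F) by exact: measurableT_comp.
      exact: (@measurable_fun_fubini_tonelli_G _ _ _ _ _ m1 _ mAF (fun z => abse_ge0 (F z))).
    - by apply: measurable_funeM; apply/measurable_EFinP; exact: measurable_indic.
    - move=> t _; rewrite [leLHS]FtA; apply: lee_wpmul2r; first by rewrite lee_fin indicE.
      exact: GC.
  have miE : measurable_fun setT (fun t : measurableTypeR R => (\1_S t : R)%:E).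
    by apply/measurable_EFinP; exact: measurable_indic.
  have i0 : forall t : measurableTypeR R, setT t -> (0 <= (\1_S t : R)%:E)%E.
    by move=> t _; rewrite lee_fin indicE.
  rewrite (ge0_integralZl _ _ miE i0)//.
  have lS : (leb S = h%:E)%E.
    by have := lebesgue_measure_itv `[0, h]; rewrite /= lte_fin h0 -EFinB subr0.
  have -> : (\int[leb]_t (\1_S t)%:E = h%:E)%E.
    by rewrite integral_indic// setIT; exact: lS.
  by rewrite -EFinM ltry.
have aeF := ae_integrable1 iF.
pose k (x : plane R) := (\int[leb]_t F (x, t))%E.
have KE (x : plane R) : \int[leb]_(t in `[0, h]) G (x, t) = fine (k x).
  by rewrite /Rintegral FS.
have ki : mu.-integrable setT k by exact: (integrable_fubini_F iF).
have mk : measurable_fun setT k by case/integrableP : ki.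
have mK : mfun2 (fun x => \int[leb]_(t in `[0, h]) G (x, t)).
  have -> : (fun x => \int[leb]_(t in `[0, h]) G (x, t)) = fine \o k by apply/funext.
  by apply: measurableT_comp => //; exact: measurable_fine.
(* The real-valued integral takes the value [fine (k x)], which can differ from [k x] only on the
   null set where the slice is not integrable. *)
have Kk : ae_eq mu setT (EFin \o (fun x => \int[leb]_(t in `[0, h]) G (x, t))) k.
  have := aeF; apply: filterS => x ix _ /=; rewrite KE fineK//.
  exact: integrable_fin_num.
split.
- have := aeF; apply: filterS => x ix; apply/(integrable_mkcond _ mS).
  by apply: eq_integrable ix => // t _; rewrite /patch /F indicE /=; case: (t \in S); rewrite ?mulr1 ?mulr0.
- refine (@le_integrable _ _ _ mu setT measurableT _ k _ _ ki); first exact/measurable_EFinP.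
  move=> x _ /=; rewrite KE; case: (k x) => [r||] /=; [exact: lexx|exact: leey|exact: leey].
- have E1 : (\int[mu]_x (EFin \o (fun x => \int[leb]_(t in `[0, h]) G (x, t))%R) x = \int[mu]_x k x)%E.
    by apply: ae_eq_integral => //; exact/measurable_EFinP.
  transitivity (fine (\int[mu]_x k x)); first by rewrite -E1.
  have E2 : (\int[mu]_x k x = \int[leb]_t \int[mu]_x F (x, t))%E := Fubini iF.
  rewrite E2 /Rintegral.
  rewrite [in RHS]integral_mkcond; congr fine; apply: eq_integral => t _.
  rewrite [LHS]Ft /patch indicE; case: ifPn => _; rewrite ?mule0// mule1 /Rintegral fineK//.
  apply: integrable_fin_num => //; apply/integrableP; split; first exact/measurable_EFinP.
  by apply: le_lt_trans (GC t) _; rewrite ltry.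
Qed.

Lemma Rintegral_along i t (F : R * R -> R) : mfun2 F ->
  \int[mu]_x F (along i t x) = \int[mu]_x F x.
Proof.
move=> mF; rewrite /Rintegral; congr fine.
apply: (integral_shift (t *: ebase R i) (F := EFin \o F)).
exact/measurable_EFinP.
Qed.

Lemma mfun2_along i t (F : R * R -> R) : mfun2 F -> mfun2 (fun x => F (along i t x)).
Proof. by move=> mF; exact: measurable_fun_shift. Qed.

Lemma I1_along i t (F : R * R -> R) : mfun2 F ->
  I1 mu (fun x => F (along i t x)) = I1 mu F.
Proof.
move=> mF; rewrite /I1 -(ge0_integral_shift (t *: ebase R i) (F := fun x => (`|F x|)%:E))//.
by apply/measurable_EFinP; exact: measurableT_comp.
Qed.

Lemma integrable_along i t (F : R * R -> R) : mu.-integrable setT (EFin \o F) ->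
  mu.-integrable setT (EFin \o (fun x => F (along i t x))).
Proof. exact: (integrable_shift (t *: ebase R i) (F := EFin \o F)). Qed.

Lemma integrable_mfun2 f : mu.-integrable setT (EFin \o f) -> mfun2 f /\ (I1 mu f < +oo)%E.
Proof. by move=> /integrableP[/measurable_EFinP mf fi]; split. Qed.

Lemma ae_eq_Rintegral f g : mfun2 f -> mfun2 g -> {ae mu, forall x, f x = g x} ->
  \int[mu]_x f x = \int[mu]_x g x.
Proof.
move=> mf mg fg; rewrite /Rintegral; congr fine.
apply: ae_eq_integral => //; [exact/measurable_EFinP|exact/measurable_EFinP|].
by apply: (ae_imp _ fg) => x xE _ /=; rewrite xE.
Qed.

Lemma segment_bounded_integrable (h B : R) (k : R -> R) :
  measurable_fun setT (k : measurableTypeR R -> R) -> (forall t, `|k t| <= B) ->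
  leb.-integrable `[0, h] (EFin \o k).
Proof.
move=> mk kB; apply: measurable_bounded_integrable.
- exact: measurable_itv.
- apply: (@eq_ind_r _ _ (fun z => (z < +oo)%E) _ _ (lebesgue_measure_itv `[0, h])) => /=.
  by case: ifP => _; rewrite ?ltry// -EFinB ltry.
- exact: measurable_funS mk.
- by exists B; split => [|M BM t _ /=]; [exact: num_real|rewrite (le_trans (kB t))// ltW].
Qed.

Lemma integrable_subr f g : mu.-integrable setT (EFin \o f) -> mu.-integrable setT (EFin \o g) ->
  mu.-integrable setT (EFin \o (fun x => f x - g x)).
Proof. by move=> fi gi; have := integrableB measurableT fi gi; exact: eq_integrable. Qed.

Lemma integrable_addr f g : mu.-integrable setT (EFin \o f) -> mu.-integrable setT (EFin \o g) ->
  mu.-integrable setT (EFin \o (fun x => f x + g x)).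
Proof. by move=> fi gi; have := integrableD measurableT fi gi; exact: eq_integrable. Qed.

(** Both sides are tested with phi. The translation is moved onto phi, the increment phi(x - h e) -
    phi(x) is an integral of its derivative over the segment, the weak derivative is applied for
    each t to a translate of phi, and the translation is moved back. *)
Lemma weak_rep i f g : weak_deriv i f g -> rep i f g.
Proof.
move=> [fi gi W] h h0.
have [mf f1] := integrable_mfun2 fi; have [mg g1] := integrable_mfun2 gi.
pose C := fine (I1 mu g).
have CE : (I1 mu g = C%:E)%E by rewrite fineK// ge0_fin_numE// I1_ge0.
pose G1 (z : plane R * measurableTypeR R) := g (along i (1 * z.2) z.1).
have mG1 : measurable_fun setT G1 by exact: measurable_along2.
have G1C t : (\int[mu]_x (`|G1 (x, t)|)%:E <= C%:E)%E.
  by rewrite -CE -(I1_along i (1 * t) mg).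
have [ai iK _] := fubini_segment h0 mG1 G1C.
pose K x := \int[leb]_(t in `[0, h]) g (along i t x).
have KE : (fun x => \int[leb]_(t in `[0, h]) G1 (x, t)) = K.
  by apply/funext => x; apply: eq_Rintegral => t _; rewrite /G1 /= mul1r.
rewrite KE in iK; have [mK _] := integrable_mfun2 iK.
have fhi := integrable_along i h fi.
pose D x := (f (along i h x) - f x) - K x.
have iD : mu.-integrable setT (EFin \o D).
  by apply: integrable_subr => //; exact: integrable_subr.
suff : {ae mu, forall x, D x = 0}.
  by apply: ae_imp => x /eqP; rewrite subr_eq0 => /eqP.
apply: du_bois_reymond => // phi tphi.
have [B B0 phiB] := test_fun_bounded tphi.
have [B' B'0 dphiB] := test_fun_bounded (test_fun_partial i tphi).
have [sphi _ _] := tphi.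
have mphi := smooth_mfun2 sphi; have mdphi := smooth_mfun2 (smooth_partial i sphi).
have i1 := integrable_Mb fhi mphi phiB; have i2 := integrable_Mb fi mphi phiB.
have i3 := integrable_Mb iK mphi phiB.
have -> : \int[mu]_x (D x * phi x) =
   \int[mu]_x (f (along i h x) * phi x) - \int[mu]_x (f x * phi x) - \int[mu]_x (K x * phi x).
  rewrite -RintegralB// -RintegralB//; last exact: integrable_subr.
  by apply: eq_Rintegral => x _; rewrite /D; ring.
apply/eqP; rewrite subr_eq0; apply/eqP.
have -> : \int[mu]_x (f (along i h x) * phi x) = \int[mu]_x (f x * phi (along i (- h) x)).
  rewrite -(Rintegral_along i h (F := fun x => f x * phi (along i (- h) x))).
    by apply: eq_Rintegral => x _; rewrite alongD addNr along0.
  by apply: measurable_funM => //; exact: mfun2_along.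
have mphih : mfun2 (fun x => phi (along i (- h) x)) by exact: mfun2_along.
have phihB x : `|phi (along i (- h) x)| <= B by exact: phiB.
have i4 := integrable_Mb fi mphih phihB.
rewrite -RintegralB//.
(* The derivative in t of phi(x - t e_i), multiplied by f(x). *)
pose G2 (z : plane R * measurableTypeR R) := f z.1 * ((-1) * partial i phi (along i ((-1) * z.2) z.1)).
have mG2 : measurable_fun setT G2.
  apply: measurable_funM; first by apply: (measurableT_comp mf); exact: measurable_fst.
  by apply: measurable_funM => //; exact: (measurable_along2 i (-1) mdphi).
pose C2 := B' * fine (I1 mu f).
have G2C t : (\int[mu]_x (`|G2 (x, t)|)%:E <= C2%:E)%E.
  rewrite /C2 EFinM fineK ?ge0_fin_numE ?I1_ge0//.
  rewrite -ge0_integralZl_EFin//; last first.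
    by apply/measurable_EFinP; exact: measurableT_comp.
  apply: ge0_intle => //.
  - by apply: measurableT_comp => //; exact: measurable_fun_pair1 mG2.
  - by apply: measurable_funM => //; exact: measurableT_comp.
  - by move=> x; rewrite /G2 /= mulN1r normrM normrN mulrC ler_wpM2r.
have [ai2 iK2 F2] := fubini_segment h0 mG2 G2C.
have -> : \int[mu]_x (f x * phi (along i (- h) x) - f x * phi x) =
   \int[mu]_x (\int[leb]_(t in `[0, h]) G2 (x, t)).
  apply: eq_Rintegral => x _; rewrite -mulrBr -[- h]mulN1r ftc_along// -RintegralZl//.
  apply: (@segment_bounded_integrable h B').
    have mp : measurable_fun setT (fun t : measurableTypeR R => partial i phi (along i (-1 * t) x)).
      apply: (@measurable_fun_pair2 _ _ _ _ _ _ (fun z : plane R * measurableTypeR R => partial i phi (along i (-1 * z.2) z.1)) x).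
      exact: measurable_along2.
    exact: measurable_funM.
  by move=> t; rewrite mulN1r normrN.
rewrite F2.
have E3 t : \int[mu]_x G2 (x, t) = \int[mu]_x (g (along i t x) * phi x).
  have tp := test_fun_along i (- t) tphi.
  have := W _ tp => /(congr1 (fun z => - z)); rewrite opprK.
  rewrite -(Rintegral_along i t (F := fun x => g x * phi (along i (- t) x))); last first.
    by apply: measurable_funM => //; exact: mfun2_along.
  move=> Wt.
  have ip : mu.-integrable setT (EFin \o (fun x => f x * partial i (fun x => phi (along i (- t) x)) x)).
    apply: (integrable_Mb (B := B') fi); last by move=> x; rewrite partial_along.
    by apply: smooth_mfun2; apply: smooth_partial; case: tp.
  have Z := @RintegralZl _ _ _ mu setT _ (-1) measurableT ip.
  rewrite mulN1r Wt in Z.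
  transitivity (\int[mu]_x (-1 * (f x * partial i (fun x => phi (along i (- t) x)) x))).
    by apply: eq_Rintegral => x _; rewrite partial_along /G2 /= mulN1r !mulN1r mulrN.
  by rewrite Z; apply: eq_Rintegral => x _; rewrite alongD addNr along0.
under eq_Rintegral do rewrite E3.
pose G3 (z : plane R * measurableTypeR R) := g (along i (1 * z.2) z.1) * phi z.1.
have mG3 : measurable_fun setT G3.
  by apply: measurable_funM => //; apply: (measurableT_comp mphi); exact: measurable_fst.
have G3C t : (\int[mu]_x (`|G3 (x, t)|)%:E <= (B * C)%:E)%E.
  rewrite EFinM -CE -(I1_along i (1 * t) mg) -ge0_integralZl_EFin//; last first.
    by apply/measurable_EFinP; apply: measurableT_comp => //; exact: mfun2_along.
  apply: ge0_intle => //.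
  - by apply: measurableT_comp => //; exact: measurable_fun_pair1 mG3.
  - by apply: measurable_funM => //; apply: measurableT_comp => //; exact: mfun2_along.
  - by move=> x; rewrite /G3 normrM mulrC ler_wpM2r.
have [_ iK3 F3] := fubini_segment h0 mG3 G3C.
have -> : \int[leb]_(t in `[0, h]) (\int[mu]_x (g (along i t x) * phi x)) =
   \int[leb]_(t in `[0, h]) (\int[mu]_x G3 (x, t)).
  by apply: eq_Rintegral => t _; apply: eq_Rintegral => x _; rewrite /G3 /= mul1r.
(* Taking [phi x] out of the inner integral needs g to be integrable along the segment, which is
   known for almost every x. *)
rewrite -F3; apply: ae_eq_Rintegral.
- by have [] := integrable_mfun2 iK3.
- exact: measurable_funM.
- move: ai; apply: ae_imp => x ix; rewrite /K -RintegralZr//.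
  + by apply: eq_Rintegral => t _; rewrite /G3 /= mul1r.
  + by apply: eq_integrable ix => // t _; rewrite /G1 /= mul1r.
Qed.

End Lines.

(** * Difference quotients converging in L2 *)

Section StrongDerivatives.
Variable R : realType.
Implicit Types (f g u v : R * R -> R) (i : 'I_2).
Notation mu := (leb2 R).
Notation leb := (@lebesgue_measure R).

Lemma lebesgue_segment (h : R) : 0 < h ->
  leb (`[0%R, h]%classic : set (measurableTypeR R)) = h%:E.
Proof. by move=> h0; have := lebesgue_measure_itv `[0, h]; rewrite /= lte_fin h0 -EFinB subr0. Qed.

Lemma Rintegral_cst_segment (h a : R) : 0 < h -> \int[leb]_(t in `[0, h]) a = a * h.
Proof.
move=> h0; have mS : measurable (`[0, h]%classic : set (measurableTypeR R)) by exact: measurable_itv.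
have -> := @Rintegral_cst _ _ R leb _ mS a; congr (_ * _).
exact: (congr1 fine (lebesgue_segment h0)).
Qed.

(** With c the mean of k, integrate 2 c k - c^2 <= k^2 over the segment. *)
Lemma jensen_segment (h : R) (k : measurableTypeR R -> R) : 0 < h -> measurable_fun setT k ->
  leb.-integrable `[0, h] (EFin \o k) ->
  ((((\int[leb]_(t in `[0, h]) k t) / h) ^+ 2)%R%:E <=
   h^-1%:E * \int[leb]_(t in `[0%R, h]) ((k t) ^+ 2)%:E)%E.
Proof.
move=> h0 mk ik; set S := `[0, h]%classic.
have mS : measurable (S : set (measurableTypeR R)) by exact: measurable_itv.
have lS := lebesgue_segment h0.
have hi0 : (0 < h^-1) by rewrite invr_gt0.
have J0 : (0 <= \int[leb]_(t in S) ((k t) ^+ 2)%:E)%E.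
  by apply: integral_ge0 => t _; rewrite lee_fin sqr_ge0.
have [Joo|Jfin] := eqVneq (\int[leb]_(t in S) ((k t) ^+ 2)%:E)%E +oo%E.
  by rewrite Joo gt0_muley ?lte_fin// leey.
have ik2 : leb.-integrable S (EFin \o (fun t => (k t) ^+ 2)).
  apply/integrableP; split.
    by apply/measurable_EFinP; apply: measurable_funX; exact: measurable_funS mk.
  rewrite (eq_integral (fun t => ((k t) ^+ 2)%:E)); first by rewrite lt_neqAle Jfin leey.
  by move=> t _; rewrite /= ger0_norm ?sqr_ge0.
set I := \int[leb]_(t in S) k t; pose c := I / h.
have icst (a : R) : leb.-integrable S (EFin \o (fun=> a)).
  by apply: (@segment_bounded_integrable R h `|a| (fun=> a)) => //.
have ick : leb.-integrable S (EFin \o (fun t => (2 * c) * k t)).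
  have := integrableZl mS (2 * c) ik; exact: eq_integrable.
have ickc : leb.-integrable S (EFin \o (fun t => (2 * c) * k t - c ^+ 2)).
  have := integrableB mS ick (icst (c ^+ 2)); exact: eq_integrable.
have H : \int[leb]_(t in S) ((2 * c) * k t - c ^+ 2) <= \int[leb]_(t in S) ((k t) ^+ 2).
  apply: le_Rintegral => // t _; have := sqr_ge0 (k t - c); nra.
have E1 : \int[leb]_(t in S) ((2 * c) * k t - c ^+ 2) = 2 * c * I - c ^+ 2 * h.
  rewrite (RintegralB mS ick (icst (c ^+ 2))) (RintegralZl _ mS ik).
  by rewrite Rintegral_cst_segment.
have E2 : (\int[leb]_(t in S) ((k t) ^+ 2)%:E = (\int[leb]_(t in S) ((k t) ^+ 2))%:E)%E.
  by rewrite /Rintegral fineK//; exact: integrable_fin_num.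
rewrite E2 -EFinM lee_fin; rewrite E1 in H.
have -> : (I / h) ^+ 2 = h^-1 * (2 * c * I - c ^+ 2 * h).
  by rewrite /c; field; rewrite gt_eqF.
by rewrite ler_wpM2l// ltW.
Qed.

Lemma tonelli_segment (H : plane R * measurableTypeR R -> R) (h : R) :
  measurable_fun setT H -> (forall z, 0 <= H z) ->
  (\int[mu]_x \int[leb]_(t in `[0%R, h]) (H (x, t))%:E =
   \int[leb]_(t in `[0%R, h]) \int[mu]_x (H (x, t))%:E)%E.
Proof.
move=> mH H0.
pose S : set (measurableTypeR R) := `[0, h]%classic.
have mS : measurable S by exact: measurable_itv.
pose m1 : {sigma_finite_measure set (plane R) -> \bar R} := @leb2sf R.
pose F (z : plane R * measurableTypeR R) := (H z * \1_S z.2)%:E.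
have mF : measurable_fun setT F.
  apply/measurable_EFinP; apply: measurable_funM => //.
  have mi : measurable_fun setT (\1_S : measurableTypeR R -> R) by exact: measurable_indic.
  exact: (measurableT_comp mi measurable_snd).
have F0 z : (0 <= F z)%E by rewrite lee_fin mulr_ge0// indicE.
have E : (\int[mu]_x \int[leb]_t F (x, t) = \int[leb]_t \int[mu]_x F (x, t))%E.
  exact: (@fubini_tonelli _ _ _ _ R m1 leb F mF F0).
transitivity (\int[mu]_x \int[leb]_t F (x, t))%E.
  apply: eq_integral => x _; rewrite [LHS]integral_mkcond; apply: eq_integral => t _.
  by rewrite /patch /F indicE /=; case: (t \in S); rewrite ?mulr1 ?mulr0.
rewrite E [RHS]integral_mkcond; apply: eq_integral => t _.
rewrite /patch /F /= indicE; case: ifPn => _.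
  by apply: eq_integral => x _; rewrite mulr1.
by rewrite integral0_eq// => x _; rewrite mulr0.
Qed.

Lemma measurable_int_segment (H : plane R * measurableTypeR R -> R) (h : R) :
  measurable_fun setT H -> (forall z, 0 <= H z) ->
  mfun2 (fun x => (\int[leb]_(t in `[0%R, h]) (H (x, t))%:E)%E).
Proof.
move=> mH H0.
pose S : set (measurableTypeR R) := `[0, h]%classic.
have mS : measurable S by exact: measurable_itv.
pose F (z : plane R * measurableTypeR R) := (H z * \1_S z.2)%:E.
have mF : measurable_fun setT F.
  apply/measurable_EFinP; apply: measurable_funM => //.
  have mi : measurable_fun setT (\1_S : measurableTypeR R -> R) by exact: measurable_indic.
  exact: (measurableT_comp mi measurable_snd).
have F0 z : (0 <= F z)%E by rewrite lee_fin mulr_ge0// indicE.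
rewrite (_ : (fun x => _) = fun x : plane R => (\int[leb]_t F (x, t))%E).
  exact: (@measurable_fun_fubini_tonelli_F _ _ _ _ _ leb F mF F0).
apply/funext => x; rewrite [LHS]integral_mkcond; apply: eq_integral => t _.
by rewrite /patch /F indicE /=; case: (t \in S); rewrite ?mulr1 ?mulr0.
Qed.

Lemma measurable_int_plane (H : plane R * measurableTypeR R -> R) :
  measurable_fun setT H -> (forall z, 0 <= H z) ->
  measurable_fun setT (fun t : measurableTypeR R => (\int[mu]_x (H (x, t))%:E)%E).
Proof.
move=> mH H0.
have mHE : measurable_fun setT (EFin \o H) by exact/measurable_EFinP.
have H0E z : (0 <= (EFin \o H) z)%E by rewrite lee_fin.
exact: (@measurable_fun_fubini_tonelli_G _ _ (plane R) _ R (@leb2sf R) (EFin \o H) mHE H0E).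
Qed.

Definition hn (n : nat) : R := n.+1%:R^-1.

Lemma hn_gt0 n : 0 < hn n. Proof. by rewrite invr_gt0 ltr0n. Qed.

Lemma hn_near (e : R) : 0 < e -> \forall n \near \oo, hn n < e.
Proof. by move=> e0; exact: (near_infty_natSinv_lt (PosNum e0)). Qed.

Definition dq i n f (x : R * R) : R := (f (along i (hn n) x) - f x) / hn n.

(** Only measurability is asked of [f]: functions such as [rad 1 f0 f1], which are at least 1
    everywhere, have a strong derivative without being in L2 of the plane. *)
Definition strong_deriv i f g := [/\ mfun2 f, L2 mu g &
  to0 (fun n => I2 mu (fun x => dq i n f x - g x))].

Lemma mfun2_dq i n f : mfun2 f -> mfun2 (dq i n f).
Proof.
move=> mf; apply: measurable_funM => //; apply: measurable_funB => //.
exact: mfun2_along.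
Qed.

Lemma ebase_le1 i : `|(ebase R i).1| <= 1 /\ `|(ebase R i).2| <= 1.
Proof. by rewrite /ebase /=; split; case: eqP => _; rewrite ?normr1 ?normr0. Qed.

Lemma L2_along_continuous i g : L2 mu g -> forall e, 0 < e -> exists2 d : R, 0 < d &
  forall t, `|t| < d -> (I2 mu (fun x => (g (along i t x) - g x)%R) <= e%:E)%E.
Proof.
move=> /L2_translation_continuous tg e e0; have [d d0 hd] := tg e e0.
exists d => // t td; apply: hd; rewrite /= normrM; apply: le_lt_trans td;
by rewrite ler_piMr//; have [] := ebase_le1 i.
Qed.

(** The difference quotient minus g is the mean over [0, h] of g(x + t e) - g(x). Jensen and Tonelli
    bound its squared norm by the mean of the squared norms of these increments, which are small by
    continuity of translations. *)
Lemma rep_strong i f g : mfun2 f -> mu.-integrable setT (EFin \o g) -> L2 mu g -> rep i f g ->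
  strong_deriv i f g.
Proof.
move=> mf gi g2 fg; split => // e e0; have [mg _] := g2.
have [d d0 hd] := L2_along_continuous i g2 e0.
have := hn_near d0; apply: filterS => n hnd; have h0 := hn_gt0 n.
set h := hn n in hnd h0 *.
pose G (z : plane R * measurableTypeR R) := g (along i (1 * z.2) z.1) - g z.1.
have mG1 : measurable_fun setT (fun z : plane R * measurableTypeR R => g (along i (1 * z.2) z.1)).
  exact: measurable_along2.
have mG : measurable_fun setT G.
  apply: measurable_funB => //.
  by apply: (measurableT_comp mg); exact: measurable_fst.
have mG2 : measurable_fun setT (fun z => (G z) ^+ 2) by exact: measurable_funX.
pose C := fine (I1 mu g).
have [_ g1] := integrable_mfun2 gi.
have CE : (I1 mu g = C%:E)%E by rewrite fineK// ge0_fin_numE// I1_ge0.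
have GC t : (\int[mu]_x (`|(fun z : plane R * measurableTypeR R => g (along i (1 * z.2) z.1)) (x, t)|)%:E <= C%:E)%E.
  by rewrite -CE -(I1_along i (1 * t) mg).
have [ai _ _] := fubini_segment h0 mG1 GC.
have mS : measurable (`[0, h]%classic : set (measurableTypeR R)) by exact: measurable_itv.
apply: (@le_trans _ _ (\int[mu]_x (h^-1%:E * \int[leb]_(t in `[0%R, h]) ((G (x, t)) ^+ 2)%:E))%E).
  have mdq := mfun2_dq i n mf.
  apply: ae_ge0_le_integral => //.
  - by move=> x _; rewrite lee_fin sqr_ge0.
  - by apply/measurable_EFinP; apply: measurable_funX; exact: measurable_funB.
  - move=> x _; apply: mule_ge0; first by rewrite lee_fin invr_ge0 ltW.
    by apply: integral_ge0 => t _; rewrite lee_fin sqr_ge0.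
  - by apply: measurable_funeM; apply: (measurable_int_segment h mG2) => z; exact: sqr_ge0.
  - apply: (ae_imp _ (ae_and ai (fg h h0))) => x [aix fgx] _.
    have ig : leb.-integrable `[0, h] (EFin \o (fun t => g (along i t x))).
      by apply: eq_integrable aix => // t _; rewrite /= mul1r.
    have ic : leb.-integrable `[0, h] (EFin \o (fun=> g x)).
      by apply: (@segment_bounded_integrable R h `|g x| (fun=> g x)).
    have mGx : measurable_fun setT (fun t : measurableTypeR R => G (x, t)).
      exact: measurable_fun_pair2.
    have iGx : leb.-integrable `[0, h] (EFin \o (fun t => G (x, t))).
      have := integrableB mS ig ic; apply: eq_integrable => // t _.
      by rewrite /G /= mul1r.
    have := jensen_segment h0 mGx iGx; congr (_ <= _)%E; congr EFin; congr (_ ^+ 2).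
    have -> : \int[leb]_(t in `[0, h]) G (x, t) = \int[leb]_(t in `[0, h]) (g (along i t x) - g x).
      by apply: eq_Rintegral => t _; rewrite /G /= mul1r.
    rewrite (RintegralB mS ig ic) Rintegral_cst_segment// -fgx /dq -/h.
    by rewrite mulrBl mulfK// gt_eqF.
rewrite ge0_integralZl_EFin//; last 3 first.
- by move=> x _; apply: integral_ge0 => t _; rewrite lee_fin sqr_ge0.
- by apply: (measurable_int_segment h mG2) => z; exact: sqr_ge0.
- by rewrite invr_ge0 ltW.
rewrite [X in (_ * X)%E](tonelli_segment h mG2 (fun z => sqr_ge0 (G z))).
apply: (@le_trans _ _ (h^-1%:E * \int[leb]_(t in `[0%R, h]) e%:E)%E).
  apply: lee_wpmul2l; first by rewrite lee_fin invr_ge0 ltW.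
  apply: ge0_le_integral => //.
  - by move=> t _; apply: integral_ge0 => x _; rewrite lee_fin sqr_ge0.
  - apply: measurable_funTS; apply: (measurable_int_plane mG2) => z; exact: sqr_ge0.
  - move=> t; rewrite /= in_itv/= => /andP[t0 th].
    have td : `|t| < d by rewrite ger0_norm// (le_lt_trans th).
    apply: le_trans (hd t td); rewrite le_eqVlt; apply/orP; left; apply/eqP.
    by apply: eq_integral => x _; rewrite /G /= mul1r.
have -> : (\int[leb]_(t in `[0%R, h]) e%:E = e%:E * h%:E)%E.
  by rewrite (@integral_cst _ _ _ leb _ mS); congr (_ * _)%E; exact: lebesgue_segment.
by rewrite -!EFinM lee_fin mulrCA mulVf ?mulr1// gt_eqF.
Qed.

End StrongDerivatives.

(** * Chain rule, integration by parts and Jacobians for strong derivatives *)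

Section Calculus.
Variable R : realType.
Implicit Types (f g u v phi : R * R -> R) (i : 'I_2).
Notation mu := (leb2 R).
Notation leb := (@lebesgue_measure R).

Lemma hn_le1 n : hn R n <= 1.
Proof. by rewrite invf_le1 ?ltr0n// ler1n. Qed.

Lemma to0_hn (c : \bar R) : (0 <= c)%E -> (c < +oo)%E ->
  to0 (fun n => (hn R n ^+ 2)%:E * c)%E.
Proof.
move=> c0 coo e e0; have cf : c \is a fin_num by rewrite ge0_fin_numE.
rewrite -(fineK cf); set r := fine c; have r0 : 0 <= r by exact: fine_ge0.
have er : 0 < e / (r + 1) by rewrite divr_gt0// ltr_pwDr.
have := hn_near er; apply: filterS => n hn1.
rewrite -EFinM lee_fin.
have h0 := hn_gt0 R n; have h1 := hn_le1 n.
apply: (@le_trans _ _ (hn R n * r)).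
  by rewrite ler_wpM2r// expr2 ler_piMl// ltW.
apply: le_trans (mul_div_add1_le r0 e0).
by rewrite mulrC ler_wpM2l// ltW.
Qed.

(* The remainder of the difference quotient is at most min(C h S, B) S, where S is the sum of
   the difference quotients of f0 and f1: the first factor is bounded and tends to 0 in L2,
   and S converges in L2. *)
Lemma strong_chain i f0 f1 d0 d1 (Phi Phi0 Phi1 : R -> R -> R) (J : R -> R -> Prop) (B C : R) :
  0 <= B -> 0 <= C ->
  strong_deriv i f0 d0 -> strong_deriv i f1 d1 -> (forall x, J (f0 x) (f1 x)) ->
  mfun2 (fun x => Phi (f0 x) (f1 x)) -> mfun2 (fun x => Phi0 (f0 x) (f1 x)) ->
  mfun2 (fun x => Phi1 (f0 x) (f1 x)) ->
  (forall a b, J a b -> `|Phi0 a b| <= B /\ `|Phi1 a b| <= B) ->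
  (forall a b a' b', J a b -> J a' b' ->
    `|Phi a' b' - Phi a b - (Phi0 a b * (a' - a) + Phi1 a b * (b' - b))| <=
      C * (`|a' - a| + `|b' - b|) ^+ 2) ->
  (forall a b a' b', J a b -> J a' b' ->
    `|Phi a' b' - Phi a b - (Phi0 a b * (a' - a) + Phi1 a b * (b' - b))| <=
      B * (`|a' - a| + `|b' - b|)) ->
  strong_deriv i (fun x => Phi (f0 x) (f1 x))
    (fun x => Phi0 (f0 x) (f1 x) * d0 x + Phi1 (f0 x) (f1 x) * d1 x).
Proof.
move=> B0 C0 [mf0 L0 t0] [mf1 L1 t1] Jf mP mP0 mP1 P01 PC PB.
have [md0 _] := L0; have [md1 _] := L1.
have mg : mfun2 (fun x => Phi0 (f0 x) (f1 x) * d0 x + Phi1 (f0 x) (f1 x) * d1 x).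
  by apply: measurable_funD; exact: measurable_funM.
have Lg : L2 mu (fun x => Phi0 (f0 x) (f1 x) * d0 x + Phi1 (f0 x) (f1 x) * d1 x).
  rewrite (_ : (fun x => _) = fun x => d0 x * Phi0 (f0 x) (f1 x) + d1 x * Phi1 (f0 x) (f1 x)); last first.
    by apply/funext => x; rewrite mulrC [X in _ + X]mulrC.
  by apply: L2D; apply: (@L2Mb _ _ _ _ B) => // x; have [] := P01 _ _ (Jf x).
split => //.
pose r n x := `|dq i n f0 x - d0 x| + `|dq i n f1 x - d1 x|.
pose S n x := `|dq i n f0 x| + `|dq i n f1 x|.
pose D x := `|d0 x| + `|d1 x|.
have LD : L2 mu D.
  have h (z : R * R -> R) : L2 mu z -> L2 mu (fun x => `|z x|).
    move=> zL; apply: (L2_le _ zL) => [|x]; last by rewrite normr_id.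
    by apply: measurableT_comp => //; case: zL.
  by apply: L2D; exact: h.
have [mD _] := LD.
have mq0 n := mfun2_dq i n mf0; have mq1 n := mfun2_dq i n mf1.
have mr n : mfun2 (r n).
  by apply: measurable_funD; apply: measurableT_comp => //; exact: measurable_funB.
have mS n : mfun2 (S n) by apply: measurable_funD; exact: measurableT_comp.
have r0 n x : 0 <= r n x by rewrite addr_ge0.
have D0 x : 0 <= D x by rewrite addr_ge0.
have S0 n x : 0 <= S n x by rewrite addr_ge0.
have SrD n x : S n x <= r n x + D x.
  rewrite /S /r /D; have h (a b : R) : `|a| <= `|a - b| + `|b|.
    by rewrite -{1}(subrK b a) ler_normD.
  by have := h (dq i n f0 x) (d0 x); have := h (dq i n f1 x) (d1 x); lra.
have tr : to0 (fun n => I2 mu (r n)).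
  apply: (@to0_le _ _ (fun n => 2%:E * I2 mu (fun x => dq i n f0 x - d0 x)%R + 2%:E * I2 mu (fun x => dq i n f1 x - d1 x)%R)%E).
    move=> n; apply: I2_lin => //; try exact: measurable_funB.
    move=> x; rewrite /r -(real_normK (num_real (dq i n f0 x - d0 x))) -(real_normK (num_real (dq i n f1 x - d1 x))).
    by have := sqr_ge0 (`|dq i n f0 x - d0 x| - `|dq i n f1 x - d1 x|); nra.
  by apply: to0D; apply: to0Z.
pose m n x := Num.min (C * (hn R n * S n x)) B.
have mm n : mfun2 (m n).
  apply: measurable_minr => //; apply: measurable_funM => //; exact: measurable_funM.
have m0 n x : 0 <= m n x.
  by rewrite le_min B0 andbT !mulr_ge0// ltW// hn_gt0.
have mB n x : `|m n x| <= B by rewrite ger0_norm// ge_min lexx orbT.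
have tm : to0 (fun n => I2 mu (m n)).
  apply: (@to0_le _ _ (fun n => (2 * C ^+ 2)%R%:E * I2 mu (r n) + (2 * C ^+ 2)%R%:E * ((hn R n ^+ 2)%:E * I2 mu D))%E).
    move=> n; rewrite -I2Z//; apply: I2_lin => //; try exact: measurable_funM.
    - by rewrite mulr_ge0// sqr_ge0.
    - by rewrite mulr_ge0// sqr_ge0.
    - move=> x; have h0 := hn_gt0 R n; have h1 := hn_le1 n.
      apply: (@le_trans _ _ ((C * (r n x + hn R n * D x)) ^+ 2)).
        rewrite lerXn2r ?nnegrE//; first by rewrite mulr_ge0// addr_ge0// mulr_ge0// ltW.
        apply: (@le_trans _ _ (C * (hn R n * S n x))); first by rewrite ge_min lexx.
        apply: ler_wpM2l => //; apply: (@le_trans _ _ (hn R n * (r n x + D x))).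
          by apply: ler_wpM2l => //; exact: ltW.
        by rewrite mulrDr lerD2r ler_piMl.
      move: (r n x) (D x) (hn R n) => rr dd hh.
      by have := sqr_ge0 (C * (rr - hh * dd)); clear; lra.
  apply: to0D; apply: to0Z; rewrite ?mulr_ge0 ?sqr_ge0//.
  by apply: to0_hn; [exact: I2_ge0|case: LD].
have tmD : to0 (fun n => I2 mu (fun x => m n x * D x)) by exact: (@to0_I2M _ _ _ _ B).
(* From (2 B r + m D)^2 <= 2 (2 B r)^2 + 2 (m D)^2. One B r bounds the error of the inner difference
   quotients, the other comes from m S <= m (r + D) <= B r + m D. *)
apply: (@to0_le _ _ (fun n => (8 * B ^+ 2)%R%:E * I2 mu (r n) + 2%:E * I2 mu (fun x => m n x * D x)%R)%E); last first.
  by apply: to0D; apply: to0Z => //; rewrite mulr_ge0 ?sqr_ge0.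
move=> n; have mqP := mfun2_dq i n mP.
apply: I2_lin => //.
- exact: measurable_funM.
- exact: measurable_funB.
- by rewrite mulr_ge0 ?sqr_ge0.
move=> x; have h0 := hn_gt0 R n.
set a := f0 x; set b := f1 x; set a' := f0 (along i (hn R n) x); set b' := f1 (along i (hn R n) x).
have Jx : J a b := Jf x; have Jx' : J a' b' := Jf (along i (hn R n) x).
have aE : a' - a = hn R n * dq i n f0 x by rewrite /dq -/a -/a' mulrC divfK// gt_eqF.
have bE : b' - b = hn R n * dq i n f1 x by rewrite /dq -/b -/b' mulrC divfK// gt_eqF.
have SE : `|a' - a| + `|b' - b| = hn R n * S n x.
  by rewrite aE bE (normrM (hn R n) (dq i n f0 x)) (normrM (hn R n) (dq i n f1 x)) (gtr0_norm h0) -mulrDr.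
set E := Phi a' b' - Phi a b - (Phi0 a b * (a' - a) + Phi1 a b * (b' - b)).
have E1 : `|E| <= hn R n * (m n x * S n x).
  rewrite /m /Num.min; case: ifP => _.
    by apply: (le_trans (PC _ _ _ _ Jx Jx')); rewrite SE expr2 le_eqVlt; apply/orP; left; apply/eqP; ring.
  by apply: (le_trans (PB _ _ _ _ Jx Jx')); rewrite SE le_eqVlt; apply/orP; left; apply/eqP; ring.
have -> : dq i n (fun x => Phi (f0 x) (f1 x)) x - (Phi0 a b * d0 x + Phi1 a b * d1 x) =
    E / hn R n + (Phi0 a b * (dq i n f0 x - d0 x) + Phi1 a b * (dq i n f1 x - d1 x)).
  rewrite {1}/dq /E aE bE -/a -/b -/a' -/b'; field; by rewrite gt_eqF.
have [p0 p1] := P01 _ _ Jx.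
have Z : `|E / hn R n + (Phi0 a b * (dq i n f0 x - d0 x) + Phi1 a b * (dq i n f1 x - d1 x))| <= 2 * B * r n x + m n x * D x.
  have q1 : `|E / hn R n| <= m n x * S n x.
    by rewrite normrM normfV (gtr0_norm h0) ler_pdivrMr// mulrC.
  have q2 : m n x * S n x <= B * r n x + m n x * D x.
    apply: (@le_trans _ _ (m n x * (r n x + D x))); first by rewrite ler_wpM2l.
    by rewrite mulrDr lerD2r ler_wpM2r// -(ger0_norm (m0 n x)).
  have q3 : `|Phi0 a b * (dq i n f0 x - d0 x) + Phi1 a b * (dq i n f1 x - d1 x)| <= B * r n x.
    apply: (le_trans (ler_normD _ _)); rewrite !normrM /r mulrDr.
    by apply: lerD; rewrite ler_wpM2r.
  apply: (le_trans (ler_normD _ _)); have := lerD (le_trans q1 q2) q3; lra.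
rewrite -(real_normK (num_real (_ + _))).
apply: (@le_trans _ _ ((2 * B * r n x + m n x * D x) ^+ 2)).
  by rewrite lerXn2r ?nnegrE// (le_trans _ Z).
have := sqr_ge0 (2 * B * r n x - m n x * D x); nra.
Qed.

Lemma integral_along_sub i (t : R) f : mu.-integrable setT (EFin \o f) ->
  \int[mu]_x (f (along i t x) - f x) = 0.
Proof.
move=> fi; have [mf _] := integrable_mfun2 fi.
by rewrite RintegralB//; [rewrite Rintegral_along// subrr|exact: integrable_along].
Qed.

Lemma L2_along i t f : L2 mu f -> L2 mu (fun x => f (along i t x)).
Proof. exact: L2_shift. Qed.

Lemma L2_dq i n f : L2 mu f -> L2 mu (dq i n f).
Proof.
move=> f2; have := L2Z ((hn R n)^-1) (L2B (L2_along i (hn R n) f2) f2).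
by congr (L2 _); apply/funext => x; rewrite /dq mulrC.
Qed.

(** The discrete product rule translates one factor by the same step [hn R n]. The error splits into
    a translate of c n - g and an increment of g. *)
Lemma to0_along i (c : nat -> R * R -> R) g : L2 mu g -> (forall n, mfun2 (c n)) ->
  to0 (fun n => I2 mu (fun x => c n x - g x)) ->
  to0 (fun n => I2 mu (fun x => c n (along i (hn R n) x) - g x)).
Proof.
move=> g2 mc cg; have [mg _] := g2.
have tg : to0 (fun n => I2 mu (fun x => g (along i (hn R n) x) - g x)).
  move=> e e0; have [d d0 hd] := L2_along_continuous i g2 e0.
  have := hn_near d0; apply: filterS => n hnd; apply: hd.
  by rewrite gtr0_norm// hn_gt0.
apply: (@to0_le _ _ (fun n => 2%:E * I2 mu (fun x => c n x - g x)%R + 2%:E * I2 mu (fun x => g (along i (hn R n) x) - g x)%R)%E); last first.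
  by apply: to0D; apply: to0Z.
move=> n; have mcg : mfun2 (fun x => c n x - g x) by exact: measurable_funB.
have mcga : mfun2 (fun x => c n (along i (hn R n) x) - g (along i (hn R n) x)).
  exact: (mfun2_along i (hn R n) mcg).
have mga : mfun2 (fun x => g (along i (hn R n) x)) by exact: mfun2_along.
have mca : mfun2 (fun x => c n (along i (hn R n) x)) by exact: mfun2_along.
have <- : I2 mu (fun x => c n (along i (hn R n) x) - g (along i (hn R n) x)) = I2 mu (fun x => c n x - g x).
  exact: (I2_shift _ mcg).
apply: I2_lin => //; [exact: measurable_funB|exact: measurable_funB|].
move=> x; set A := c n _; set B := g (along _ _ _); set D := g x.
by have := sqr_ge0 (A - B - (B - D)); clear; lra.
Qed.

Lemma to0_cstfun f : to0 (fun n : nat => I2 mu (fun x => f x - f x)).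
Proof.
apply: (@to0_le _ _ (fun=> 0%E)) => [n|e e0].
  rewrite /I2 (eq_integral (cst 0%E)) ?integral0// => x _.
  by rewrite subrr expr0n.
by apply: nearW => n; rewrite lee_fin ltW.
Qed.

(** By the discrete Leibniz rule, with one factor translated, the sum of the two products is the
    difference quotient of f g, whose integral is 0. *)
Lemma strong_ibp i f g f' g' : L2 mu f -> L2 mu g ->
  strong_deriv i f f' -> strong_deriv i g g' ->
  \int[mu]_x (f' x * g x + f x * g' x) = 0.
Proof.
move=> f2 g2 [mf f'2 tf] [mg g'2 tg].
have tga : to0 (fun n => I2 mu (fun x => g (along i (hn R n) x) - g x)).
  exact: (@to0_along i (fun=> g) g g2 (fun=> mg) (to0_cstfun g)).
have iP n : mu.-integrable setT (EFin \o (fun x => dq i n f x * g (along i (hn R n) x) + f x * dq i n g x)).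
  by apply: integrable_addr; apply: L2_integrableM => //;
    [exact: L2_dq|exact: L2_along|exact: L2_dq].
refine (@L2_cv_eq0 _ (plane R) R mu (fun n => dq i n f) (fun n x => g (along i (hn R n) x))
  f' g (fun=> f) (fun n => dq i n g) f g' _ _ _ _ _ _ _ _ _ _ _ _ _ _) => //.
- by move=> n; exact: mfun2_dq.
- by move=> n; exact: mfun2_along.
- by move=> n; exact: mfun2_dq.
- exact: to0_cstfun.
move=> n; have h0 := hn_gt0 R n.
have ifg : mu.-integrable setT (EFin \o (fun x => f x * g x)) by exact: L2_integrableM.
have i1 := integrable_subr (integrable_along i (hn R n) ifg) ifg.
rewrite -[LHS]fineK; last by exact: (integrable_fin_num measurableT (iP n)).
congr EFin.
transitivity (\int[mu]_x ((hn R n)^-1 * (f (along i (hn R n) x) * g (along i (hn R n) x) - f x * g x))).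
  by apply: eq_Rintegral => x _; rewrite /dq; ring.
by rewrite RintegralZl// (integral_along_sub i (hn R n) ifg) mulr0.
Qed.

(* The discrete Jacobian of two functions is a sum of differences of translates. *)
Lemma strong_jacobian u g u0 u1 g0 g1 (i j : 'I_2) : L2 mu u -> L2 mu g ->
  strong_deriv i u u0 -> strong_deriv j u u1 ->
  strong_deriv i g g0 -> strong_deriv j g g1 ->
  \int[mu]_x (u0 x * g1 x + u1 x * - g0 x) = 0.
Proof.
move=> u2 g2 [mu' u02 tu0] [_ u12 tu1] [mg g02 tg0] [_ g12 tg1].
have LN (z : R * R -> R) : L2 mu z -> L2 mu (fun x => - z x).
  move=> z2; have := L2Z (-1) z2; congr (L2 _).
  by apply/funext => x; rewrite mulN1r.
have b1 n : L2 mu (fun x => dq j n g (along i (hn R n) x)).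
  by apply: L2_along; exact: L2_dq.
have b2 n : L2 mu (fun x => - dq i n g (along j (hn R n) x)).
  by apply: LN; apply: L2_along; exact: L2_dq.
have iP n : mu.-integrable setT (EFin \o (fun x => dq i n u x * dq j n g (along i (hn R n) x) + dq j n u x * - dq i n g (along j (hn R n) x))).
  by apply: integrable_addr; apply: L2_integrableM => //; exact: L2_dq.
refine (@L2_cv_eq0 _ (plane R) R mu (fun n => dq i n u) (fun n x => dq j n g (along i (hn R n) x))
  u0 g1 (fun n => dq j n u) (fun n x => - dq i n g (along j (hn R n) x))
  u1 (fun x => - g0 x) _ _ _ _ _ _ _ _ _ _ _ _ _ _) => //.
- by move=> n; exact: mfun2_dq.
- by move=> n; case: (b1 n).
- by move=> n; exact: mfun2_dq.
- by move=> n; case: (b2 n).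
- exact: LN.
- exact: (@to0_along i (fun n => dq j n g) g1 g12 (fun n => mfun2_dq j n mg) tg1).
- have := @to0_along j (fun n => dq i n g) g0 g02 (fun n => mfun2_dq i n mg) tg0.
  apply: to0_le => n; rewrite le_eqVlt; apply/orP; left; apply/eqP.
  by apply: eq_integral => x _; congr EFin; rewrite -opprB sqrrN; congr (_ ^+ 2); ring.
move=> n; set h := hn R n; have h0 : 0 < h := hn_gt0 R n.
rewrite -[LHS]fineK; last by exact: (integrable_fin_num measurableT (iP n)).
congr EFin.
pose A x := along i h x; pose B x := along j h x.
have AB x : A (B x) = B (A x) by rewrite /A /B /along /shift2 addrAC.
have i1 : mu.-integrable setT (EFin \o (fun x => u x * g (B x))) by apply: L2_integrableM => //; exact: L2_along.
have i2 : mu.-integrable setT (EFin \o (fun x => u x * g x)) by exact: L2_integrableM.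
have i3 : mu.-integrable setT (EFin \o (fun x => u x * g (A x))) by apply: L2_integrableM => //; exact: L2_along.
have j1 := integrable_subr (integrable_along i h i1) i1.
have j2 := integrable_subr (integrable_along i h i2) i2.
have j3 := integrable_subr (integrable_along j h i3) i3.
have j4 := integrable_subr (integrable_along j h i2) i2.
(* The terms [u x * g (B (A x))] of the two products cancel since the translations commute. The rest
   is grouped into differences of a function and its translate. *)
pose W x := ((u (A x) * g (B (A x)) - u x * g (B x)) - (u (A x) * g (A x) - u x * g x))
  - ((u (B x) * g (A (B x)) - u x * g (A x)) - (u (B x) * g (B x) - u x * g x)).
have jj1 := integrable_subr j1 j2; have jj2 := integrable_subr j3 j4.
have jW : mu.-integrable setT (EFin \o W) := integrable_subr jj1 jj2.
transitivity (\int[mu]_x ((h^-1 * h^-1) * W x)).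
  by apply: eq_Rintegral => x _; rewrite /W AB /dq -/h -/(A x) -/(B x) -/(B (A x)) -/(A (B x)) AB; ring.
rewrite RintegralZl// /W.
rewrite (RintegralB measurableT jj1 jj2) (RintegralB measurableT j1 j2) (RintegralB measurableT j3 j4).
rewrite (integral_along_sub i h i1) (integral_along_sub i h i2).
by rewrite (integral_along_sub j h i3) (integral_along_sub j h i2) !subrr mulr0.
Qed.

Lemma weak_strong i f g : weak_deriv i f g -> L2 mu g -> strong_deriv i f g.
Proof.
move=> W g2; have [fi gi _] := W; have [mf _] := integrable_mfun2 fi.
exact: rep_strong (weak_rep W).
Qed.

Lemma L2_square n : L2 mu (\1_(@square R n) : R * R -> R).
Proof. exact: (L2_indic (@measurable_square R n) (@square_fin R n)). Qed.

Lemma L2_supp n f (B : R) : mfun2 f -> (forall x, `|f x| <= B) ->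
  (forall x, f x != 0 -> square n x) -> L2 mu f.
Proof.
move=> mf fB fS.
apply: (@L2_le _ _ _ mu f (fun x => `|B| * \1_(@square R n) x) mf (L2Z `|B| (L2_square n))) => x.
rewrite normrM normr_id indicE; have [->|f0] := eqVneq (f x) 0.
  by rewrite normr0 mulr_ge0.
by rewrite mem_set ?normr1 ?mulr1; [exact: le_trans (ler_norm _)|exact: fS].
Qed.

Lemma L2_supp_integrable n f : L2 mu f -> (forall x, f x != 0 -> square n x) ->
  mu.-integrable setT (EFin \o f).
Proof.
move=> f2 fS; have := L2_integrableM f2 (L2_square n).
apply: eq_integrable => // x _ /=; congr EFin; rewrite indicE.
have [->|f0] := eqVneq (f x) 0; first by rewrite mul0r.
by rewrite mem_set ?mulr1//; exact: fS.
Qed.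

Lemma test_fun_square Omega phi : test_fun Omega phi ->
  exists n, forall x, tsupp phi x -> square n x.
Proof.
move=> [_ cphi _]; have [M [Mr hM]] := compact_bounded cphi.
have [n hn'] : exists n : nat, `|M| + 1 < n%:R.
  by exists (Num.bound (`|M| + 1)); apply: archi_boundP; rewrite addr_ge0.
exists n => x px.
have xM : `|x| <= `|M| + 1.
  by apply: (hM (`|M| + 1)) => //; rewrite (le_lt_trans (ler_norm _))// ltrDl.
have x1 : `|x.1| <= `|x| by rewrite [leRHS]prod_normE le_max lexx.
have x2 : `|x.2| <= `|x| by rewrite [leRHS]prod_normE le_max lexx orbT.
have := le_trans x1 xM; have := le_trans x2 xM.
rewrite !ler_norml => /andP[? ?] /andP[? ?].
by split; rewrite /= in_itv/=; apply/andP; split; lra.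
Qed.

Lemma test_fun_L2 Omega phi : test_fun Omega phi -> L2 mu phi /\ mu.-integrable setT (EFin \o phi).
Proof.
move=> tphi; have [n hn'] := test_fun_square tphi.
have [B B0 phiB] := test_fun_bounded tphi; have [sphi _ _] := tphi.
have S x : phi x != 0 -> square n x by move=> px; apply: hn'; exact: subset_closure.
have p2 : L2 mu phi by apply: L2_supp S => //; exact: smooth_mfun2.
by split => //; exact: L2_supp_integrable S.
Qed.

Lemma test_fun_strong Omega i phi : test_fun Omega phi -> strong_deriv i phi (partial i phi).
Proof.
move=> tphi; have [sphi _ _] := tphi.
have [d2 di] := test_fun_L2 (test_fun_partial i tphi).
apply: rep_strong => //; first exact: smooth_mfun2.
move=> h h0; apply: aeW => x; have := ftc_along i 1 x sphi h0; rewrite mul1r => ->.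
by apply: eq_Rintegral => t _; rewrite !mul1r.
Qed.

Lemma strong_weak i f g : L2 mu f -> mu.-integrable setT (EFin \o f) ->
  mu.-integrable setT (EFin \o g) -> strong_deriv i f g -> weak_deriv i f g.
Proof.
move=> f2 fi gi fg; split => // phi tphi; have [_ g2 _] := fg.
have [p2 _] := test_fun_L2 tphi; have [dp2 _] := test_fun_L2 (test_fun_partial i tphi).
have := strong_ibp f2 p2 fg (test_fun_strong i tphi).
rewrite RintegralD//; try exact: L2_integrableM.
by move=> /eqP; rewrite addrC addr_eq0 => /eqP.
Qed.

End Calculus.

(** * Higher integrability *)

Section Gagliardo.
Variable R : realType.
Implicit Types (f g u v phi : R * R -> R) (i : 'I_2).
Notation mu := (leb2 R).
Notation leb := (@lebesgue_measure R).

Lemma ge0_integral_shift1 (a : R) (k : R -> \bar R) :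
  measurable_fun setT (k : measurableTypeR R -> \bar R) -> (forall t, 0 <= k t)%E ->
  (\int[leb]_t k (a + t)%R = \int[leb]_t k t)%E.
Proof.
move=> mk k0; pose s (t : measurableTypeR R) : measurableTypeR R := t + a.
have ms : measurable_fun setT s by exact: measurable_funD.
have := @ge0_integral_pushforward _ _ (measurableTypeR R) (measurableTypeR R) R s ms leb setT k
  measurableT mk (fun t _ => k0 t).
rewrite preimage_setT => E.
transitivity (\int[leb]_t (k \o s) t)%E.
  by apply: eq_integral => t _ /=; rewrite /s addrC.
by rewrite -E; apply: eq_measure_integral => A mA _; exact: lebesgue_measure_shift.
Qed.

Lemma alongE i (t : R) x :
  along i t x = (x.1 + t * (ebase R i).1, x.2 + t * (ebase R i).2).
Proof. by []. Qed.

(** The square has side 2 n, so a step of length 2 n + 1 along an axis leaves it. *)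
Lemma square_along i n x : square n x -> ~ square n (along i (2 * n%:R + 1 : R) x).
Proof.
rewrite alongE => -[/=]; rewrite !in_itv/= => /andP[a b] /andP[c d] [/=].
rewrite !in_itv/= /ebase; case: i => [[|[|//]] Hi] /=.
  by rewrite mulr1 => /andP[_ h] _; lra.
by rewrite mulr1 => _ /andP[_ h]; lra.
Qed.

Lemma abse_fine_le (I : \bar R) : ((`|fine I|)%:E <= `|I|)%E.
Proof. by case: I => [r||] /=; [exact: lexx | exact: leey | exact: leey]. Qed.

(** At the far end of a segment longer than the side of the square f vanishes, so f(x) is minus the
    integral of g along this segment. *)
Lemma line_bound i n f g : mfun2 g -> rep i f g ->
  (forall x, f x != 0 -> square n x) ->
  {ae mu, forall x, (`|f x|%:E <= \int[leb]_t (`|g (along i t x)|)%:E)%E}.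
Proof.
move=> mg fg fS; have h0 : 0 < 2 * n%:R + 1 :> R by rewrite ltr_wpDl// mulr_ge0.
apply: (ae_imp _ (fg _ h0)) => x E.
have [->|fx] := eqVneq (f x) 0.
  by rewrite normr0; apply: integral_ge0 => t _; rewrite lee_fin.
have f0 : f (along i (2 * n%:R + 1) x) = 0.
  by apply/eqP/negPn/negP => /fS; exact: square_along (fS _ fx).
move: E; rewrite f0 sub0r => /(congr1 (fun z => - z)); rewrite opprK => ->.
rewrite normrN.
have mgx : measurable_fun setT (fun t : measurableTypeR R => g (along i t x)).
  have := @measurable_fun_pair2 _ _ _ _ _ _ (fun z : plane R * measurableTypeR R => g (along i (1 * z.2) z.1)) x (measurable_along2 i 1 mg).
  by congr measurable_fun; apply/funext => t /=; rewrite mul1r.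
pose S : set (measurableTypeR R) := `[0, 2 * n%:R + 1]%classic.
have mS : measurable S by exact: measurable_itv.
have mgE : measurable_fun S (fun t : measurableTypeR R => (g (along i t x))%:E).
  by apply: measurable_funTS; exact/measurable_EFinP.
apply: (@le_trans _ _ `|\int[leb]_(t in S) (g (along i t x))%:E|%E).
  exact: abse_fine_le.
apply: (le_trans (le_abse_integral leb mS mgE)).
apply: ge0_subset_integral => //.
by apply/measurable_EFinP; exact: measurableT_comp.
Qed.

Lemma along0E (t : R) x : along 0 t x = (x.1 + t, x.2).
Proof. by rewrite alongE /ebase /= mulr1 mulr0 addr0. Qed.

Lemma along1E (t : R) x : along 1 t x = (x.1, x.2 + t).
Proof. by rewrite alongE /ebase /= mulr1 mulr0 addr0. Qed.

(** The line integral of |f0| depends only on the second coordinate and that of |f1| only on the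
    first. Each bounds |f|, so |f|^2 is at most a product in separated variables, whose integral
    factorizes. *)
Lemma gagliardo_nirenberg n f f0 f1 : weak_deriv 0 f f0 -> weak_deriv 1 f f1 ->
  (forall x, f x != 0 -> square n x) ->
  (I2 mu f <= I1 mu f0 * I1 mu f1)%E.
Proof.
move=> W0 W1 fS; have [fi i0 _] := W0; have [_ i1 _] := W1.
have [mf _] := integrable_mfun2 fi.
have [m0 _] := integrable_mfun2 i0; have [m1 _] := integrable_mfun2 i1.
have a0 := line_bound m0 (weak_rep W0) fS; have a1 := line_bound m1 (weak_rep W1) fS.
pose A (y : measurableTypeR R) := (\int[leb]_s (`|f0 (s, y)|)%:E)%E.
pose B (z : measurableTypeR R) := (\int[leb]_s (`|f1 (z, s)|)%:E)%E.
have mn0 : measurable_fun [set: plane R] (fun x => (`|f0 x|)%:E).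
  by apply/measurable_EFinP; exact: measurableT_comp.
have mn1 : measurable_fun [set: plane R] (fun x => (`|f1 x|)%:E).
  by apply/measurable_EFinP; exact: measurableT_comp.
have n0 (k : R * R -> R) x : (0 <= (`|k x|)%:E)%E by rewrite lee_fin.
have mA : measurable_fun setT A.
  exact: (@measurable_fun_fubini_tonelli_G _ _ _ _ R leb _ mn0 (n0 f0)).
have mB : measurable_fun setT B.
  exact: (@measurable_fun_fubini_tonelli_F _ _ _ _ R leb _ mn1 (n0 f1)).
have A0 y : (0 <= A y)%E by apply: integral_ge0.
have B0 z : (0 <= B z)%E by apply: integral_ge0.
have EA : (\int[leb]_y A y = I1 mu f0)%E.
  by rewrite /I1 [RHS](@fubini_tonelli2 _ _ _ _ R leb leb _ mn0 (n0 f0)).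
have EB : (\int[leb]_z B z = I1 mu f1)%E.
  by rewrite /I1 [RHS](@fubini_tonelli1 _ _ _ _ R leb leb _ mn1 (n0 f1)).
have mBA : measurable_fun [set: plane R] (fun x : plane R => B x.1 * A x.2)%E.
  apply: emeasurable_funM.
  - by apply: (measurableT_comp mB); exact: measurable_fst.
  - by apply: (measurableT_comp mA); exact: measurable_snd.
have BA0 (x : plane R) : (0 <= B x.1 * A x.2)%E by exact: mule_ge0.
apply: (@le_trans _ _ (\int[mu]_x (B x.1 * A x.2))%E).
  apply: ae_ge0_le_integral => //.
  - by move=> x _; rewrite lee_fin sqr_ge0.
  - by apply/measurable_EFinP; exact: measurable_funX.
  apply: (ae_imp _ (ae_and a0 a1)) => x [h0 h1] _.
  rewrite -(real_normK (num_real (f x))) expr2 EFinM.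
  have mx0 : measurable_fun setT (fun s : measurableTypeR R => (`|f0 (s, x.2)|)%:E).
    exact: (@measurable_fun_pair1 _ _ _ _ _ _ (fun x : plane R => (`|f0 x|)%:E)).
  have mx1 : measurable_fun setT (fun s : measurableTypeR R => (`|f1 (x.1, s)|)%:E).
    exact: (@measurable_fun_pair2 _ _ _ _ _ _ (fun x : plane R => (`|f1 x|)%:E)).
  apply: lee_pmul; rewrite ?lee_fin//.
  - apply: (le_trans h1); rewrite le_eqVlt; apply/orP; left; apply/eqP.
    transitivity (\int[leb]_t (`|f1 (x.1, (x.2 + t)%R)|)%:E)%E.
      by apply: eq_integral => t _; rewrite along1E.
    exact: (ge0_integral_shift1 x.2 mx1 (fun t => n0 f1 (x.1, t))).
  - apply: (le_trans h0); rewrite le_eqVlt; apply/orP; left; apply/eqP.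
    transitivity (\int[leb]_t (`|f0 ((x.1 + t)%R, x.2)|)%:E)%E.
      by apply: eq_integral => t _; rewrite along0E.
    exact: (ge0_integral_shift1 x.1 mx0 (fun t => n0 f0 (t, x.2))).
have -> : (\int[mu]_x (B x.1 * A x.2) = \int[leb]_z \int[leb]_y (B z * A y))%E.
  exact: (@fubini_tonelli1 _ _ _ _ R leb leb _ mBA BA0).
rewrite -EA -EB muleC.
rewrite (eq_integral (fun z => B z * \int[leb]_y A y)%E); last first.
  by move=> z _; rewrite ge0_integralZl.
by rewrite ge0_integralZr//; exact: integral_ge0.
Qed.

End Gagliardo.

(** * Products, powers and the regularized modulus *)

Section Radial.
Variable R : realType.
Implicit Types (f g u v phi : R * R -> R) (i : 'I_2).
Notation mu := (leb2 R).

Lemma mfun2_inv f : (forall x, 0 <= f x) -> mfun2 f -> mfun2 (fun x => (f x)^-1).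
Proof.
move=> f0 mf; rewrite (_ : (fun x => _) = fun x => f x `^ (-1)); last first.
  by apply/funext => x; rewrite powR_inv1.
exact: measurableT_comp (measurable_powR (-1)) mf.
Qed.

Lemma mfun2_sqrt f : mfun2 f -> mfun2 (fun x => Num.sqrt (f x)).
Proof. exact: measurableT_comp (continuous_measurable_fun (@sqrt_continuous R)). Qed.

Lemma strong_chain1 i f d (phi psi : R -> R) (J : R -> Prop) (B C : R) :
  0 <= B -> 0 <= C -> strong_deriv i f d -> (forall x, J (f x)) ->
  mfun2 (fun x => phi (f x)) -> mfun2 (fun x => psi (f x)) ->
  (forall a, J a -> `|psi a| <= B) ->
  (forall a b, J a -> J b -> `|phi b - phi a - psi a * (b - a)| <= C * (b - a) ^+ 2) ->
  (forall a b, J a -> J b -> `|phi b - phi a - psi a * (b - a)| <= B * `|b - a|) ->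
  strong_deriv i (fun x => phi (f x)) (fun x => psi (f x) * d x).
Proof.
move=> B0 C0 fd Jf m1 m2 pB pC pL.
have := @strong_chain R i f f d d (fun a _ => phi a) (fun a _ => psi a) (fun _ _ => 0)
  (fun a _ => J a) B C B0 C0 fd fd Jf m1 m2.
rewrite (_ : (fun x => psi (f x) * d x + 0 * d x) = (fun x => psi (f x) * d x)); last first.
  by apply/funext => x; rewrite mul0r addr0.
apply => //.
- by move=> a _ Ja; rewrite normr0; split => //; exact: pB.
- move=> a b a' b' Ja Ja'; rewrite mul0r addr0; apply: (le_trans (pC _ _ Ja Ja')).
  by rewrite ler_wpM2l// -(real_normK (num_real (a' - a))) lerXn2r ?nnegrE ?addr_ge0// lerDl.
- move=> a b a' b' Ja Ja'; rewrite mul0r addr0; apply: (le_trans (pL _ _ Ja Ja')).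
  by rewrite ler_wpM2l// lerDl.
Qed.

(** The remainder of the product is exactly (a' - a) (b' - b): it is quadratic, and on the bounded
    range also linear with constant 2 B. *)
Lemma strong_mul i f g df dg (B : R) : strong_deriv i f df -> strong_deriv i g dg ->
  (forall x, `|f x| <= B) -> (forall x, `|g x| <= B) ->
  strong_deriv i (fun x => f x * g x) (fun x => g x * df x + f x * dg x).
Proof.
move=> fd gd fB gB; have B0 : 0 <= B by exact: le_trans (normr_ge0 _) (fB (0, 0)).
have [mf _ _] := fd; have [mg _ _] := gd.
apply: (@strong_chain R i f g df dg (fun a b => a * b) (fun _ b => b) (fun a _ => a)
  (fun a b => `|a| <= B /\ `|b| <= B) (2 * B) 1) => //.
- by rewrite mulr_ge0.
- exact: measurable_funM.
- by move=> a b [h1 h2]; split; [apply: (le_trans h2)|apply: (le_trans h1)]; lra.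
- move=> a b a' b' _ _.
  rewrite (_ : a' * b' - a * b - _ = (a' - a) * (b' - b)); last by ring.
  by rewrite normrM; have := normr_ge0 (a' - a); have := normr_ge0 (b' - b); clear; nra.
- move=> a b a' b' [h1 h2] [h3 h4].
  rewrite (_ : a' * b' - a * b - _ = (a' - a) * (b' - b)); last by ring.
  rewrite normrM; have : `|b' - b| <= 2 * B.
    by rewrite (le_trans (ler_normB _ _))//; lra.
  by have := normr_ge0 (a' - a); have := normr_ge0 (b' - b); move: `|a' - a| `|b' - b| => s t; clear -B0; nra.
Qed.

Lemma strong_subc i f d (c : R) : strong_deriv i f d -> strong_deriv i (fun x => f x - c) d.
Proof.
move=> [mf d2 t]; split => //; first exact: measurable_funB.
congr to0: t; apply/funext => n; congr I2; apply/funext => x; congr (_ - _).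
by rewrite /dq; congr (_ / _); ring.
Qed.

Lemma strong_pow i f d (B : R) n : strong_deriv i f d -> (forall x, `|f x| <= B) ->
  strong_deriv i (fun x => f x ^+ n.+1) (fun x => (n.+1%:R * f x ^+ n) * d x).
Proof.
move=> fd fB; elim: n => [|n IH].
  by congr strong_deriv: fd; apply/funext => x; rewrite ?expr1// expr0 !mul1r.
have B0 : 0 <= B by exact: le_trans (normr_ge0 _) (fB (0, 0)).
(* [strong_mul] wants one bound for both factors; with base at least 1 the power [(B + 1) ^+ n.+1]
   bounds [f] as well as its power. *)
have B1 : 1 <= B + 1 by lra.
have b1 x : `|f x| <= (B + 1) ^+ n.+1.
  apply: (le_trans (fB x)); apply: (@le_trans _ _ (B + 1)); first by rewrite lerDl.
  by rewrite -[leLHS]expr1; apply: ler_weXn2l.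
have b2 x : `|f x ^+ n.+1| <= (B + 1) ^+ n.+1.
  by rewrite normrX lerXn2r ?nnegrE ?addr_ge0// (le_trans (fB x))// lerDl.
congr strong_deriv: (strong_mul fd IH b1 b2); apply/funext => x.
by rewrite -[n.+2%:R]natr1 exprS; ring.
Qed.

(** The modulus of (a, b) regularized at 0 for e > 0; [e = 0] gives the Euclidean norm itself. *)
Definition rad (e a b : R) : R := Num.sqrt (e ^+ 2 + a ^+ 2 + b ^+ 2).

Lemma rad_sqr (e a b : R) : rad e a b ^+ 2 = e ^+ 2 + a ^+ 2 + b ^+ 2.
Proof. by rewrite sqr_sqrtr// !addr_ge0 ?sqr_ge0. Qed.

Lemma rad_ge0 (e a b : R) : 0 <= rad e a b. Proof. exact: sqrtr_ge0. Qed.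

Lemma rad_ge_l (e a b : R) : `|a| <= rad e a b.
Proof.
rewrite -(@ler_pXn2r _ 2) ?nnegrE ?rad_ge0// rad_sqr real_normK ?num_real//.
by have := sqr_ge0 e; have := sqr_ge0 b; lra.
Qed.

Lemma radC (e a b : R) : rad e a b = rad e b a.
Proof. by rewrite /rad addrAC. Qed.

Lemma rad_ge_r (e a b : R) : `|b| <= rad e a b.
Proof. by rewrite radC rad_ge_l. Qed.

Lemma rad_ge_e (e a b : R) : e <= rad e a b.
Proof.
have [e0|e0] := leP 0 e; last by rewrite (le_trans (ltW e0))// rad_ge0.
rewrite -(@ler_pXn2r _ 2) ?nnegrE ?rad_ge0// rad_sqr.
by have := sqr_ge0 a; have := sqr_ge0 b; lra.
Qed.

Lemma rad_gt0 (e a b : R) : 0 < e -> 0 < rad e a b.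
Proof. by move=> e0; apply: lt_le_trans (rad_ge_e _ _ _). Qed.

Lemma mfun2_rad (e : R) f g : mfun2 f -> mfun2 g -> mfun2 (fun x => rad e (f x) (g x)).
Proof.
move=> mf mg; apply: mfun2_sqrt; apply: measurable_funD; last exact: measurable_funX.
by apply: measurable_funD => //; exact: measurable_funX.
Qed.

Lemma rad_lip (e a b a' b' : R) :
  rad e a' b' <= rad e a b + (`|a' - a| + `|b' - b|).
Proof.
have h0 := rad_ge0 e a b; have ha := rad_ge_l e a b; have hb := rad_ge_r e a b.
have s0 : 0 <= `|a' - a| + `|b' - b| by rewrite addr_ge0.
rewrite -(@ler_pXn2r _ 2) ?nnegrE ?rad_ge0 ?addr_ge0// sqrrD !rad_sqr.
have E (x y : R) : y ^+ 2 <= x ^+ 2 + 2 * `|x| * `|y - x| + `|y - x| ^+ 2.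
  rewrite -[in leLHS](subrK x y) -[x ^+ 2](real_normK (num_real x)) sqrrD.
  rewrite (real_normK (num_real (y - x))) (real_normK (num_real x)).
  have := ler_norm ((y - x) * x); rewrite normrM; lra.
have Ea := E a a'; have Eb := E b b'.
have h1 := normr_ge0 (a' - a); have h2 := normr_ge0 (b' - b).
have h3 := ler_wpM2r h1 ha; have h4 := ler_wpM2r h2 hb.
have h5 := mulr_ge0 h1 h2.
move: Ea Eb h3 h4 h5; move: (`|a' - a|) (`|b' - b|) (`|a|) (`|b|) (rad e a b) => p q r s t.
by clear; lra.
Qed.

Lemma strong_rad i (e : R) f0 f1 d0 d1 : 0 < e -> strong_deriv i f0 d0 -> strong_deriv i f1 d1 ->
  strong_deriv i (fun x => rad e (f0 x) (f1 x))
    (fun x => (f0 x / rad e (f0 x) (f1 x)) * d0 x + (f1 x / rad e (f0 x) (f1 x)) * d1 x).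
Proof.
move=> e0 s0 s1; have [m0 _ _] := s0; have [m1 _ _] := s1.
have mr := mfun2_rad e m0 m1.
have mri : mfun2 (fun x => (rad e (f0 x) (f1 x))^-1).
  by apply: mfun2_inv => // x; exact: rad_ge0.
have r1 a b : `|a / rad e a b| <= 1 /\ `|b / rad e a b| <= 1.
  have r0 := rad_gt0 a b e0.
  by rewrite !normrM normfV (gtr0_norm r0) !ler_pdivrMr// mul1r rad_ge_l rad_ge_r.
apply: (@strong_chain R i f0 f1 d0 d1 (rad e) (fun a b => a / rad e a b)
  (fun a b => b / rad e a b) (fun _ _ => True) 2 (2 * e)^-1) => //.
- by rewrite invr_ge0 mulr_ge0// ltW.
- exact: measurable_funM.
- exact: measurable_funM.
- by move=> a b _; have [h1 h2] := r1 a b; split; [apply: (le_trans h1)|apply: (le_trans h2)]; rewrite ler1n.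
- move=> a b a' b' _ _; have r0 := rad_gt0 a b e0; have re := rad_ge_e e a b.
  set A := rad e a b in r0 re *; set A' := rad e a' b'.
  have lip1 : A' <= A + (`|a' - a| + `|b' - b|) := rad_lip e a b a' b'.
  have lip2 : A <= A' + (`|a' - a| + `|b' - b|).
    by have := rad_lip e a' b' a b; rewrite (distrC a) (distrC b).
  (* Since the square of [rad] is a polynomial, the remainder is explicit. The Lipschitz bound makes
     its numerator at most (|a' - a| + |b' - b|)^2 in absolute value, and A >= e. *)
  have E : A' - A - (a / A * (a' - a) + b / A * (b' - b)) =
      ((a' - a) ^+ 2 + (b' - b) ^+ 2 - (A' - A) ^+ 2) / (2 * A).
    apply: (@mulIf _ (2 * A)); first by rewrite mulf_neq0// gt_eqF.
    rewrite divfK ?mulf_neq0 ?gt_eqF//.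
    have -> : (A' - A - (a / A * (a' - a) + b / A * (b' - b))) * (2 * A) =
      2 * A * A' - 2 * A ^+ 2 - 2 * (a * (a' - a) + b * (b' - b)) by field; rewrite gt_eqF.
    have := rad_sqr e a b; have := rad_sqr e a' b'; rewrite -/A -/A' => h1 h2.
    by clear -h1 h2; nra.
  rewrite E normrM normfV (@gtr0_norm _ (2 * A)) ?mulr_gt0//.
  rewrite mulrC ler_pM//; first by rewrite invr_ge0 mulr_ge0// ltW.
    by rewrite lef_pV2 ?posrE ?mulr_gt0// ler_pM2l.
  rewrite -(real_normK (num_real (a' - a))) -(real_normK (num_real (b' - b))).
  have h1 := normr_ge0 (a' - a); have h2 := normr_ge0 (b' - b).
  rewrite ler_norml; move: lip1 lip2 h1 h2; move: (`|a' - a|) (`|b' - b|) => p q l1 l2 p0 q0.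
  have P1 : 0 <= p + q - (A' - A) by lra.
  have P2 : 0 <= p + q + (A' - A) by lra.
  have := mulr_ge0 P1 P2; have := mulr_ge0 p0 q0; have := sqr_ge0 (A' - A).
  have := sqr_ge0 p; have := sqr_ge0 q.
  by clear => *; apply/andP; split; lra.
- move=> a b a' b' _ _; have [h1 h2] := r1 a b.
  have lip1 := rad_lip e a b a' b'.
  have lip2 := rad_lip e a' b' a b; rewrite (distrC a) (distrC b) in lip2.
  have k1 : `|a / rad e a b * (a' - a)| <= `|a' - a| by rewrite normrM ler_piMl.
  have k2 : `|b / rad e a b * (b' - b)| <= `|b' - b| by rewrite normrM ler_piMl.
  move: k1 k2 lip1 lip2; move: (a / rad e a b * (a' - a)) (b / rad e a b * (b' - b)) => p q.
  rewrite !ler_norml; move: (rad e a b) (rad e a' b') (`|a' - a|) (`|b' - b|) => A A' s t.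
  by clear => /andP[? ?] /andP[? ?] ? ?; apply/andP; split; lra.
Qed.

End Radial.

(** * Moser iteration *)

Section Moser.
Variable R : realType.
Implicit Types (f g u v phi : R * R -> R) (i : 'I_2).
Notation mu := (leb2 R).

Lemma limn_einf_le (u : (\bar R)^nat) (K : \bar R) :
  (forall n, u n <= K)%E -> (limn_einf u <= K)%E.
Proof.
move=> uK; rewrite limn_einf_lim; apply: lime_le; first exact: is_cvg_einfs.
apply: nearW => n; apply: le_trans (uK n); apply: ereal_inf_lbound.
by exists n => /=.
Qed.

Lemma I2_fatou (c : nat -> R * R -> R) f (K : \bar R) : (forall n, mfun2 (c n)) ->
  (forall x, c n x @[n --> \oo] --> f x) -> (forall n, I2 mu (c n) <= K)%E ->
  (I2 mu f <= K)%E.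
Proof.
move=> mc cf cK.
have E x : limn_einf (fun n => ((c n x) ^+ 2)%:E) = ((f x) ^+ 2)%:E.
  have : (((c n x) ^+ 2)%:E @[n --> \oo] --> ((f x) ^+ 2)%:E)%E.
    by apply: cvg_EFin; [exact: nearW|exact: cvgM (cf x) (cf x)].
  by move=> /cvg_limn_einf_sup[].
apply: (@le_trans _ _ (limn_einf (fun n => I2 mu (c n)))); last exact: limn_einf_le.
have -> : I2 mu f = (\int[mu]_x limn_einf (fun n => ((c n x) ^+ 2)%:E))%E.
  by apply: eq_integral => x _; rewrite E.
apply: fatou => //.
- by move=> n; apply/measurable_EFinP; exact: measurable_funX.
- by move=> n x _; rewrite lee_fin sqr_ge0.
Qed.

Lemma sat_diff (e s t : R) : 0 <= e -> 0 <= s -> 0 <= t ->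
  t / (1 + e * t) - s / (1 + e * s) - ((1 + e * s)^-1) ^+ 2 * (t - s) =
  - (e * (t - s) ^+ 2 * ((1 + e * s)^-1 ^+ 2 * (1 + e * t)^-1)).
Proof.
move=> e0 s0 t0; have h1 : 1 + e * s != 0 by rewrite gt_eqF// ltr_wpDr ?mulr_ge0.
have h2 : 1 + e * t != 0 by rewrite gt_eqF// ltr_wpDr ?mulr_ge0.
by field; rewrite h1 h2.
Qed.

Lemma inv1D_le1 (a : R) : 0 <= a -> 0 <= (1 + a)^-1 <= 1.
Proof.
move=> a0; have h : 0 < 1 + a by rewrite ltr_wpDr.
by rewrite invr_ge0 ltW//= invf_le1// lerDl.
Qed.

(** A truncation t / (1 + e t) accessible to the chain rule: for e > 0 it is bounded by 1 / e, its
    derivative is at most 1, and it tends to t as e tends to 0, so that estimates uniform in e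
    survive by Fatou's lemma. *)
Lemma strong_sat i (e : R) f d : 0 <= e <= 1 -> (forall x, 0 <= f x) -> strong_deriv i f d ->
  strong_deriv i (fun x => f x / (1 + e * f x)) (fun x => ((1 + e * f x)^-1) ^+ 2 * d x).
Proof.
move=> /andP[e0 e1] f0 fd; have [mf _ _] := fd.
have mi : mfun2 (fun x => (1 + e * f x)^-1).
  apply: mfun2_inv => [x|]; first by rewrite addr_ge0// mulr_ge0.
  by apply: measurable_funD => //; exact: measurable_funM.
have b (s : R) : 0 <= s -> 0 <= (1 + e * s)^-1 <= 1 by move=> s0; apply: inv1D_le1; rewrite mulr_ge0.
have b2 (s : R) : 0 <= s -> 0 <= (1 + e * s)^-1 ^+ 2 <= 1.
  by move=> /b /andP[h1 h2]; rewrite sqr_ge0 expr_le1.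
apply: (@strong_chain1 R i f d (fun t => t / (1 + e * t)) (fun t => ((1 + e * t)^-1) ^+ 2)
  (fun t => 0 <= t) 1 1) => //.
- exact: measurable_funM.
- exact: measurable_funX.
- by move=> s /b2/andP[h1 h2]; rewrite ger0_norm.
- move=> s t s0 t0; have /andP[h1 h2] := b2 _ s0; have /andP[h3 h4] := b _ t0.
  have h5 := mulr_ile1 h1 h3 h2 h4; have h6 := mulr_ge0 h1 h3.
  have h7 : 0 <= e * (t - s) ^+ 2 by rewrite mulr_ge0// sqr_ge0.
  rewrite sat_diff// normrN ger0_norm; last exact: mulr_ge0.
  rewrite (le_trans (ler_piMr h7 h5))//.
  by apply: ler_wpM2r => //; exact: sqr_ge0.
- move=> s t s0 t0; have /andP[h1 h2] := b2 _ s0; have /andP[h3 h4] := b _ t0.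
  have /andP[h5 h6] := b _ s0.
  have -> : t / (1 + e * t) - s / (1 + e * s) - ((1 + e * s)^-1) ^+ 2 * (t - s) =
    ((1 + e * s)^-1 * (1 + e * t)^-1 - ((1 + e * s)^-1) ^+ 2) * (t - s).
    have k1 : 1 + e * s != 0 by rewrite gt_eqF// ltr_wpDr ?mulr_ge0.
    have k2 : 1 + e * t != 0 by rewrite gt_eqF// ltr_wpDr ?mulr_ge0.
    by field; rewrite k1 k2.
  rewrite normrM ler_wpM2r// ler_norml.
  have := mulr_ge0 h5 h3; have := mulr_ile1 h5 h3 h6 h4; move: h1 h2; clear => *.
  by apply/andP; split; lra.
Qed.

Lemma sat_le (e t : R) : 0 < e -> 0 <= t ->
  [/\ 0 <= t / (1 + e * t), t / (1 + e * t) <= t & t / (1 + e * t) <= e^-1].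
Proof.
move=> e0 t0; have /andP[h1 h2] : 0 <= (1 + e * t)^-1 <= 1.
  by apply: inv1D_le1; rewrite mulr_ge0// ltW.
split; [exact: mulr_ge0 | exact: ler_piMr|].
have h : 0 < 1 + e * t by rewrite ltr_wpDr// mulr_ge0// ltW.
by rewrite ler_pdivrMr// mulrDr mulr1 mulKf ?gt_eqF// lerDr invr_ge0 ltW.
Qed.

Lemma sat_cvg (t : R) : 0 <= t -> t / (1 + hn R n * t) @[n --> \oo] --> t.
Proof.
move=> t0; rewrite -[X in _ --> X]divr1; apply: cvgM; first exact: cvg_cst.
apply: cvgV; first by rewrite oner_eq0.
rewrite -[X in _ --> X]addr0; apply: cvgD; first exact: cvg_cst.
rewrite -[X in _ --> X](mul0r t); apply: cvgM; last exact: cvg_cst.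
exact: cvg_harmonic.
Qed.

Lemma L2_norm f : L2 mu f -> L2 mu (fun x => `|f x|).
Proof.
move=> fL; apply: (L2_le _ fL) => [|x]; last by rewrite normr_id.
by apply: measurableT_comp => //; case: fL.
Qed.

Lemma I1_fin f : mu.-integrable setT (EFin \o f) -> (I1 mu f < +oo)%E.
Proof. by move=> /integrableP[_]. Qed.

Lemma indic_square_ge0 n (x : R * R) : 0 <= \1_(@square R n) x :> R.
Proof. by rewrite indicE. Qed.

(* With r = rad 1 f0 f1, the Gagliardo-Nirenberg inequality is applied to the powers p + 1 of
   the bounded functions r / (1 + e r), whose gradients are at most (p + 1) r^p |Df|. *)
Lemma moser n f0 f1 (d0 d1 : 'I_2 -> R * R -> R) : L2 mu f0 -> L2 mu f1 ->
  (forall x, f0 x != 0 -> square n x) -> (forall x, f1 x != 0 -> square n x) ->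
  (forall i, strong_deriv i f0 (d0 i)) -> (forall i, strong_deriv i f1 (d1 i)) ->
  forall p, L2 mu (fun x => rad 1 (f0 x) (f1 x) ^+ p * \1_(@square R n) x).
Proof.
move=> f02 f12 S0 S1 D0 D1; have [m0 _] := f02; have [m1 _] := f12.
pose r x := rad 1 (f0 x) (f1 x); pose one (x : R * R) : R := \1_(@square R n) x.
have mr : mfun2 r by exact: mfun2_rad.
have rge0 x : 0 <= r x by exact: rad_ge0.
have mone : mfun2 one by case: (L2_square R n).
have offS x : ~ square n x -> f0 x = 0 /\ f1 x = 0.
  by move=> nS; split; apply/eqP/negPn/negP => /[dup] ?; [move=> /S0|move=> /S1].
elim=> [|p IH]; first by have := L2_square R n; congr (L2 mu); apply/funext => x; rewrite expr0 mul1r.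
pose D i x := `|d0 i x| + `|d1 i x|.
have D2 i : L2 mu (D i).
  by apply: L2D; apply: L2_norm; [case: (D0 i)|case: (D1 i)].
(* Bounds the derivative of the truncated power independently of the truncation. It is integrable as
   a product of two L2 functions, the first by the induction hypothesis. *)
pose dom i x := p.+1%:R * ((r x ^+ p * one x) * D i x).
have mdom i : mfun2 (dom i).
  apply: measurable_funM => //; apply: measurable_funM; last by case: (D2 i).
  by case: IH.
have domfin i : (I1 mu (dom i) < +oo)%E.
  apply: I1_fin; have := L2_integrableM (L2Z p.+1%:R IH) (D2 i).
  by apply: eq_integrable => // x _ /=; congr EFin; rewrite /dom /r /one; ring.
(* From t^2 <= 2 (t - c)^2 + 2 c^2 with c <= 1, where the first square is estimated by the
   Gagliardo-Nirenberg inequality. *)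
pose K := (2%:E * (I1 mu (dom 0%R) * I1 mu (dom 1%R)) + 2%:E * I2 mu one)%E.
have Kfin : (K < +oo)%E.
  rewrite /K lte_add_pinfty// lte_mul_pinfty//; last by case: (L2_square R n).
  by rewrite lte_mul_pinfty ?I1_ge0// ge0_fin_numE ?I1_ge0.
have mpow : mfun2 (fun x => r x ^+ p.+1 * one x).
  by apply: measurable_funM => //; exact: measurable_funX.
split => //; apply: le_lt_trans Kfin.
pose tau k x := r x / (1 + hn R k * r x).
apply: (@I2_fatou (fun k x => tau k x ^+ p.+1 * one x)).
- move=> k; apply: measurable_funM => //; apply: measurable_funX; apply: measurable_funM => //.
  apply: mfun2_inv => [x|]; first by rewrite addr_ge0// mulr_ge0// ltW// hn_gt0.
  by apply: measurable_funD => //; exact: measurable_funM.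
- move=> x; apply: cvgM; last exact: cvg_cst.
  have := sat_cvg (rge0 x); move: p.+1 => q h; elim: q => [|q IHq]; first exact: cvg_cst.
  rewrite exprS (_ : (fun k => _) = (fun k => tau k x * tau k x ^+ q)); last first.
    by apply/funext => k; rewrite exprS.
  exact: cvgM.
move=> k; set e := hn R k; have e0 : 0 < e := hn_gt0 R k.
have e1 : 0 <= e <= 1 by rewrite ltW// hn_le1.
have tb x := sat_le e0 (rge0 x).
(* The value of the truncated power off the square, where f0 = f1 = 0 and r = 1. Subtracting it
   leaves a function supported in the square. *)
pose c := (1 / (1 + e * 1)) ^+ p.+1 : R.
pose u x := tau k x ^+ p.+1 - c.
pose dr i x := (f0 x / r x) * d0 i x + (f1 x / r x) * d1 i x.
pose du i x := (p.+1%:R * tau k x ^+ p) * (((1 + e * r x)^-1) ^+ 2 * dr i x).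
have Dr i : strong_deriv i r (dr i) by exact: strong_rad (D0 i) (D1 i).
have Dt i : strong_deriv i (tau k) (fun x => ((1 + e * r x)^-1) ^+ 2 * dr i x).
  exact: (strong_sat e1 rge0 (Dr i)).
have tB x : `|tau k x| <= e^-1 by have [h1 h2 h3] := tb x; rewrite ger0_norm.
have Du i : strong_deriv i u (du i).
  by apply: strong_subc; exact: (strong_pow p (Dt i) tB).
have uS x : u x != 0 -> square n x.
  apply: contra_neqP => /offS[E0 E1]; rewrite /u /tau /r E0 E1 /rad !expr0n/= !addr0 expr1n sqrtr1.
  by rewrite /c subrr.
have mu_ : mfun2 u by case: (Du 0).
have u2 : L2 mu u.
  apply: (@L2_supp _ n u (e^-1 ^+ p.+1 + `|c|)) => // x.
  rewrite (le_trans (ler_normB _ _))// lerD2r normrX lerXn2r ?nnegrE//.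
  by rewrite invr_ge0 ltW.
have dub i x : `|du i x| <= `|dom i x|.
  have dom0 : 0 <= dom i x.
    by rewrite mulr_ge0// mulr_ge0 ?addr_ge0// mulr_ge0 ?exprn_ge0// indic_square_ge0.
  rewrite (ger0_norm dom0).
  have [Sx|nSx] := pselect (square n x); last first.
    have [E0 E1] := offS x nSx; by rewrite /du /dr E0 E1 !mul0r addr0 !mulr0 normr0.
  rewrite /du /dom /one indicE mem_set// mulr1 -mulrA normrM ger0_norm// ler_wpM2l// normrM.
  have [h1 h2 h3] := tb x.
  rewrite ler_pM//; first by rewrite normrX lerXn2r ?nnegrE// ger0_norm.
  rewrite normrM; have /andP[i0 i1] : 0 <= (1 + e * r x)^-1 <= 1.
    by apply: inv1D_le1; rewrite mulr_ge0// ltW.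
  apply: (@le_trans _ _ `|dr i x|).
    by rewrite ler_piMl// ger0_norm ?sqr_ge0// expr_le1.
  have r0 : 0 < r x by exact: rad_gt0.
  apply: (le_trans (ler_normD _ _)); rewrite !normrM normfV (gtr0_norm r0).
  by apply: lerD; rewrite ler_piMl// ler_pdivrMr// mul1r; [exact: rad_ge_l|exact: rad_ge_r].
have mdu i : mfun2 (du i) by have [_ [h _] _] := Du i.
have I1du i : (I1 mu (du i) <= I1 mu (dom i))%E.
  by apply: ge0_intle => //; exact: measurableT_comp.
have W i : weak_deriv i u (du i).
  apply: strong_weak => //; first exact: L2_supp_integrable u2 uS.
  by apply: integrable_I1 => //; exact: le_lt_trans (domfin i).
have GN : (I2 mu u <= I1 mu (dom 0%R) * I1 mu (dom 1%R))%E.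
  apply: (le_trans (gagliardo_nirenberg (W 0) (W 1) uS)).
  by apply: lee_pmul => //; exact: I1_ge0.
apply: (@le_trans _ _ (2%:E * I2 mu u + 2%:E * I2 mu one)%E); last first.
  by apply: leeD2r; apply: lee_wpmul2l.
apply: I2_lin => //.
  apply: measurable_funM => //; apply: measurable_funX; by case: (Dt 0).
move=> x; have [Sx|nSx] := pselect (square n x); last first.
  rewrite /one indicE memNset//= mulr0 expr0n/= mulr0 addr0 mulr_ge0 ?sqr_ge0//.
rewrite /one indicE mem_set// mulr1 expr1n mulr1 /u.
have c1 : 0 <= c <= 1.
  have h : 0 <= (1 + e * 1)^-1 <= 1 by apply: inv1D_le1; rewrite mulr1 ltW.
  by move: h => /andP[h1 h2]; rewrite /c div1r exprn_ge0// exprn_ile1.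
move: c1; move: (tau k x ^+ p.+1) => t; generalize c => z /andP[z0 z1].
have := sqr_ge0 (t - 2 * z); have : z ^+ 2 <= 1 by rewrite expr_le1.
by clear; lra.
Qed.

End Moser.

(** * Local weak derivatives *)

Section Localization.
Variables (R : realType) (Omega : set (R * R)).
Implicit Types (f g phi eta : R * R -> R) (i : 'I_2).
Notation mu := (leb2 R).

Lemma tsupp_eq0 eta x : ~ tsupp eta x -> eta x = 0.
Proof. by move=> nx; apply/eqP/negPn/negP => ex; apply: nx; exact: subset_closure. Qed.

Lemma Rintegral_off f : (forall x, ~ Omega x -> f x = 0) ->
  \int[mu]_(x in Omega) f x = \int[mu]_x f x.
Proof.
move=> f0; rewrite Rintegral_mkcond; apply: eq_Rintegral => x _.
by rewrite /patch; case: ifPn => //; rewrite notin_setE => /f0 ->.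
Qed.

Lemma Lploc1_integrable f eta : Lploc 1%E Omega f -> test_fun Omega eta ->
  mu.-integrable setT (EFin \o (fun x => eta x * f x)).
Proof.
move=> f1 te; have [seta ceta etaO] := te; have [B B0 etaB] := test_fun_bounded te.
have /Lfun1_integrable fi := f1 _ ceta etaO.
have := integrable_Mb fi (smooth_mfun2 seta) etaB.
apply: eq_integrable => // x _ /=; congr EFin; rewrite mulrC patchE.
by case: ifPn => //; rewrite notin_setE => /tsupp_eq0 ->; rewrite !mul0r.
Qed.

Lemma Lploc2_L2 f eta : Lploc 2%:E Omega f -> test_fun Omega eta ->
  L2 mu (fun x => eta x * f x).
Proof.
move=> f2 te; have [seta ceta etaO] := te; have [B B0 etaB] := test_fun_bounded te.
have fK := f2 _ ceta etaO; have mK := set_mem (sub_Lfun_mfun fK).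
have LK : L2 mu (f \_ (tsupp eta)).
  split => //; have /integrableP[_] := Lfun2_integrable_sqr fK.
  apply: le_lt_trans; rewrite le_eqVlt; apply/orP; left; apply/eqP.
  by apply: eq_integral => x _ /=; rewrite ger0_norm ?sqr_ge0.
have := L2Mb LK (smooth_mfun2 seta) etaB; congr (L2 mu); apply/funext => x.
rewrite mulrC patchE.
by case: ifPn => //; rewrite notin_setE => /tsupp_eq0 ->; rewrite !mul0r.
Qed.

Lemma test_fun_partialM i eta phi x : test_fun Omega eta -> test_fun setT phi ->
  partial i (fun y => eta y * phi y) x = eta x * partial i phi x + partial i eta x * phi x.
Proof.
move=> [se _ _] [sp _ _]; apply: partialM.
- by have [_ h] := se 1%N; have [d _] := h i; exact: d.
- by have [_ h] := sp 1%N; have [d _] := h i; exact: d.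
Qed.

(** For a test function phi on the plane, eta phi is a test function on Omega; the derivative that
    falls on eta is moved to the other side. *)
Lemma is_wpartial_weak i f g eta : is_wpartial Omega i f g -> test_fun Omega eta ->
  weak_deriv i (fun x => eta x * f x) (fun x => eta x * g x + partial i eta x * f x).
Proof.
move=> [f1 g1 fg] te; have tde := test_fun_partial i te.
have i1 := Lploc1_integrable f1 te; have i2 := Lploc1_integrable g1 te.
have i3 := Lploc1_integrable f1 tde.
split => // [|phi tphi].
  have := integrableD measurableT i2 i3; apply: eq_integrable => // x _ /=.
have tep : test_fun Omega (fun x => eta x * phi x) by apply: test_funMl => //; case: tphi.
have tdp := test_fun_partial i tphi.
have [Bp _ pB] := test_fun_bounded tphi; have [Bd _ dB] := test_fun_bounded tdp.
have mp : mfun2 phi by apply: smooth_mfun2; case: tphi.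
have md : mfun2 (partial i phi) by apply: smooth_mfun2; case: tdp.
have j1 := integrable_Mb i1 md dB; have j2 := integrable_Mb i2 mp pB.
have j3 := integrable_Mb i3 mp pB.
have := fg _ tep.
rewrite !Rintegral_off; last 2 first.
- by move=> x /(test_fun0 tep) ->; rewrite mulr0.
- by move=> x /(test_fun0 (test_fun_partial i tep)) ->; rewrite mulr0.
have -> : \int[mu]_x (f x * partial i (fun y => eta y * phi y) x) =
    \int[mu]_x (eta x * f x * partial i phi x + partial i eta x * f x * phi x).
  by apply: eq_Rintegral => x _; rewrite (test_fun_partialM i x te tphi); ring.
have -> : \int[mu]_x (g x * (eta x * phi x)) = \int[mu]_x (eta x * g x * phi x).
  by apply: eq_Rintegral => x _; ring.
have -> : \int[mu]_x ((eta x * g x + partial i eta x * f x) * phi x) =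
    \int[mu]_x (eta x * g x * phi x + partial i eta x * f x * phi x).
  by apply: eq_Rintegral => x _; ring.
by rewrite !RintegralD//; move=> h; lra.
Qed.

(** Stated after multiplication by a test function, so that [du_bois_reymond] on the whole plane
    applies and Omega need not be exhausted by compact sets. *)
Lemma is_wpartial_unique i f g g' eta : is_wpartial Omega i f g -> is_wpartial Omega i f g' ->
  test_fun Omega eta -> {ae mu, forall x, eta x * g x = eta x * g' x}.
Proof.
move=> [f1 g1 fg] [_ g1' fg'] te.
have i1 := Lploc1_integrable g1 te; have i2 := Lploc1_integrable g1' te.
have i3 := integrableB measurableT i1 i2.
have : {ae mu, forall x, eta x * g x - eta x * g' x = 0}.
  apply: du_bois_reymond => // phi tphi.
  have tep : test_fun Omega (fun x => eta x * phi x) by apply: test_funMl => //; case: tphi.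
  have [Bp _ pB] := test_fun_bounded tphi.
  have mp : mfun2 phi by apply: smooth_mfun2; case: tphi.
  have j1 := integrable_Mb i1 mp pB; have j2 := integrable_Mb i2 mp pB.
  have -> : \int[mu]_x ((eta x * g x - eta x * g' x) * phi x) =
      \int[mu]_x (eta x * g x * phi x - eta x * g' x * phi x).
    by apply: eq_Rintegral => x _; ring.
  rewrite RintegralB//; apply/eqP; rewrite subr_eq0; apply/eqP/oppr_inj.
  have off (h : R * R -> R) x : ~ Omega x -> h x * (eta x * phi x) = 0.
    by move=> /(test_fun0 tep) ->; rewrite mulr0.
  have := fg _ tep; rewrite (fg' _ tep) (Rintegral_off (off g)) (Rintegral_off (off g')) => E.
  have c (h : R * R -> R) : \int[mu]_x (eta x * h x * phi x) = \int[mu]_x (h x * (eta x * phi x)).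
    by apply: eq_Rintegral => x _; ring.
  by rewrite !c -E.
by apply: ae_imp => x /eqP; rewrite subr_eq0 => /eqP.
Qed.

Lemma wpartialP i f : (exists g, is_wpartial Omega i f g) ->
  is_wpartial Omega i f (wpartial Omega i f).
Proof. by move=> h; exact: (xgetPex (fun=> 0) h). Qed.

Lemma L2_ae f g : mfun2 f -> L2 mu g -> {ae mu, forall x, f x = g x} -> L2 mu f.
Proof.
move=> mf [mg g2] fg; split => //; apply: le_lt_trans g2.
rewrite le_eqVlt; apply/orP; left; apply/eqP; apply: ae_eq_integral => //.
- by apply/measurable_EFinP; exact: measurable_funX.
- by apply/measurable_EFinP; exact: measurable_funX.
- by apply: (ae_imp _ fg) => x -> _.
Qed.

Lemma W1loc2_wpartial i f : W1loc 2%:E Omega f ->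
  is_wpartial Omega i f (wpartial Omega i f).
Proof. by move=> [_ /(_ i)[g fg _]]; apply: wpartialP; exists g. Qed.

(** [wpartial] is an arbitrary choice among the weak derivatives, so its local square integrability
    is transferred by uniqueness from the derivative provided by [W1loc]. *)
Lemma W1loc2_L2 i f eta : W1loc 2%:E Omega f -> test_fun Omega eta ->
  L2 mu (fun x => eta x * wpartial Omega i f x).
Proof.
move=> [f2 /(_ i)[g fg g2]] te.
have fw : is_wpartial Omega i f (wpartial Omega i f) by apply: wpartialP; exists g.
apply: (L2_ae _ (Lploc2_L2 g2 te)); last exact: is_wpartial_unique fw fg te.
by have [_ w1 _] := fw; have [] := integrable_mfun2 (Lploc1_integrable w1 te).
Qed.

Lemma W1loc2_strong i f eta : W1loc 2%:E Omega f -> test_fun Omega eta ->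
  strong_deriv i (fun x => eta x * f x)
    (fun x => eta x * wpartial Omega i f x + partial i eta x * f x).
Proof.
move=> f2 te; apply: weak_strong; first exact: is_wpartial_weak (W1loc2_wpartial i f2) te.
apply: L2D; first exact: W1loc2_L2.
by case: f2 => f2 _; apply: Lploc2_L2 => //; exact: test_fun_partial.
Qed.

End Localization.

(** * Cutoffs on a support, inverses and real powers *)

Section Powers.
Variable R : realType.
Implicit Types (f g phi eta : R * R -> R) (i : 'I_2).
Notation mu := (leb2 R).

Lemma partial_near_cst (U : set (R * R)) (c : R) f i x : open U -> (forall y, U y -> f y = c) ->
  U x -> partial i f x = 0.
Proof.
move=> oU fU Ux.
rewrite /partial (_ : 'D_(ebase R i) f x = 'D_(ebase R i) (cst c) x); first by rewrite derive_cst.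
apply: near_eq_derive.
have : nbhs x U by exact: open_nbhs_nbhs.
by apply: filterS => y Uy /=; exact: fU.
Qed.

(** Multiplying by eta changes neither a function nor, in the product rule, its derivative on the
    support of phi, while it makes both global. *)
Lemma test_fun_cutoff (Omega : set (R * R)) phi : open Omega -> test_fun Omega phi ->
  exists eta : R * R -> R, test_fun Omega eta /\
    forall x, tsupp phi x -> eta x = 1 /\ forall i, partial i eta x = 0.
Proof.
move=> oO [_ cphi phiO]; have [eta [te _ [U [oU KU eU]]]] := cutoff_exists oO cphi phiO.
exists eta; split => // x /KU Ux; split; first exact: eU.
by move=> i; apply: (partial_near_cst i oU eU).
Qed.

Lemma Rintegral_dominated_eq0 (h : nat -> R * R -> R) (k dom : R * R -> R) : (forall n, mfun2 (h n)) -> mfun2 k ->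
  (forall x, h n x @[n --> \oo] --> k x) -> mu.-integrable setT (EFin \o dom) ->
  (forall n x, `|h n x| <= dom x) -> (forall n, \int[mu]_x h n x = 0) -> \int[mu]_x k x = 0.
Proof.
move=> mh mk hk domi hd h0.
have [] := @dominated_convergence _ _ R mu setT measurableT
  (fun n x => (h n x)%:E) (fun x => (k x)%:E) (fun x => (dom x)%:E).
- by move=> n; apply/measurable_EFinP.
- exact/measurable_EFinP.
- by apply: aeW => x _; apply: cvg_EFin; [exact: nearW|exact: hk].
- exact: domi.
- by apply: aeW => x n _; rewrite abse_EFin lee_fin.
move=> _ _ L; have hi n : mu.-integrable setT (EFin \o h n).
  apply: (le_integrable measurableT _ _ domi) => [|x _ /=]; first exact/measurable_EFinP.
  by rewrite lee_fin (le_trans (hd n x))// ler_norm.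
have E n : (\int[mu]_x (h n x)%:E = 0)%E.
  rewrite -[LHS]fineK; first by have := h0 n; rewrite /Rintegral => ->.
  exact: integrable_fin_num (hi n).
move: L; under eq_fun do rewrite E; move=> /cvg_lim L.
by rewrite /Rintegral -L// lim_cst.
Qed.

Lemma strong_inv i f d : (forall x, 1 <= f x) -> strong_deriv i f d ->
  strong_deriv i (fun x => (f x)^-1) (fun x => - ((f x)^-1) ^+ 2 * d x).
Proof.
move=> f1 fd; have [mf _ _] := fd.
have mi : mfun2 (fun x => (f x)^-1).
  by apply: mfun2_inv => // x; exact: le_trans (f1 x).
have b (s : R) : 1 <= s -> 0 <= s^-1 <= 1.
  by move=> s1; have s0 := lt_le_trans ltr01 s1; rewrite invr_ge0 ltW//= invf_le1.
have E (s t : R) : 1 <= s -> 1 <= t -> t^-1 - s^-1 - - s^-1 ^+ 2 * (t - s) = s^-1 ^+ 2 * t^-1 * (t - s) ^+ 2.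
  move=> s1 t1; have s0 := lt_le_trans ltr01 s1; have t0 := lt_le_trans ltr01 t1.
  by field; rewrite !gt_eqF.
apply: (@strong_chain1 R i f d (fun t => t^-1) (fun t => - t^-1 ^+ 2) (fun t => 1 <= t) 1 1) => //.
- by apply: measurableT_comp => //; exact: measurable_funX.
- by move=> s /b/andP[h1 h2]; rewrite normrN normrX ger0_norm// expr_le1.
- move=> s t s1 t1; have /andP[h1 h2] := b _ s1; have /andP[h3 h4] := b _ t1.
  have h5 : 0 <= s^-1 ^+ 2 <= 1 by rewrite sqr_ge0 expr_le1.
  move: h5 => /andP[h5 h6]; rewrite E// ger0_norm; last by rewrite mulr_ge0 ?sqr_ge0 ?mulr_ge0.
  by apply: ler_wpM2r; [exact: sqr_ge0|exact: mulr_ile1].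
- move=> s t s1 t1; have /andP[h1 h2] := b _ s1; have /andP[h3 h4] := b _ t1.
  have s0 := lt_le_trans ltr01 s1; have t0 := lt_le_trans ltr01 t1.
  have -> : t^-1 - s^-1 - - s^-1 ^+ 2 * (t - s) = s^-1 * (s^-1 - t^-1) * (t - s).
    by field; rewrite !gt_eqF.
  rewrite normrM ler_wpM2r// normrM (ger0_norm h1) mulr_ile1//.
  by rewrite ler_norml; apply/andP; split; lra.
Qed.

(** Convexity of the power, obtained from Young's inequality for y and x^(p - 1) with the conjugate
    exponents p and p / (p - 1). *)
Lemma powR_tangent (p x y : R) : 1 < p -> 0 <= x -> 0 <= y ->
  x `^ p + p * x `^ (p - 1) * (y - x) <= y `^ p.
Proof.
move=> p1 x0 y0; have p0 : 0 < p by lra.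
have q0 : 0 < p - 1 by lra.
have := @conjugate_powR R y (x `^ (p - 1)) p (p / (p - 1)) y0 (powR_ge0 _ _) p0 (divr_gt0 p0 q0).
rewrite -powRrM.
have -> : (p - 1) * (p / (p - 1)) = p by field; rewrite gt_eqF.
have -> : p^-1 + (p / (p - 1))^-1 = 1 by field; rewrite !gt_eqF.
move=> /(_ erefl).
have -> : x `^ p = x `^ (p - 1) * x.
  have := @powRD R x (p - 1) 1; rewrite subrK powRr1// => -> //.
  by rewrite (gt_eqF p0).
have -> : x `^ (p - 1) * x / (p / (p - 1)) = x `^ (p - 1) * x - x `^ (p - 1) * x / p.
  by field; rewrite !gt_eqF.
move=> h; have := ler_wpM2l (ltW p0) h.
have -> : p * (y `^ p / p + (x `^ (p - 1) * x - x `^ (p - 1) * x / p)) =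
  y `^ p + p * (x `^ (p - 1) * x) - x `^ (p - 1) * x by field; rewrite gt_eqF.
by clear; lra.
Qed.

Lemma powR_unit (p x : R) : 0 <= p -> 0 <= x <= 1 -> 0 <= x `^ p <= 1.
Proof.
move=> p0 /andP[x0 x1]; rewrite powR_ge0/=.
by have := @ge0_ler_powR R p p0 x 1; rewrite !nnegrE powR1 => ->.
Qed.

(** For a > 2 the derivative a t^(a - 1) is Lipschitz on [0, 1], which gives the quadratic remainder
    that the chain rule requires. *)
Lemma strong_powR i (a : R) f d : 2 < a -> (forall x, 0 <= f x <= 1) -> strong_deriv i f d ->
  strong_deriv i (fun x => f x `^ a) (fun x => a * f x `^ (a - 1) * d x).
Proof.
move=> a2 f01 fd; have [mf _ _] := fd; have a0 : 0 <= a by lra.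
have b (c s : R) : 0 <= c -> 0 <= s <= 1 -> 0 <= s `^ c <= 1 by exact: powR_unit.
have lip (x y : R) : 0 <= x <= 1 -> 0 <= y <= 1 ->
    y `^ (a - 1) - x `^ (a - 1) <= a * `|y - x|.
  move=> /andP[x0 x1] /andP[y0 y1]; have a1 : 1 < a - 1 by lra.
  have T := powR_tangent a1 y0 x0.
  have /andP[h1 h2] : 0 <= y `^ (a - 1 - 1) <= 1 by apply: b; [lra|rewrite y0 y1].
  have h3 : y `^ (a - 1 - 1) * (y - x) <= `|y - x|.
    apply: (@le_trans _ _ (y `^ (a - 1 - 1) * `|y - x|)); first by rewrite ler_wpM2l// ler_norm.
    by rewrite ler_piMl.
  have h4 := normr_ge0 (y - x).
  have h5 : (a - 1) * (y `^ (a - 1 - 1) * (y - x)) <= (a - 1) * `|y - x|.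
    by rewrite ler_wpM2l//; lra.
  by move: T h5 h4; clear; lra.
(* The tangent inequalities at x and at y enclose the remainder between 0 and a (y^(a - 1) - x^(a -
   1)) (y - x). *)
have err (x y : R) : 0 <= x <= 1 -> 0 <= y <= 1 ->
    `|y `^ a - x `^ a - a * x `^ (a - 1) * (y - x)| <= a * `|y `^ (a - 1) - x `^ (a - 1)| * `|y - x|.
  move=> /andP[x0 x1] /andP[y0 y1]; have a1 : 1 < a by lra.
  have T1 := powR_tangent a1 x0 y0; have T2 := powR_tangent a1 y0 x0.
  rewrite -[leRHS]mulrA -normrM [leLHS]ger0_norm; last by move: T1; clear; lra.
  have := ler_wpM2l a0 (ler_norm ((y `^ (a - 1) - x `^ (a - 1)) * (y - x))).
  by move: T2; clear; lra.
have mp (c : R) : mfun2 (fun x => f x `^ c) by exact: measurableT_comp (measurable_powR c) mf.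
apply: (@strong_chain1 R i f d (fun t => t `^ a) (fun t => a * t `^ (a - 1))
  (fun t => 0 <= t <= 1) a (a * a)) => //.
- by rewrite mulr_ge0.
- exact: measurable_funM.
- move=> s s01; have /andP[h1 h2] : 0 <= s `^ (a - 1) <= 1 by apply: b => //; lra.
  by rewrite ger0_norm ?mulr_ge0// ler_piMr.
- move=> s t s01 t01; apply: (le_trans (err _ _ s01 t01)).
  rewrite -[(t - s) ^+ 2]real_normK ?num_real// expr2 mulrA ler_wpM2r// -!mulrA ler_wpM2l//.
  by rewrite ler_norml lip// andbT -lerN2 opprK opprB distrC lip.
- move=> s t s01 t01; apply: (le_trans (err _ _ s01 t01)); rewrite ler_wpM2r// ler_piMr//.
  have /andP[h1 h2] : 0 <= s `^ (a - 1) <= 1 by apply: b => //; lra.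
  have /andP[h3 h4] : 0 <= t `^ (a - 1) <= 1 by apply: b => //; lra.
  by rewrite ler_norml; apply/andP; split; lra.
Qed.

Lemma strong_csub i f d (c : R) : strong_deriv i f d -> strong_deriv i (fun x => c - f x) (fun x => - d x).
Proof.
move=> fd; have [mf _ _] := fd.
have := @strong_chain1 R i f d (fun t => c - t) (fun=> -1) (fun=> True) 1 0.
rewrite (_ : (fun x => -1 * d x) = (fun x => - d x)); last by apply/funext => x; rewrite mulN1r.
apply => //.
- exact: measurable_funB.
- by move=> *; rewrite normrN normr1.
- by move=> s t _ _; rewrite mul0r normr_le0; apply/eqP; ring.
- move=> s t _ _; rewrite (_ : c - t - (c - s) - -1 * (t - s) = 0); last by ring.
  by rewrite normr0 mulr_ge0.
Qed.

End Powers.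

(** * The weak derivative of the modulus *)

Section Modulus.
Variables (R : realType) (Omega : set (R * R)).
Implicit Types (f g phi eta : R * R -> R) (i : 'I_2).
Notation mu := (leb2 R).

Lemma rad00 (e : R) : 0 <= e -> rad e 0 0 = e.
Proof. by move=> e0; rewrite /rad !expr0n/= !addr0 sqrtr_sqr ger0_norm. Qed.

Lemma rad_le (e a b : R) : 0 <= e -> rad e a b <= e + (`|a| + `|b|).
Proof. by move=> e0; have := rad_lip e 0 0 a b; rewrite !subr0 rad00. Qed.

Lemma rad_ge0e (e a b : R) : rad 0 a b <= rad e a b.
Proof.
by rewrite /rad ler_sqrt ?addr_ge0 ?sqr_ge0// !lerD2r expr0n/= sqr_ge0.
Qed.

Lemma rad_le0e (e a b : R) : 0 <= e -> rad e a b <= rad 0 a b + e.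
Proof.
move=> e0; rewrite -(@ler_pXn2r _ 2) ?nnegrE ?rad_ge0 ?addr_ge0 ?rad_ge0//.
rewrite rad_sqr sqrrD rad_sqr expr0n/=; have := mulr_ge0 (rad_ge0 0 a b) e0.
by clear; lra.
Qed.

Lemma rad_cvg0 (a b : R) : rad (hn R n) a b @[n --> \oo] --> rad 0 a b.
Proof.
apply: (@squeeze_cvgr _ _ _ _ (fun=> rad 0 a b) (fun n => rad 0 a b + hn R n)).
- by apply: nearW => n; rewrite rad_ge0e rad_le0e// ltW// hn_gt0.
- exact: cvg_cst.
- rewrite -[X in _ --> X]addr0; apply: cvgD; first exact: cvg_cst.
  exact: cvg_harmonic.
Qed.

Lemma rad_dir_cvg0 (a b : R) : a / rad (hn R n) a b @[n --> \oo] --> a / rad 0 a b.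
Proof.
have [->|a0] := eqVneq a 0.
  by rewrite mul0r; under eq_fun do rewrite mul0r; exact: cvg_cst.
apply: cvgM; first exact: cvg_cst.
apply: cvgV; last exact: rad_cvg0.
by rewrite gt_eqF// (lt_le_trans _ (rad_ge_l _ _ _))// normr_gt0.
Qed.

Lemma rad_dir_le1 (e a b : R) : `|a / rad e a b| <= 1.
Proof.
have [->|a0] := eqVneq a 0; first by rewrite mul0r normr0.
have r0 : 0 < rad e a b by rewrite (lt_le_trans _ (rad_ge_l _ _ _))// normr_gt0.
by rewrite normrM normfV (gtr0_norm r0) ler_pdivrMr// mul1r rad_ge_l.
Qed.

Lemma rad_combo_le (e a b c d : R) :
  `|a / rad e a b * c + b / rad e a b * d| <= `|c| + `|d|.
Proof.
apply: (le_trans (ler_normD _ _)); rewrite !normrM -!normrM; apply: lerD; rewrite normrM ler_piMl//.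
  exact: rad_dir_le1.
by rewrite radC rad_dir_le1.
Qed.

Lemma mfun2_combo (e : R) f0 f1 g0 g1 : mfun2 f0 -> mfun2 f1 -> mfun2 g0 -> mfun2 g1 ->
  mfun2 (fun x => f0 x / rad e (f0 x) (f1 x) * g0 x + f1 x / rad e (f0 x) (f1 x) * g1 x).
Proof.
move=> m0 m1 k0 k1.
have mi : mfun2 (fun x => (rad e (f0 x) (f1 x))^-1).
  by apply: mfun2_inv => [x|]; [exact: rad_ge0|exact: mfun2_rad].
by apply: measurable_funD; apply: measurable_funM => //; exact: measurable_funM.
Qed.

(** The chain rule holds for [rad e] with e > 0. As e tends to 0 the directions f / rad stay bounded
    by 1 and converge everywhere, the convention 0 / 0 = 0 giving the value 0 where f0 = f1 = 0, so
    the integrated identity passes to the limit by domination. *)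
Lemma modulus_wpartial i f0 f1 g0 g1 : open Omega ->
  (forall eta, test_fun Omega eta -> L2 mu (fun x => eta x * f0 x)) ->
  (forall eta, test_fun Omega eta -> L2 mu (fun x => eta x * f1 x)) ->
  (forall eta, test_fun Omega eta -> L2 mu (fun x => eta x * g0 x)) ->
  (forall eta, test_fun Omega eta -> L2 mu (fun x => eta x * g1 x)) ->
  is_wpartial Omega i f0 g0 -> is_wpartial Omega i f1 g1 ->
  is_wpartial Omega i (fun x => rad 0 (f0 x) (f1 x))
    (fun x => f0 x / rad 0 (f0 x) (f1 x) * g0 x + f1 x / rad 0 (f0 x) (f1 x) * g1 x).
Proof.
move=> oO L0 L1 K0 K1 W0 W1; have [a0 b0 _] := W0; have [a1 b1 _] := W1.
have mF (f : R * R -> R) K : Lploc 1%E Omega f -> compact K -> K `<=` Omega -> mfun2 (f \_ K).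
  by move=> fL cK KO; exact: set_mem (sub_Lfun_mfun (fL _ cK KO)).
have iF (f : R * R -> R) K : Lploc 1%E Omega f -> compact K -> K `<=` Omega ->
    mu.-integrable setT (EFin \o (fun x => `|(f \_ K) x|)).
  by move=> fL cK KO; have /Lfun1_integrable/integrable_norm := fL _ cK KO.
split.
- move=> K cK KO; apply/Lfun1_integrable.
  have E : (fun x => rad 0 (f0 x) (f1 x)) \_ K = (fun x => rad 0 ((f0 \_ K) x) ((f1 \_ K) x)).
    by apply/funext => x; rewrite !patchE; case: ifP => //; rewrite rad00.
  rewrite E; have m : mfun2 (fun x => rad 0 ((f0 \_ K) x) ((f1 \_ K) x)).
    by apply: mfun2_rad; apply: mF.
  apply: (le_integrable measurableT _ _ (integrableD measurableT (iF _ _ a0 cK KO) (iF _ _ a1 cK KO))).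
    exact/measurable_EFinP.
  move=> x _ /=; rewrite lee_fin ger0_norm ?rad_ge0// ger0_norm ?addr_ge0//.
  by have := @rad_le 0 ((f0 \_ K) x) ((f1 \_ K) x) (lexx _); rewrite add0r.
- move=> K cK KO; apply/Lfun1_integrable.
  set n' := (X in X \_ K).
  have E : n' \_ K = (fun x => (f0 \_ K) x / rad 0 ((f0 \_ K) x) ((f1 \_ K) x) * (g0 \_ K) x +
      (f1 \_ K) x / rad 0 ((f0 \_ K) x) ((f1 \_ K) x) * (g1 \_ K) x).
    by apply/funext => x; rewrite !patchE; case: ifP => // _; rewrite !mulr0 addr0.
  rewrite E.
  apply: (le_integrable measurableT _ _ (integrableD measurableT (iF _ _ b0 cK KO) (iF _ _ b1 cK KO))).
    by apply/measurable_EFinP; apply: mfun2_combo; apply: mF.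
  by move=> x _ /=; rewrite lee_fin [leRHS]ger0_norm ?addr_ge0// rad_combo_le.
move=> phi tphi; have [eta [te hcut]] := test_fun_cutoff oO tphi.
have tdp := test_fun_partial i tphi; have tde := test_fun_partial i te.
pose h0 x := eta x * f0 x; pose h1 x := eta x * f1 x.
pose d0 x := eta x * g0 x + partial i eta x * f0 x.
pose d1 x := eta x * g1 x + partial i eta x * f1 x.
have h02 : L2 mu h0 by exact: L0.
have h12 : L2 mu h1 by exact: L1.
have d02 : L2 mu d0 by apply: L2D; [exact: K0|exact: L0].
have d12 : L2 mu d1 by apply: L2D; [exact: K1|exact: L1].
have S0 : strong_deriv i h0 d0 := weak_strong (is_wpartial_weak W0 te) d02.
have S1 : strong_deriv i h1 d1 := weak_strong (is_wpartial_weak W1 te) d12.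
have [mh0 _] := h02; have [mh1 _] := h12; have [md0 _] := d02; have [md1 _] := d12.
have [p2 _] := test_fun_L2 tphi; have [dp2 _] := test_fun_L2 tdp.
have [mp _] := p2; have [mdp _] := dp2.
pose D (e : R) x := h0 x / rad e (h0 x) (h1 x) * d0 x + h1 x / rad e (h0 x) (h1 x) * d1 x.
(* Subtracting the constant puts the function in L2, with the bound |h0| + |h1| for every e >= 0,
   and does not change its derivative. *)
pose U (e : R) x := rad e (h0 x) (h1 x) - e.
have Ub (e : R) x : 0 <= e -> 0 <= U e x <= `|h0 x| + `|h1 x|.
  move=> e0; rewrite /U subr_ge0 rad_ge_e /=.
  by have := @rad_le e (h0 x) (h1 x) e0; clear; lra.
have mU (e : R) : mfun2 (U e) by apply: measurable_funB => //; exact: mfun2_rad.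
have mD (e : R) : mfun2 (D e) by exact: mfun2_combo.
have h2 : L2 mu (fun x => `|h0 x| + `|h1 x|) by apply: L2D; exact: L2_norm.
have D2 : L2 mu (fun x => `|d0 x| + `|d1 x|) by apply: L2D; exact: L2_norm.
have U2 (e : R) : 0 <= e -> L2 mu (U e).
  move=> e0; apply: (L2_le (mU e) h2) => x; have /andP[u0 u1] := Ub e x e0.
  by rewrite ger0_norm// (le_trans u1)// ler_norm.
have Dom2 (e : R) : L2 mu (D e).
  apply: (L2_le (mD e) D2) => x; apply: (le_trans (rad_combo_le _ _ _ _ _)).
  by rewrite ler_norm.
have Z : \int[mu]_x (D 0 x * phi x + U 0 x * partial i phi x) = 0.
  apply: (@Rintegral_dominated_eq0 _
    (fun n x => D (hn R n) x * phi x + U (hn R n) x * partial i phi x) _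
    (fun x => (`|d0 x| + `|d1 x|) * `|phi x| + (`|h0 x| + `|h1 x|) * `|partial i phi x|)).
  - by move=> n; apply: measurable_funD; exact: measurable_funM.
  - by apply: measurable_funD; exact: measurable_funM.
  - move=> x; apply: cvgD; apply: cvgM; try exact: cvg_cst.
      apply: cvgD; apply: cvgM; try exact: cvg_cst; first exact: rad_dir_cvg0.
      rewrite radC; under eq_fun do rewrite radC; exact: rad_dir_cvg0.
    by apply: cvgB; [exact: rad_cvg0|exact: cvg_harmonic].
  - have I1 := L2_integrableM D2 (L2_norm p2); have I2 := L2_integrableM h2 (L2_norm dp2).
    by have := integrableD measurableT I1 I2; apply: eq_integrable.
  - move=> n x; apply: (le_trans (ler_normD _ _)); rewrite !normrM.
    apply: lerD; apply: ler_wpM2r => //; first exact: rad_combo_le.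
    have /andP[u0 u1] := Ub (hn R n) x (ltW (hn_gt0 R n)).
    by rewrite -!normrM [leLHS]ger0_norm.
  - move=> n; have e0 := hn_gt0 R n.
    have SU : strong_deriv i (U (hn R n)) (D (hn R n)).
      exact: (strong_subc (hn R n) (strong_rad e0 S0 S1)).
    exact: (strong_ibp (U2 _ (ltW e0)) p2 SU (test_fun_strong i tphi)).
have IU : mu.-integrable setT (EFin \o (fun x => U 0 x * partial i phi x)).
  by apply: L2_integrableM => //; exact: U2.
have ID : mu.-integrable setT (EFin \o (fun x => D 0 x * phi x)) by exact: L2_integrableM.
move: Z; rewrite RintegralD// => Z.
have off (h ps : R * R -> R) : test_fun Omega ps ->
    \int[mu]_(x in Omega) (h x * ps x) = \int[mu]_x (h x * ps x).
  by move=> tps; apply: Rintegral_off => x /(test_fun0 tps) ->; rewrite mulr0.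
have -> : \int[mu]_(x in Omega) (rad 0 (f0 x) (f1 x) * partial i phi x) =
    \int[mu]_x (U 0 x * partial i phi x).
  rewrite (off (fun x => rad 0 (f0 x) (f1 x)) _ tdp); apply: eq_Rintegral => x _; have [->|px] := eqVneq (partial i phi x) 0; first by rewrite !mulr0.
  by have [e1 _] := hcut x (partial_supp px); rewrite /U /h0 /h1 e1 !mul1r subr0.
set J := (X in _ = - X); have -> : J = \int[mu]_x (D 0 x * phi x).
  rewrite /J (off (fun x => f0 x / rad 0 (f0 x) (f1 x) * g0 x + f1 x / rad 0 (f0 x) (f1 x) * g1 x) _ tphi).
  apply: eq_Rintegral => x _; have [px|px] := pselect (tsupp phi x); last first.
    by rewrite (tsupp_eq0 px) !mulr0.
  by have [e1 e2] := hcut x px; rewrite /D /d0 /d1 /h0 /h1 e1 e2 !mul1r !mul0r !addr0.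
by apply/eqP; rewrite -addr_eq0 addrC Z.
Qed.

End Modulus.

(** * The curl identity *)

Section CurlAlgebra.
Variable R : realType.

(** The weighted relation k Dv = l F: since 1 - q = s q, the extra factor (1 - q)^g equals s^g q^g,
    which cancels both s^(-g) and q^(-g). At s = 0 both sides are 0. *)
Lemma powR_split (q s g m F : R) : 0 < q -> 0 <= s -> 1 - q = s * q -> m + g != 0 -> m != 0 ->
  (s = 0 -> F = 0) ->
  q `^ (m - g) * (1 - q) `^ (m + g) * (s `^ (- g) * F) = q `^ m * (1 - q) `^ m * F.
Proof.
move=> q0 s0 E mg m0 F0; have [sE|sn] := eqVneq s 0; first by rewrite F0// !mulr0.
have sp : 0 < s by rewrite lt_def sn.
have qn : q != 0 by rewrite gt_eqF.
rewrite E !powRM ?(ltW q0)//.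
have D (x a b : R) : 0 < x -> x `^ (a + b) = x `^ a * x `^ b.
  by move=> x0; rewrite powRD//; apply/implyP => _; rewrite gt_eqF.
have N (x a : R) : x `^ (- a) = (x `^ a)^-1 by rewrite powRN.
rewrite !D// !N; have h1 : s `^ g != 0 by rewrite gt_eqF// powR_gt0.
have h2 : q `^ g != 0 by rewrite gt_eqF// powR_gt0.
by field; rewrite h1 h2.
Qed.

Lemma powR_pred (x a : R) : 0 < x -> x `^ (a - 1) = x `^ a / x.
Proof. by move=> x0; rewrite powRB ?powRr1 ?ltW//; apply/implyP => _; rewrite gt_eqF. Qed.

(** Here X is the weight l and X sg the weight k. The logarithmic derivatives of k and l in q differ
    by -g (1/q + 1/A) = -g / (s q^2), in which m no longer occurs; multiplied by the derivative -2
    q^2 w_j of q this gives 2 g w_j / s. *)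
Lemma curl_algebra (X sg q A s g m F0 F1 w0 w1 G01 G10 : R) :
  X != 0 -> sg != 0 -> q != 0 -> A != 0 -> s != 0 -> A = 1 - q -> A = s * q ->
  X * sg * ((m - g) / q - (m + g) / A) * (- 2 * q ^+ 2 * w0) * (sg^-1 * F1)
  - X * sg * ((m - g) / q - (m + g) / A) * (- 2 * q ^+ 2 * w1) * (sg^-1 * F0)
  - (G10 - G01) * X
  - (X * (m / q - m / A) * (- 2 * q ^+ 2 * w0) * F1
     - X * (m / q - m / A) * (- 2 * q ^+ 2 * w1) * F0) = 0 ->
  G01 - G10 = 2 * g * (F0 * w1 - F1 * w0) / s.
Proof.
move=> X0 sg0 q0 A0 s0 E1 E2.
have -> : (2 * g * (F0 * w1 - F1 * w0)) / s = 2 * g * (F0 * w1 - F1 * w0) * (q ^+ 2 * (q^-1 + A^-1)).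
  have -> : q ^+ 2 * (q^-1 + A^-1) = q * (A + q) / A by field; rewrite q0 A0.
  by rewrite {1}E1 subrK E2; field; rewrite q0 s0.
set L := (X in X = 0 -> _) => L0.
have : L = X * (G01 - G10 - 2 * g * (F0 * w1 - F1 * w0) * (q ^+ 2 * (q^-1 + A^-1))).
  by rewrite /L; field; rewrite sg0 q0 A0.
by rewrite L0 => /esym/eqP; rewrite mulf_eq0 (negbTE X0) /= subr_eq0 => /eqP.
Qed.

(** P0 and P1 stand for the derivatives of the product of cutoff and test function. Wherever they
    act, k h = kap f, so their contributions to the Jacobian and to the two integrations by parts
    cancel. *)
Lemma curl_test_algebra (k k0 k1 kap l0 l1 f0 f1 h0 h1 d10 d01 c p P0 P1 : R) :
  P1 * (k * h0 - kap * f0) = 0 -> P0 * (k * h1 - kap * f1) = 0 ->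
  (k0 * (c * h1) - k1 * (c * h0) - (d10 - d01) * (kap * c) - (l0 * (c * f1) - l1 * (c * f0))) * p =
  ((c * p) * k0 + k * P0) * h1 - ((c * p) * k1 + k * P1) * h0
  - ((d10 * (kap * (c * p)) + f1 * ((c * p) * l0 + kap * P0))
     - (d01 * (kap * (c * p)) + f0 * ((c * p) * l1 + kap * P1))).
Proof.
move=> R0 R1; apply/eqP; rewrite -subr_eq0; apply/eqP.
rewrite [LHS](_ : _ = P1 * (k * h0 - kap * f0) - P0 * (k * h1 - kap * f1)); last by ring.
by rewrite R0 R1 subrr.
Qed.

End CurlAlgebra.

(** * Square integrability of the localized v and Dv *)

Section Curl.
Variables (R : realType) (Omega : set (R * R)).
Implicit Types (f g v phi eta : R * R -> R) (i j : 'I_2).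
Notation mu := (leb2 R).

Lemma lte_mul_fin (a b : \bar R) : (0 <= a)%E -> (a < +oo)%E -> (b < +oo)%E -> (a * b < +oo)%E.
Proof. by move=> a0 aoo boo; rewrite lte_mul_pinfty// ge0_fin_numE. Qed.

(** [v] is only known to have integrable first derivatives locally; the Gagliardo-Nirenberg
    inequality for eta v raises this to L2 for v. *)
Lemma wpartial_L2 v V0 V1 eta : is_wpartial Omega 0 v V0 -> is_wpartial Omega 1 v V1 ->
  test_fun Omega eta -> L2 mu (fun x => eta x * v x).
Proof.
move=> W0 W1 te; have w0 := is_wpartial_weak W0 te; have w1 := is_wpartial_weak W1 te.
have [n eS] := test_fun_square te.
have S x : eta x * v x != 0 -> square n x.
  by move=> ev; apply: eS; apply: subset_closure; apply: contraNneq ev => ->; rewrite mul0r.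
have [i1 j0 _] := w0; have [_ j1 _] := w1.
split; first by have [] := integrable_mfun2 i1.
apply: (le_lt_trans (gagliardo_nirenberg w0 w1 S)).
have h0 := I1_fin j0; have h1 := I1_fin j1.
exact: lte_mul_fin (I1_ge0 _ _) h0 h1.
Qed.

(** [moser] is applied to z F0 and z F1, with z a cutoff equal to 1 on the support of eta, where the
    bound on V then applies unchanged. *)
Lemma growth_L2 F0 F1 (V : R * R -> R) p eta : open Omega ->
  W1loc 2%:E Omega F0 -> W1loc 2%:E Omega F1 -> Lploc 1%E Omega V ->
  (forall x, `|V x| <= rad 1 (F0 x) (F1 x) ^+ p) -> test_fun Omega eta ->
  L2 mu (fun x => eta x * V x).
Proof.
move=> oO W0 W1 LV VF te; have [z [tz hz]] := test_fun_cutoff oO te.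
have [n zS] := test_fun_square tz; have [B B0 eB] := test_fun_bounded te.
have S (F : R * R -> R) x : z x * F x != 0 -> square n x.
  by move=> zF; apply: zS; apply: subset_closure; apply: contraNneq zF => ->; rewrite mul0r.
have f02 : L2 mu (fun x => z x * F0 x) by case: W0 => L0 _; exact (Lploc2_L2 L0 tz).
have f12 : L2 mu (fun x => z x * F1 x) by case: W1 => L1 _; exact: (Lploc2_L2 L1 tz).
have M := moser f02 f12 (S F0) (S F1) (fun i => W1loc2_strong i W0 tz)
  (fun i => W1loc2_strong i W1 tz) p.
have mV : mfun2 (fun x => eta x * V x) by have [] := integrable_mfun2 (Lploc1_integrable LV te).
apply: (L2_le mV (L2Z B M)) => x.
have [ex|nx] := pselect (tsupp eta x); last by rewrite (tsupp_eq0 nx) mul0r normr0.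
have [z1 _] := hz x ex.
have Sx : square n x.
  by apply: zS; apply: subset_closure; rewrite /= z1 oner_neq0.
rewrite z1 !mul1r indicE mem_set// mulr1 !normrM; apply: ler_pM => //.
  by rewrite (ger0_norm B0).
by rewrite (le_trans (VF x))// ler_norm.
Qed.

End Curl.

Section CurlIdentity.
Variables (R : realType) (Omega : set (R * R)).
Implicit Types (f g v phi eta : R * R -> R) (i j : 'I_2).
Notation mu := (leb2 R).

Lemma L2_bound f eta : L2 mu f -> test_fun Omega eta -> L2 mu (fun x => eta x * f x).
Proof.
move=> f2 te; have [B _ eB] := test_fun_bounded te; have [se _ _] := te.
have := L2Mb f2 (smooth_mfun2 se) eB; congr (L2 mu).
by apply/funext => x; rewrite mulrC.
Qed.

Lemma test_L2_bounded f (B : R) eta : mfun2 f -> (forall x, `|f x| <= B) -> test_fun Omega eta ->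
  L2 mu (fun x => f x * eta x).
Proof.
move=> mf fB te; have [e2 _] := test_fun_L2 te.
have := L2Mb e2 mf fB; congr (L2 mu).
by apply/funext => x; rewrite mulrC.
Qed.

Lemma strong_mul_test i f d (B : R) eta : strong_deriv i f d -> (forall x, `|f x| <= B) ->
  test_fun Omega eta ->
  strong_deriv i (fun x => f x * eta x) (fun x => eta x * d x + f x * partial i eta x).
Proof.
move=> fd fB te; have [C _ eC] := test_fun_bounded te.
apply: (@strong_mul R i f eta _ _ (Num.max B C)) => //.
- exact: test_fun_strong te.
- by move=> x; rewrite le_max fB.
- by move=> x; rewrite le_max eC orbT.
Qed.

(* Write s = |F|^2, q = 1 / (1 + s), k = q^(m - gam/2) (1 - q)^(m + gam/2) and
   l = q^m (1 - q)^m, so that k = l s^(gam/2) and k Dv = l F. For large m both are regular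
   enough for the chain rule. Integrating l F by parts and using the Jacobian identity for
   (k phi, v), the terms with derivatives of phi cancel. *)
Lemma curl_identity (gam : R) v F0 F1 V0 V1 p chi : open Omega ->
  is_wpartial Omega 0 v V0 -> is_wpartial Omega 1 v V1 ->
  W1loc 2%:E Omega F0 -> W1loc 2%:E Omega F1 ->
  (forall x, V0 x = (F0 x ^+ 2 + F1 x ^+ 2) `^ (- (gam / 2)) * F0 x) ->
  (forall x, V1 x = (F0 x ^+ 2 + F1 x ^+ 2) `^ (- (gam / 2)) * F1 x) ->
  (forall x, `|V0 x| <= rad 1 (F0 x) (F1 x) ^+ p) ->
  (forall x, `|V1 x| <= rad 1 (F0 x) (F1 x) ^+ p) ->
  test_fun Omega chi ->
  let G0 j := wpartial Omega j F0 in let G1 j := wpartial Omega j F1 in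
  {ae mu, forall x, chi x != 0 -> F0 x ^+ 2 + F1 x ^+ 2 != 0 ->
    G0 1 x - G1 0 x = gam * (F0 x * (F0 x * G0 1 x + F1 x * G1 1 x)
      - F1 x * (F0 x * G0 0 x + F1 x * G1 0 x)) / (F0 x ^+ 2 + F1 x ^+ 2)}.
Proof.
move=> oO W0 W1 Q0 Q1 E0 E1 b0 b1 tchi G0 G1.
have [z [tz hz]] := test_fun_cutoff oO tchi.
have tdz j := test_fun_partial j tz.
pose f0 x := z x * F0 x; pose f1 x := z x * F1 x.
pose d0 j x := z x * G0 j x + partial j z x * F0 x.
pose d1 j x := z x * G1 j x + partial j z x * F1 x.
have [LF0 _] := Q0; have [LF1 _] := Q1.
have f02 : L2 mu f0 := Lploc2_L2 LF0 tz.
have f12 : L2 mu f1 := Lploc2_L2 LF1 tz.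
have S0 j : strong_deriv j f0 (d0 j) := W1loc2_strong j Q0 tz.
have S1 j : strong_deriv j f1 (d1 j) := W1loc2_strong j Q1 tz.
pose g x := z x * v x.
pose h0 x := z x * V0 x + partial 0 z x * v x.
pose h1 x := z x * V1 x + partial 1 z x * v x.
have g2 : L2 mu g := wpartial_L2 W0 W1 tz.
have [Lv LV0 _] := W0; have [_ LV1 _] := W1.
have h02 : L2 mu h0 := L2D (growth_L2 oO Q0 Q1 LV0 b0 tz) (wpartial_L2 W0 W1 (tdz 0)).
have h12 : L2 mu h1 := L2D (growth_L2 oO Q0 Q1 LV1 b1 tz) (wpartial_L2 W0 W1 (tdz 1)).
have T0 : strong_deriv 0 g h0 := weak_strong (is_wpartial_weak W0 tz) h02.
have T1 : strong_deriv 1 g h1 := weak_strong (is_wpartial_weak W1 tz) h12.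
pose r x := rad 1 (f0 x) (f1 x).
pose dr j x := f0 x / r x * d0 j x + f1 x / r x * d1 j x.
have Sr j : strong_deriv j r (dr j) := strong_rad ltr01 (S0 j) (S1 j).
have r1 x : 1 <= r x by exact: rad_ge_e.
have r0 x : 0 < r x by exact: lt_le_trans (r1 x).
pose rho x := (r x)^-1; have rho01 x : 0 <= rho x <= 1.
  by rewrite invr_ge0 ltW//= invf_le1.
have rhoB x : `|rho x| <= 1 by have /andP[? ?] := rho01 x; rewrite ger0_norm.
(* 1 / (1 + |f|^2) is reached through r, 1 / r and its square, as each of these steps satisfies the
   global bounds of the chain rule. *)
pose q x := rho x ^+ 2; pose dq j x := (2%:R * rho x ^+ 1) * (- rho x ^+ 2 * dr j x).
have Sq j : strong_deriv j q (dq j) := strong_pow 1 (strong_inv r1 (Sr j)) rhoB.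
have q01 x : 0 <= q x <= 1.
  by have /andP[h k] := rho01 x; rewrite sqr_ge0 expr_le1.
have p01 x : 0 <= 1 - q x <= 1 by have /andP[h k] := q01 x; apply/andP; split; lra.
pose K (a b : R) x := q x `^ a * (1 - q x) `^ b.
pose dK (a b : R) j x := (1 - q x) `^ b * (a * q x `^ (a - 1) * dq j x)
  + q x `^ a * (b * (1 - q x) `^ (b - 1) * (- dq j x)).
have n1 (c y : R) : 2 < c -> 0 <= y <= 1 -> `|y `^ c| <= 1.
  move=> c2 y01; have /andP[k1 k2] : 0 <= y `^ c <= 1 by apply: powR_unit => //; lra.
  by rewrite ger0_norm.
have SK a b j : 2 < a -> 2 < b -> strong_deriv j (K a b) (dK a b j).
  move=> a2 b2; apply: strong_mul.
  - exact: (strong_powR a2 q01 (Sq j)).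
  - exact: (strong_powR b2 p01 (strong_csub 1 (Sq j))).
  - by move=> x; exact: n1.
  - by move=> x; exact: n1.
have KB a b x : 2 < a -> 2 < b -> `|K a b x| <= 1.
  by move=> a2 b2; rewrite normrM mulr_ile1// n1.
(* All of m, m - gh and m + gh exceed 2, as [strong_powR] requires. *)
pose gh := gam / 2; pose m := 3 + `|gh|.
have m2 : 2 < m by rewrite /m; have := normr_ge0 gh; clear; lra.
have am : 2 < m - gh by rewrite /m; have := ler_norm gh; clear; lra.
have bm : 2 < m + gh by rewrite /m; have := ler_norm (- gh); rewrite normrN; clear; lra.
pose k := K (m - gh) (m + gh); pose dk := dK (m - gh) (m + gh).
pose kap := K m m; pose dkap := dK m m.
have Sk j : strong_deriv j k (dk j) by exact: SK.
have Skap j : strong_deriv j kap (dkap j) by exact: SK.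
have kB x : `|k x| <= 1 by exact: KB.
have kapB x : `|kap x| <= 1 by exact: KB.
have [mk _ _] := Sk 0; have [mkap _ _] := Skap 0.
have [tchi_s _ _] := tchi; have mchi := smooth_mfun2 tchi_s.
have cut x : tsupp chi x -> [/\ f0 x = F0 x, f1 x = F1 x, h0 x = V0 x, h1 x = V1 x &
    forall j, d0 j x = G0 j x /\ d1 j x = G1 j x].
  move=> /hz[z1 dz]; rewrite /f0 /f1 /h0 /h1 /d0 /d1 z1 !dz !mul1r !mul0r !addr0.
  by split => // j; rewrite dz !mul0r !addr0 !mul1r.
have qE x : q x = (1 + f0 x ^+ 2 + f1 x ^+ 2)^-1.
  by rewrite /q /rho exprVn rad_sqr expr1n.
pose s x := f0 x ^+ 2 + f1 x ^+ 2; have s_ge0 x : 0 <= s x by rewrite addr_ge0 ?sqr_ge0.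
have q0 x : 0 < q x by rewrite qE invr_gt0; have := s_ge0 x; rewrite /s; clear; lra.
have qs x : 1 - q x = s x * q x.
  have nz : 1 + f0 x ^+ 2 + f1 x ^+ 2 != 0 by rewrite gt_eqF//; have := s_ge0 x; rewrite /s; clear; lra.
  by rewrite qE /s; field.
have s0 x : s x = 0 -> f0 x = 0 /\ f1 x = 0.
  move=> /eqP; rewrite paddr_eq0 ?sqr_ge0// !sqrf_eq0 => /andP[/eqP ? /eqP ?]; by split.
have rel0 x : tsupp chi x -> k x * V0 x = kap x * f0 x.
  move=> /cut[e0 e1 _ _ _]; rewrite E0 /k /kap /K -e0 -e1.
  by apply: powR_split => //; [exact: s_ge0|rewrite gt_eqF//; lra|rewrite gt_eqF//; lra|move=> /s0[]].
have rel1 x : tsupp chi x -> k x * V1 x = kap x * f1 x.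
  move=> /cut[e0 e1 _ _ _]; rewrite E1 /k /kap /K -e0 -e1.
  by apply: powR_split => //; [exact: s_ge0|rewrite gt_eqF//; lra|rewrite gt_eqF//; lra|move=> /s0[]].
(* [E] is chi times the expression of [curl_algebra]: [A1] is the part left by the Jacobian of the
   weighted test function and v, [A2] and [A3] the parts left by integrating f1 and f0 by parts. *)
pose A1 x := dk 0 x * (chi x * h1 x) - dk 1 x * (chi x * h0 x).
pose A2 x := (d1 0 x - d0 1 x) * (kap x * chi x).
pose A3 x := dkap 0 x * (chi x * f1 x) - dkap 1 x * (chi x * f0 x).
pose E x := A1 x - A2 x - A3 x.
have Ld j : [/\ L2 mu (dk j), L2 mu (dkap j), L2 mu (d0 j) & L2 mu (d1 j)].
  by split; [case: (Sk j)|case: (Skap j)|case: (S0 j)|case: (S1 j)].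
have [dk02 dkap02 d002 d102] := Ld 0; have [dk12 dkap12 d012 d112] := Ld 1.
have IE : mu.-integrable setT (EFin \o E).
  apply: integrable_subr; first apply: integrable_subr.
  - by apply: integrable_subr; apply: L2_integrableM => //; exact: L2_bound.
  - by apply: L2_integrableM; [exact: L2B|exact: test_L2_bounded kapB tchi].
  - by apply: integrable_subr; apply: L2_integrableM => //; exact: L2_bound.
have E_eq0 : {ae mu, forall x, E x = 0}.
  apply: du_bois_reymond => // phi tphi; have [sphi _ _] := tphi.
  pose Phi x := chi x * phi x.
  have tPhi : test_fun Omega Phi by exact: test_funMl.
  have PhiS x : tsupp Phi x -> tsupp chi x.
    by apply: closure_subset => y /=; apply: contraNneq; rewrite /Phi => ->; rewrite mul0r.
  pose u x := k x * Phi x; pose du j x := Phi x * dk j x + k x * partial j Phi x.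
  have Su j : strong_deriv j u (du j) := strong_mul_test (Sk j) kB tPhi.
  pose w x := kap x * Phi x; pose dw j x := Phi x * dkap j x + kap x * partial j Phi x.
  have Sw j : strong_deriv j w (dw j) := strong_mul_test (Skap j) kapB tPhi.
  have u2 : L2 mu u := test_L2_bounded mk kB tPhi.
  have w2 : L2 mu w := test_L2_bounded mkap kapB tPhi.
  have du2 j : L2 mu (du j) by case: (Su j).
  have dw2 j : L2 mu (dw j) by case: (Sw j).
  pose J x := du 0 x * h1 x - du 1 x * h0 x.
  pose B0 x := d1 0 x * w x + f1 x * dw 0 x.
  pose B1 x := d0 1 x * w x + f0 x * dw 1 x.
  have IJ : mu.-integrable setT (EFin \o J).
    by apply: integrable_subr; exact: L2_integrableM.
  have IB0 : mu.-integrable setT (EFin \o B0).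
    exact: (integrableD measurableT (L2_integrableM d102 w2) (L2_integrableM f12 (dw2 0))).
  have IB1 : mu.-integrable setT (EFin \o B1).
    exact: (integrableD measurableT (L2_integrableM d012 w2) (L2_integrableM f02 (dw2 1))).
  have ZJ : \int[mu]_x J x = 0.
    have <- := strong_jacobian u2 g2 (Su 0) (Su 1) T0 T1.
    by apply: eq_Rintegral => x _; rewrite mulrN.
  have Z0 : \int[mu]_x B0 x = 0 := strong_ibp f12 w2 (S1 0) (Sw 0).
  have Z1 : \int[mu]_x B1 x = 0 := strong_ibp f02 w2 (S0 1) (Sw 1).
  have -> : \int[mu]_x (E x * phi x) = \int[mu]_x (J x - (B0 x - B1 x)).
    apply: eq_Rintegral => x _.
    (* Either x is in the support of chi, where the weighted relation k Dv = kap F holds, or the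
       derivatives of Phi vanish at x. *)
    have [R0 R1] : partial 1 Phi x * (k x * h0 x - kap x * f0 x) = 0 /\
        partial 0 Phi x * (k x * h1 x - kap x * f1 x) = 0.
      have [cx|ncx] := pselect (tsupp chi x); last first.
        have dP j : partial j Phi x = 0 by apply/eqP/negPn/negP => /partial_supp/PhiS.
        by rewrite !dP !mul0r.
      have [_ _ v0 v1 _] := cut x cx.
      by rewrite v0 v1 (rel0 x cx) (rel1 x cx) !subrr !mulr0.
    exact: (curl_test_algebra (dk 0 x) (dk 1 x) (dkap 0 x) (dkap 1 x) (d1 0 x) (d0 1 x)
      (chi x) (phi x) R0 R1).
  have IB : mu.-integrable setT (EFin \o (fun x => B0 x - B1 x)) := integrable_subr IB0 IB1.
  by rewrite (RintegralB measurableT IJ IB) (RintegralB measurableT IB0 IB1) ZJ Z0 Z1 !subr0.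
apply: (ae_imp _ E_eq0) => x Ex cx sx.
have sc : tsupp chi x by exact: subset_closure.
have [e0 e1 v0 v1 dd] := cut x sc.
have qn : q x != 0 by rewrite gt_eqF.
rewrite -e0 -e1 in sx *.
have sp : 0 < s x by rewrite lt_def sx s_ge0.
have Ap : 0 < 1 - q x by rewrite qs mulr_gt0.
have X0 : kap x != 0 by rewrite /kap /K gt_eqF// mulr_gt0// powR_gt0.
have sg0 : s x `^ gh != 0 by rewrite gt_eqF// powR_gt0.
have dqE j : dq j x = - 2 * q x ^+ 2 * (f0 x * d0 j x + f1 x * d1 j x).
  rewrite /dq /dr /q -/(rho x); ring.
(* As s > 0 at this point, both q and 1 - q are positive and the derivative of the weight can be
   written logarithmically, the form used in [curl_algebra]. *)
have dKE a b j : dK a b j x = K a b x * (a / q x - b / (1 - q x)) * dq j x.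
  rewrite /dK /K !powR_pred//; field; by rewrite qn gt_eqF.
have D (a b : R) : forall y : R, 0 < y -> y `^ (a + b) = y `^ a * y `^ b.
  by move=> y y0; rewrite powRD//; apply/implyP => _; rewrite gt_eqF.
have kE : k x = kap x * s x `^ gh.
  have := @powR_split R (q x) (s x) gh m (s x `^ gh) (q0 x) (s_ge0 x) (qs x).
  rewrite powRN mulVf// mulr1 /k /kap /K => -> //; first by rewrite gt_eqF//; lra.
    by rewrite gt_eqF//; lra.
  by move=> sE; move: sx; rewrite -/(s x) sE eqxx.
have gE : gam = 2 * gh by rewrite /gh; field.
have [d00 d10] := dd 0; have [d01 d11] := dd 1.
rewrite -d00 -d10 -d01 -d11 gE.
apply: (@curl_algebra R (kap x) (s x `^ gh) (q x) (1 - q x) (s x) gh m) => //.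
- by rewrite gt_eqF.
apply: (@mulfI _ (chi x)) => //; rewrite mulr0 -{}Ex /E /A1 /A2 /A3.
have kE' : K (m - gh) (m + gh) x = kap x * s x `^ gh := kE.
rewrite v0 v1 E0 E1 -e0 -e1 -/(s x) -/gh powRN /dk /dkap !dKE !dqE kE' -/(kap x).
move: (kap x) (s x `^ gh) (q x) (f0 x) (f1 x) (d0 0 x) (d0 1 x) (d1 0 x) (d1 1 x) (chi x); generalize m gh.
by clear => *; ring.
Qed.

End CurlIdentity.

(** * The integral identity *)

Section Core.
Variable R : realType.
Implicit Types (f g phi eta : R * R -> R) (i j k l : 'I_2).
Notation mu := (leb2 R).

(** The two sides differ by -f1 p0 C + f0 p1 C, where C = 0 is the curl relation. That relation is
    available only where a derivative of psi is nonzero and s <> 0; at s = 0 both f0 and f1 vanish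
    and only the determinant is left on each side. *)
Lemma core_algebra (gam ps p0 p1 p00 p01 p10 p11 f0 f1 d00 d01 d10 d11 s : R) :
  s = f0 ^+ 2 + f1 ^+ 2 ->
  (p0 != 0 -> s != 0 ->
    d01 - d10 = gam * (f0 * (f0 * d01 + f1 * d11) - f1 * (f0 * d00 + f1 * d10)) / s) ->
  (p1 != 0 -> s != 0 ->
    d01 - d10 = gam * (f0 * (f0 * d01 + f1 * d11) - f1 * (f0 * d00 + f1 * d10)) / s) ->
  - (d00 * d11 - d01 * d10) * ps
  + (1 / 2) * (p00 * f0 * f0 + p01 * f0 * f1 + p10 * f1 * f0 + p11 * f1 * f1)
  - (1 - gam) / 2 * ((f0 ^+ 2 + f1 ^+ 2) * (p00 + p11))
  + gam * (((f0 * d00 + f1 * d10) * f0 + (f0 * d01 + f1 * d11) * f1) * (f0 * p0 + f1 * p1) / s) =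
  (1 / 2) * (((ps * d10 + p0 * f1) * d01 - (ps * d11 + p1 * f1) * d00)
             - ((ps * d00 + p0 * f0) * d11 - (ps * d01 + p1 * f0) * d10))
  + (1 / 2) * ((d00 * (p0 * f0) + f0 * (p0 * d00 + p00 * f0))
              + (d00 * (p1 * f1) + f0 * (p1 * d10 + p01 * f1))
              + (d11 * (p0 * f0) + f1 * (p0 * d01 + p10 * f0))
              + (d11 * (p1 * f1) + f1 * (p1 * d11 + p11 * f1)))
  - (1 - gam) / 2 * ((d00 * (p0 * f0) + f0 * (p0 * d00 + p00 * f0))
              + (d01 * (p1 * f0) + f0 * (p1 * d01 + p11 * f0))
              + (d10 * (p0 * f1) + f1 * (p0 * d10 + p00 * f1))
              + (d11 * (p1 * f1) + f1 * (p1 * d11 + p11 * f1))).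
Proof.
move=> sE h0 h1; have [s0|sn] := eqVneq s 0.
  have [-> ->] : f0 = 0 /\ f1 = 0.
    move: s0; rewrite sE => /eqP; rewrite paddr_eq0 ?sqr_ge0// !sqrf_eq0.
    by move=> /andP[/eqP -> /eqP ->].
  by rewrite !mul0r !mulr0 !add0r !mul0r; field.
set w := f0 * (f0 * d01 + f1 * d11) - f1 * (f0 * d00 + f1 * d10) in h0 h1.
have K0 : p0 * (d01 - d10 - gam * w / s) = 0.
  by have [->|pn] := eqVneq p0 0; [rewrite mul0r|rewrite h0// subrr mulr0].
have K1 : p1 * (d01 - d10 - gam * w / s) = 0.
  by have [->|pn] := eqVneq p1 0; [rewrite mul0r|rewrite h1// subrr mulr0].
apply/eqP; rewrite -subr_eq0; apply/eqP.
rewrite [LHS](_ : _ = - f1 * (p0 * (d01 - d10 - gam * w / s)) + f0 * (p1 * (d01 - d10 - gam * w / s))).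
  by rewrite K0 K1 !mulr0 addr0.
by rewrite /w; move: sn; rewrite sE => sn; field.
Qed.

Lemma integrable_ext f g : (forall x, f x = g x) -> mu.-integrable setT (EFin \o f) ->
  mu.-integrable setT (EFin \o g).
Proof. by move=> /funext ->. Qed.

Lemma transpose4 (a b c d g k : R) : a + 1 / 2 * b - k * c + g * d = 0 ->
  a = - (1 / 2) * b + k * c - g * d.
Proof. by lra. Qed.

(** Keeps integrability and value together, so that the integral of a long linear combination is
    computed along its syntax without separate side conditions. *)
Definition has_int (h : R * R -> R) (a : R) :=
  mu.-integrable setT (EFin \o h) /\ \int[mu]_x h x = a.

Lemma has_intD f g (a b : R) : has_int f a -> has_int g b -> has_int (fun x => f x + g x) (a + b).
Proof.
move=> [fi <-] [gi <-]; split; first exact: (integrableD measurableT fi gi).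
exact: RintegralD.
Qed.

Lemma has_intZ f (c a : R) : has_int f a -> has_int (fun x => c * f x) (c * a).
Proof.
move=> [fi <-]; split; first exact: (integrableZl measurableT c fi).
exact: RintegralZl.
Qed.

Lemma has_intB f g (a b : R) : has_int f a -> has_int g b -> has_int (fun x => f x - g x) (a - b).
Proof.
move=> [fi <-] [gi <-]; split; first exact: (integrableB measurableT fi gi).
exact: RintegralB.
Qed.

Lemma has_int_self f : mu.-integrable setT (EFin \o f) -> has_int f (\int[mu]_x f x).
Proof. by []. Qed.

Lemma has_int_ae f g (a b : R) : has_int f a -> has_int g b -> {ae mu, forall x, f x = g x} -> a = b.
Proof.
move=> [/integrable_mfun2[mf _] <-] [/integrable_mfun2[mg _] <-] fg.
exact: ae_eq_Rintegral.
Qed.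

(** [f] and [d] will be F times a cutoff and its derivative. The product rule for eta f is a
    hypothesis because f may be unbounded, out of reach of [strong_mul]; in the application it comes
    from the local weak derivative of F. *)
Lemma core_identity (Omega : set (R * R)) (gam : R) psi (f : 'I_2 -> R * R -> R)
    (d : 'I_2 -> 'I_2 -> R * R -> R) :
  test_fun Omega psi -> (forall k, L2 mu (f k)) -> (forall k j, strong_deriv j (f k) (d k j)) ->
  (forall eta k j, test_fun Omega eta -> tsupp eta `<=` tsupp psi ->
    strong_deriv j (fun x => eta x * f k x) (fun x => eta x * d k j x + partial j eta x * f k x)) ->
  (forall i, {ae mu, forall x, partial i psi x != 0 -> f 0 x ^+ 2 + f 1 x ^+ 2 != 0 ->
    d 0 1 x - d 1 0 x = gam * (f 0 x * (f 0 x * d 0 1 x + f 1 x * d 1 1 x)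
      - f 1 x * (f 0 x * d 0 0 x + f 1 x * d 1 0 x)) / (f 0 x ^+ 2 + f 1 x ^+ 2)}) ->
  let P i j := partial i (partial j psi) in
  \int[mu]_x (- (d 0 0 x * d 1 1 x - d 0 1 x * d 1 0 x) * psi x) =
  - (1 / 2) * \int[mu]_x (P 0 0 x * f 0 x * f 0 x + P 0 1 x * f 0 x * f 1 x
                + P 1 0 x * f 1 x * f 0 x + P 1 1 x * f 1 x * f 1 x)
  + (1 - gam) / 2 * \int[mu]_x ((f 0 x ^+ 2 + f 1 x ^+ 2) * (P 0 0 x + P 1 1 x))
  - gam * \int[mu]_x (((f 0 x * d 0 0 x + f 1 x * d 1 0 x) * f 0 x
        + (f 0 x * d 0 1 x + f 1 x * d 1 1 x) * f 1 x)
      * (f 0 x * partial 0 psi x + f 1 x * partial 1 psi x) / (f 0 x ^+ 2 + f 1 x ^+ 2)).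
Proof.
move=> tpsi f2 Sf Sef curl P.
pose p i := partial i psi.
have tp i : test_fun Omega (p i) by exact: test_fun_partial.
have pS i : tsupp (p i) `<=` tsupp psi.
  have cl : closed (tsupp psi) by exact: closed_closure.
  rewrite [X in _ `<=` X]((closure_id _).1 cl); apply: closure_subset => y.
  exact: partial_supp.
have tP i j : test_fun Omega (P i j) := test_fun_partial i (tp j).
have d2 k j : L2 mu (d k j) by case: (Sf k j).
have LT eta g : test_fun Omega eta -> L2 mu g -> L2 mu (fun x => eta x * g x).
  by move=> te g2; exact: (L2_bound g2 te).
(* The integrand of the integration by parts of [f k] against [p j * f l] in direction i. *)
pose X k i l j x := d k i x * (p j x * f l x) + f k x * (p j x * d l i x + P i j x * f l x).
have ZX k i l j : has_int (X k i l j) 0.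
  have h2 : L2 mu (fun x => p j x * f l x) by exact: LT.
  have Sh := Sef (p j) l i (tp j) (pS j).
  have k2 : L2 mu (fun x => p j x * d l i x + P i j x * f l x) by case: Sh.
  split; last exact: (strong_ibp (f2 k) h2 (Sf k i) Sh).
  exact: (integrable_addr (L2_integrableM (d2 k i) h2) (L2_integrableM (f2 k) k2)).
(* The Jacobian determinant of the pair (psi f_k, f_l). *)
pose J k l x := (psi x * d k 0 x + p 0 x * f k x) * d l 1 x - (psi x * d k 1 x + p 1 x * f k x) * d l 0 x.
have ZJ k l : has_int (J k l) 0.
  have h2 : L2 mu (fun x => psi x * f k x) by exact: LT.
  have Sh j := Sef psi k j tpsi (fun x => id).
  have k2 j : L2 mu (fun x => psi x * d k j x + p j x * f k x) by case: (Sh j).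
  split.
    by apply: integrable_subr; apply: L2_integrableM.
  have <- := strong_jacobian h2 (f2 l) (Sh 0) (Sh 1) (Sf l 0) (Sf l 1).
  by apply: eq_Rintegral => x _; rewrite mulrN.
have IT1 : mu.-integrable setT (EFin \o (fun x => - (d 0 0 x * d 1 1 x - d 0 1 x * d 1 0 x) * psi x)).
  have := integrable_subr (L2_integrableM (d2 0 1) (LT _ _ tpsi (d2 1 0)))
    (L2_integrableM (d2 0 0) (LT _ _ tpsi (d2 1 1))).
  by apply: integrable_ext => x; ring.
have If i j : mu.-integrable setT (EFin \o (fun x => P i j x * f i x * f j x)).
  by apply: L2_integrableM => //; exact: LT.
have IT2 := integrable_addr (integrable_addr (integrable_addr (If 0 0) (If 0 1)) (If 1 0)) (If 1 1).
have IT3 : mu.-integrable setT (EFin \o (fun x => (f 0 x ^+ 2 + f 1 x ^+ 2) * (P 0 0 x + P 1 1 x))).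
  have Ig i k : mu.-integrable setT (EFin \o (fun x => P i i x * f k x * f k x)).
    by apply: L2_integrableM => //; exact: LT.
  have := integrable_addr (integrable_addr (integrable_addr (Ig 0 0) (Ig 0 1)) (Ig 1 0)) (Ig 1 1).
  apply: integrable_ext => x; move: (f 0 x) (f 1 x) (P 0 0 x) (P 1 1 x) => a b c e.
  by clear; ring.
(* The division by |f|^2 in the last term is distributed over two such unit directions, bounded by
   1, so the term is integrable although its denominator may vanish. *)
pose e k x := f k x / rad 0 (f 0 x) (f 1 x).
have eb k x : `|e k x| <= 1.
  rewrite /e; have [->|->] : k = 0 \/ k = 1.
  - by case: k => [[|[|//]] Hk]; [left|right]; exact: val_inj.
  - exact: rad_dir_le1.
  - by rewrite radC; exact: rad_dir_le1.
have [mf0 _] := f2 0; have [mf1 _] := f2 1.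
have me k : mfun2 (e k).
  apply: measurable_funM; first by case: (f2 k).
  by apply: mfun2_inv => [x|]; [exact: rad_ge0|exact: mfun2_rad].
pose T4 x := ((f 0 x * d 0 0 x + f 1 x * d 1 0 x) * f 0 x
        + (f 0 x * d 0 1 x + f 1 x * d 1 1 x) * f 1 x)
      * (f 0 x * p 0 x + f 1 x * p 1 x) / (f 0 x ^+ 2 + f 1 x ^+ 2).
have IT4 : mu.-integrable setT (EFin \o T4).
  pose Y i j x := (d 0 j x * (p i x * f 0 x) + d 1 j x * (p i x * f 1 x)) * (e j x * e i x).
  have IY i j : mu.-integrable setT (EFin \o Y i j).
    have I0 := integrable_addr (L2_integrableM (d2 0 j) (LT _ _ (tp i) (f2 0)))
      (L2_integrableM (d2 1 j) (LT _ _ (tp i) (f2 1))).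
    apply: (@integrable_Mb R 1 _ _ I0); first exact: measurable_funM.
    by move=> x; rewrite normrM mulr_ile1.
  have := integrable_addr (integrable_addr (integrable_addr (IY 0 0) (IY 0 1)) (IY 1 0)) (IY 1 1).
  apply: integrable_ext => x; rewrite /Y /T4 /e.
  have := rad_sqr 0 (f 0 x) (f 1 x); rewrite expr0n/= add0r => <-.
  rewrite -exprVn; move: (rad 0 (f 0 x) (f 1 x))^-1 (f 0 x) (f 1 x) (p 0 x) (p 1 x).
  move: (d 0 0 x) (d 0 1 x) (d 1 0 x) (d 1 1 x) => *.
  by clear; ring.
have H := has_intD (has_intB (has_intD (has_int_self IT1) (has_intZ (1 / 2) (has_int_self IT2)))
  (has_intZ ((1 - gam) / 2) (has_int_self IT3))) (has_intZ gam (has_int_self IT4)).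
(* The right side of [core_algebra], term by term; every integral in it is 0. *)
have H' := has_intB (has_intD (has_intZ (1 / 2) (has_intB (ZJ 1 0) (ZJ 0 1)))
   (has_intZ (1 / 2) (has_intD (has_intD (has_intD (ZX 0 0 0 0) (ZX 0 0 1 1)) (ZX 1 1 0 0)) (ZX 1 1 1 1))))
   (has_intZ ((1 - gam) / 2) (has_intD (has_intD (has_intD (ZX 0 0 0 0) (ZX 0 1 0 1)) (ZX 1 0 1 0)) (ZX 1 1 1 1))).
have Z := has_int_ae H H'; rewrite !subrr !addr0 !mulr0 addr0 subr0 in Z.
apply: transpose4; apply: Z.
apply: (ae_imp _ (ae_and (curl 0) (curl 1))) => x [c0 c1].
exact: (core_algebra (psi x) (P 0 0 x) (P 0 1 x) (P 1 0 x) (P 1 1 x) erefl c0 c1).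
Qed.

End Core.

(** * Pointwise relations between Dv and F *)

Section Pointwise.
Variable R : realType.
Implicit Types (a b n beta : R).

Lemma sum_ord2 (V : nmodType) (E : 'I_2 -> V) : \sum_i E i = E 0 + E 1.
Proof.
by rewrite !big_ord_recl big_ord0 addr0; congr (E _ + E _); exact: val_inj.
Qed.

Lemma det2 (M : 'M[R]_2) : \det M = M 0 0 * M 1 1 - M 0 1 * M 1 0.
Proof.
rewrite (expand_det_row _ 0) sum_ord2 /cofactor !det_mx11 !mxE /= expr0 expr1 mul1r mulN1r mulrN.
by congr (_ * M _ _ - _ * M _ _); exact: val_inj.
Qed.

Lemma enormE (u : 'cV[R]_2) : enorm u = Num.sqrt (u 0 0 ^+ 2 + u 1 0 ^+ 2).
Proof. by rewrite /enorm /dotp sum_ord2 !expr2. Qed.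

Lemma addr1_gt0 beta : -1 < beta -> 0 < beta + 1.
Proof. by move=> b1; lra. Qed.

Lemma powR_beta1 n beta : 0 <= n -> -1 < beta -> n `^ (beta + 1) = n `^ beta * n.
Proof.
move=> n0 b1; rewrite powRD ?powRr1//; apply/implyP => /eqP h.
by move: b1; rewrite -subr_gt0 opprK h ltxx.
Qed.

Lemma powR_double n c : 0 <= n -> n `^ (2 * c) = (n `^ c) ^+ 2.
Proof. by move=> n0; rewrite mulrC powRrM powR_mulrn// powR_ge0. Qed.

Lemma combo_congr (a b c d a' b' c' d' w : R) : a = a' -> b = b' -> c = c' -> d = d' ->
  w = a' / rad 0 a' b' * c' + b' / rad 0 a' b' * d' ->
  w = a / rad 0 a b * c + b / rad 0 a b * d.
Proof. by move=> -> -> -> ->. Qed.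

Lemma third_algebra (w0 w1 p0 p1 a b q y00 y10 y01 y11 : R) :
  a * a * q = y00 -> b * a * q = y10 -> a * b * q = y01 -> b * b * q = y11 ->
  (w0 * a + w1 * b) * (a * p0 + b * p1) * q =
  p0 * w0 * y00 + p0 * w1 * y10 + p1 * w0 * y01 + p1 * w1 * y11.
Proof. by move=> <- <- <- <-; ring. Qed.

Variables (beta a b n : R).
Hypotheses (beta1 : -1 < beta) (nE : n = Num.sqrt (a ^+ 2 + b ^+ 2)).
Let t := n `^ beta.

Lemma norm2_ge0 : 0 <= n. Proof. by rewrite nE sqrtr_ge0. Qed.

Lemma norm2_sqr : n ^+ 2 = a ^+ 2 + b ^+ 2.
Proof. by rewrite nE sqr_sqrtr// addr_ge0 ?sqr_ge0. Qed.

Lemma norm2_eq0 : n = 0 -> a = 0 /\ b = 0.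
Proof.
move=> n0; have := norm2_sqr; rewrite n0 expr0n/= => /esym/eqP.
by rewrite paddr_eq0 ?sqr_ge0// !sqrf_eq0 => /andP[/eqP -> /eqP ->].
Qed.

Lemma norm2_F : (t * a) ^+ 2 + (t * b) ^+ 2 = (t * n) ^+ 2.
Proof. by rewrite !exprMn norm2_sqr; ring. Qed.

Lemma rad_F : rad 0 (t * a) (t * b) = n `^ (beta + 1).
Proof.
rewrite /rad expr0n/= add0r norm2_F sqrtr_sqr powR_beta1 ?norm2_ge0// ger0_norm//.
by rewrite mulr_ge0 ?powR_ge0// norm2_ge0.
Qed.

(** |F| = n^(beta + 1), so |F|^2 to the power -beta / (2 (beta + 1)) is n^(-beta), the inverse of
    t. *)
Lemma inverse_F (c : R) : (n = 0 -> c = 0) ->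
  c = ((t * a) ^+ 2 + (t * b) ^+ 2) `^ (- (beta / (beta + 1) / 2)) * (t * c).
Proof.
move=> c0; have [n0|nn] := eqVneq n 0; first by rewrite c0// !mulr0.
have np : 0 < n by rewrite lt_def nn norm2_ge0.
have bn : beta + 1 != 0 by rewrite gt_eqF// addr1_gt0.
rewrite norm2_F -powR_beta1 ?norm2_ge0// -powR_double ?norm2_ge0// -powRrM.
have -> : 2 * (beta + 1) * - (beta / (beta + 1) / 2) = - beta by field.
by rewrite powRN mulKf// gt_eqF// powR_gt0.
Qed.

(** |Dv| = |F|^(1 / (beta + 1)). Passing to a base of at least 1 allows rounding the exponent up to
    the integer that [moser] handles. *)
Lemma growth_F (c : R) (p : nat) : `|c| <= n -> (beta + 1)^-1 <= p%:R -> `|c| <= rad 1 (t * a) (t * b) ^+ p.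
Proof.
move=> cn bp; apply: (le_trans cn).
have bn := addr1_gt0 beta1.
set r := rad 1 _ _; have r1 : 1 <= r by exact: rad_ge_e.
have nr : n `^ (beta + 1) <= r by rewrite -rad_F rad_ge0e.
have -> : n = (n `^ (beta + 1)) `^ (beta + 1)^-1.
  by rewrite -powRrM divff ?gt_eqF// powRr1// norm2_ge0.
rewrite -powR_mulrn; last by rewrite (le_trans _ r1).
apply: (@le_trans _ _ (r `^ (beta + 1)^-1)); last exact: ler_powR.
apply: ge0_ler_powR => //; first by rewrite invr_ge0 ltW.
  by rewrite nnegrE powR_ge0.
by rewrite nnegrE (le_trans _ r1).
Qed.

(** As n^(beta - 1) = t / n and |F| = t n, the weight of the last integral turns one component of Dv
    into a component of F and the other into one of F / |F|. *)
Lemma quotient_F (c e : R) : (n = 0 -> c = 0) -> c * e * n `^ (beta - 1) =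
  (t * c) * ((t * e) / rad 0 (t * a) (t * b)).
Proof.
move=> c0; have [n0|nn] := eqVneq n 0; first by rewrite c0// !(mul0r, mulr0).
have np : 0 < n by rewrite lt_def nn norm2_ge0.
have tn : t != 0 by rewrite gt_eqF// powR_gt0.
rewrite rad_F powR_beta1 ?norm2_ge0// -/t.
have -> : n `^ (beta - 1) = t / n by rewrite powR_pred.
by field; rewrite nn tn.
Qed.

Lemma norm2_le : `|a| <= n /\ `|b| <= n.
Proof.
have := rad_ge_l 0 a b; have := rad_ge_r 0 a b.
by rewrite /rad expr0n/= add0r nE.
Qed.

End Pointwise.

(** * The integral identity for |Dv|^beta Dv *)

Unset Implicit Arguments.

Theorem lemma3p1 (R : realType) (Omega : set (R * R)) (beta : R)
    (v : R * R -> R) :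
  let Dv := wgrad Omega v in
  let F := fun x => enorm (Dv x) `^ beta *: Dv x in
  let N := fun x => enorm (Dv x) `^ (beta + 1) in
  is_domain Omega ->
  -1 < beta ->
  W1loc 1%E Omega v ->
  W1loc_vec 2%:E Omega F ->
  forall psi : R * R -> R, test_fun Omega psi ->
    \int[leb2 R]_(x in Omega) (- \det (wjac Omega F x) * psi x) =
      - (1 / 2) *
        \int[leb2 R]_(x in Omega)
          (enorm (Dv x) `^ (2 * beta) * dotp (hessian psi x *m Dv x) (Dv x))
      + 1 / (2 * beta + 2) *
        \int[leb2 R]_(x in Omega)
          (enorm (Dv x) `^ (2 * beta + 2) * laplacian psi x)
      - beta / (beta + 1) *
        \int[leb2 R]_(x in Omega)
          (dotp (wgrad Omega N x) (Dv x) * dotp (Dv x) (grad psi x)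
           * enorm (Dv x) `^ (beta - 1)).
Proof.
move=> Dv F N [oO _ _] b1 Wv WF psi tpsi.
pose V j := wpartial Omega j v.
have DvE j x : Dv x j 0 = V j x by rewrite mxE.
pose t x := enorm (Dv x) `^ beta.
pose FF (k : 'I_2) x := F x k 0.
have FE k x : FF k x = t x * V k x by rewrite /FF mxE DvE.
have nE x : enorm (Dv x) = Num.sqrt (V 0 x ^+ 2 + V 1 x ^+ 2) by rewrite enormE !DvE.
have WFF k : W1loc 2%:E Omega (FF k) by exact: WF.
have WV j : is_wpartial Omega j v (V j).
  by apply: wpartialP; have [_ /(_ j)[g vg _]] := Wv; exists g.
pose G k j := wpartial Omega j (FF k).
have WG k j : is_wpartial Omega j (FF k) (G k j) := W1loc2_wpartial j (WFF k).
have [z [tz hz]] := test_fun_cutoff oO tpsi.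
pose p j := partial j psi.
have tp j : test_fun Omega (p j) := test_fun_partial j tpsi.
(* Global functions that agree with F, and whose derivatives [d] agree with DF, on the support of
   psi; all integrals are moved to them. *)
pose f k x := z x * FF k x.
pose d k j x := z x * G k j x + partial j z x * FF k x.
have f2 k : L2 (leb2 R) (f k) by have [h _] := WFF k; exact: (Lploc2_L2 h tz).
have Sf k j : strong_deriv j (f k) (d k j) := W1loc2_strong j (WFF k) tz.
have cut x : tsupp psi x -> (forall k, f k x = FF k x) /\ (forall k j, d k j x = G k j x).
  move=> /hz[z1 dz]; split => [k|k j]; first by rewrite /f z1 mul1r.
  by rewrite /d z1 dz mul1r mul0r addr0.
have Sef eta k j : test_fun Omega eta -> tsupp eta `<=` tsupp psi ->
    strong_deriv j (fun x => eta x * f k x) (fun x => eta x * d k j x + partial j eta x * f k x).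
  move=> te es; have := W1loc2_strong j (WFF k) te.
  congr (strong_deriv j _ _); apply/funext => x.
    have [ex|nx] := pselect (tsupp eta x); last by rewrite (tsupp_eq0 nx) !mul0r.
    by have [h _] := cut x (es x ex); rewrite h.
  have [ex|nx] := pselect (tsupp eta x).
    by have [h k'] := cut x (es x ex); rewrite h k'.
  have -> : partial j eta x = 0 by apply/eqP/negPn/negP => /partial_supp.
  by rewrite (tsupp_eq0 nx) !mul0r.
pose gam := beta / (beta + 1).
have V0 k x : enorm (Dv x) = 0 -> V k x = 0.
  move=> n0; have [h0 h1] := norm2_eq0 (nE x) n0.
  have [->|->] : k = 0 \/ k = 1 by case: k => [[|[|//]] Hk]; [left|right]; exact: val_inj.
  - exact: h0.
  - exact: h1.
(* The exponent with which a power of |F| controls |Dv|, as in [growth_F]. *)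
have [P bP] : exists P : nat, (beta + 1)^-1 <= P%:R.
  exists (Num.bound (beta + 1)^-1); apply/ltW/archi_boundP.
  by rewrite invr_ge0 ltW// addr1_gt0.
have curl i : {ae leb2 R, forall x, p i x != 0 -> f 0 x ^+ 2 + f 1 x ^+ 2 != 0 ->
    d 0 1 x - d 1 0 x = gam * (f 0 x * (f 0 x * d 0 1 x + f 1 x * d 1 1 x)
      - f 1 x * (f 0 x * d 0 0 x + f 1 x * d 1 0 x)) / (f 0 x ^+ 2 + f 1 x ^+ 2)}.
  have := @curl_identity R Omega gam v (FF 0) (FF 1) (V 0) (V 1) P (p i) oO (WV 0) (WV 1) (WFF 0) (WFF 1).
  move=> C; have {C} := C _ _ _ _ (tp i).
  move=> C; apply: (ae_imp _ (C _ _ _ _)).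
  - move=> x H px; have [h k] := cut x (partial_supp px).
    by rewrite !h !k; exact: H.
  - move=> x; rewrite !FE; apply: (inverse_F b1 (nE x)); exact: V0.
  - move=> x; rewrite !FE; apply: (inverse_F b1 (nE x)); exact: V0.
  - by move=> x; rewrite !FE; apply: (growth_F b1 (nE x)) => //; have [] := norm2_le (nE x).
  - by move=> x; rewrite !FE; apply: (growth_F b1 (nE x)) => //; have [] := norm2_le (nE x).
have core := core_identity tpsi f2 Sf Sef curl.
have off h : (forall x, ~ tsupp psi x -> h x = 0) ->
    \int[leb2 R]_(x in Omega) h x = \int[leb2 R]_x h x.
  move=> h0; apply: Rintegral_off => x nx; apply: h0 => px; apply: nx.
  by have [_ _] := tpsi; exact.
have p0 j x : ~ tsupp psi x -> p j x = 0.
  by move=> nx; apply/eqP/negPn/negP => /partial_supp.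
have pp0 i j x : ~ tsupp psi x -> partial i (partial j psi) x = 0.
  move=> nx; apply/eqP/negPn/negP => /partial_supp h; apply: nx.
  have cl : closed (tsupp psi) by exact: closed_closure.
  rewrite ((closure_id _).1 cl); move: h; apply: closure_subset => y; exact: partial_supp.
(* Replaces an integral over Omega in terms of Dv and F by one over the plane in terms of [f] and
   [d]. *)
have conv h k : (forall x, tsupp psi x -> h x = k x) -> (forall x, ~ tsupp psi x -> h x = 0) ->
    (forall x, ~ tsupp psi x -> k x = 0) ->
    \int[leb2 R]_(x in Omega) h x = \int[leb2 R]_x k x.
  move=> hk h0 k0; rewrite off//; apply: eq_Rintegral => x _.
  by have [px|px] := pselect (tsupp psi x); [exact: hk|rewrite h0// k0].
have -> : \int[leb2 R]_(x in Omega) (- \det (wjac Omega F x) * psi x) =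
    \int[leb2 R]_x (- (d 0 0 x * d 1 1 x - d 0 1 x * d 1 0 x) * psi x).
  apply: conv => x px.
  - by have [_ k] := cut x px; rewrite det2 !mxE !k.
  - by rewrite (tsupp_eq0 px) mulr0.
  - by rewrite (tsupp_eq0 px) mulr0.
have -> : \int[leb2 R]_(x in Omega)
      (enorm (Dv x) `^ (2 * beta) * dotp (hessian psi x *m Dv x) (Dv x)) =
    \int[leb2 R]_x (partial 0 (partial 0 psi) x * f 0 x * f 0 x
      + partial 0 (partial 1 psi) x * f 0 x * f 1 x
      + partial 1 (partial 0 psi) x * f 1 x * f 0 x
      + partial 1 (partial 1 psi) x * f 1 x * f 1 x).
  have E x : dotp (hessian psi x *m Dv x) (Dv x) =
      (partial 0 (partial 0 psi) x * V 0 x + partial 0 (partial 1 psi) x * V 1 x) * V 0 x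
      + (partial 1 (partial 0 psi) x * V 0 x + partial 1 (partial 1 psi) x * V 1 x) * V 1 x.
    by rewrite /dotp sum_ord2 !mxE !sum_ord2 !mxE.
  apply: conv => x px.
  - have [h _] := cut x px; rewrite E !h !FE (powR_double _ (sqrtr_ge0 _)) -/(t x).
    move: (partial 0 (partial 0 psi) x) (partial 0 (partial 1 psi) x)
      (partial 1 (partial 0 psi) x) (partial 1 (partial 1 psi) x) (t x) (V 0 x) (V 1 x) => *.
    by clear; ring.
  - have q i j := pp0 i j x px; rewrite E !q.
    by move: (V 0 x) (V 1 x) => *; rewrite !mul0r !addr0 !mul0r addr0 mulr0.
  - have q i j := pp0 i j x px; rewrite !q.
    by move: (f 0 x) (f 1 x) => *; rewrite !mul0r !addr0.
have -> : \int[leb2 R]_(x in Omega) (enorm (Dv x) `^ (2 * beta + 2) * laplacian psi x) =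
    \int[leb2 R]_x ((f 0 x ^+ 2 + f 1 x ^+ 2) *
      (partial 0 (partial 0 psi) x + partial 1 (partial 1 psi) x)).
  apply: conv => x px.
  - have [h _] := cut x px; rewrite !h !FE (norm2_F beta (nE x)) /laplacian sum_ord2; congr (_ * _).
    rewrite -(powR_beta1 (sqrtr_ge0 _) b1) -(powR_double _ (sqrtr_ge0 _)).
    by congr (_ `^ _); ring.
  - by have q i j := pp0 i j x px; rewrite /laplacian sum_ord2 !q addr0 mulr0.
  - by have q i j := pp0 i j x px; rewrite !q addr0 mulr0.
have NE : N = fun x => rad 0 (FF 0 x) (FF 1 x).
  by apply/funext => x; rewrite !FE /N (rad_F b1 (nE x)).
pose nu j x := FF 0 x / rad 0 (FF 0 x) (FF 1 x) * G 0 j x + FF 1 x / rad 0 (FF 0 x) (FF 1 x) * G 1 j x.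
have FL k eta : test_fun Omega eta -> L2 (leb2 R) (fun x => eta x * FF k x).
  by move=> te; have [h _] := WFF k; exact: (Lploc2_L2 h te).
have GL k j eta : test_fun Omega eta -> L2 (leb2 R) (fun x => eta x * G k j x).
  by move=> te; exact: (W1loc2_L2 j (WFF k) te).
have WN j : is_wpartial Omega j N (nu j).
  rewrite NE; exact: (modulus_wpartial oO (FL 0) (FL 1) (GL 0 j) (GL 1 j) (WG 0 j) (WG 1 j)).
(* [W] is the representative occurring in the statement and [nu] the explicit one; they are equal
   only almost everywhere, and only after multiplication by a cutoff is this used. *)
pose W j := wpartial Omega j N.
have WW j : is_wpartial Omega j N (W j) by apply: wpartialP; exists (nu j).
pose e k x := f k x / rad 0 (f 0 x) (f 1 x).
have mf k : mfun2 (f k) by case: (f2 k).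
have md k j : mfun2 (d k j) by case: (Sf k j) => _ [].
have me k : mfun2 (e k).
  apply: measurable_funM => //.
  by apply: mfun2_inv => [x|]; [exact: rad_ge0|exact: mfun2_rad].
have mW i j : mfun2 (fun x => p i x * W j x).
  by have [_ w1 _] := WW j; have [] := integrable_mfun2 (Lploc1_integrable w1 (tp i)).
have mn i j : mfun2 (fun x => p i x * (e 0 x * d 0 j x + e 1 x * d 1 j x)).
  have [sp _ _] := tp i; apply: measurable_funM; first exact: smooth_mfun2.
  exact: mfun2_combo.
(* The slot [w] receives p_i times either representative of the derivative of N. The factor p_i
   stays attached to [W j], since [W j] has a measurable extension to the plane only after
   multiplication by a test function. *)
pose h (w : 'I_2 -> 'I_2 -> R * R -> R) x :=
  w 0 0 x * (f 0 x * e 0 x) + w 0 1 x * (f 1 x * e 0 x)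
  + w 1 0 x * (f 0 x * e 1 x) + w 1 1 x * (f 1 x * e 1 x).
have mh w : (forall i j, mfun2 (w i j)) -> mfun2 (h w).
  move=> mw; do ![apply: measurable_funD]; apply: measurable_funM => //; exact: measurable_funM.
have E x : dotp (wgrad Omega N x) (Dv x) * dotp (Dv x) (grad psi x) * enorm (Dv x) `^ (beta - 1) =
    (W 0 x * V 0 x + W 1 x * V 1 x) * (V 0 x * p 0 x + V 1 x * p 1 x) * enorm (Dv x) `^ (beta - 1).
  by rewrite /dotp !sum_ord2 !mxE.
have -> : \int[leb2 R]_(x in Omega) (dotp (wgrad Omega N x) (Dv x) * dotp (Dv x) (grad psi x)
      * enorm (Dv x) `^ (beta - 1)) = \int[leb2 R]_x h (fun i j x => p i x * W j x) x.
  apply: conv => x px.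
  - have [hh _] := cut x px; rewrite E /h /e !hh !FE.
    have Q (c c' : R) : (enorm (Dv x) = 0 -> c = 0) -> c * c' * enorm (Dv x) `^ (beta - 1) =
      (t x * c) * (t x * c' / rad 0 (t x * V 0 x) (t x * V 1 x)).
      exact: (quotient_F b1 (nE x)).
    exact: (third_algebra (W 0 x) (W 1 x) (p 0 x) (p 1 x) (Q _ (V 0 x) (@V0 0 x))
      (Q _ (V 0 x) (@V0 1 x)) (Q _ (V 1 x) (@V0 0 x)) (Q _ (V 1 x) (@V0 1 x))).
  - have q i := p0 i x px; rewrite E !q.
    by move: (V 0 x) (V 1 x) => *; rewrite !mulr0 addr0 mulr0 mul0r.
  - have q i := p0 i x px; rewrite /h !q.
    by move: (W 0 x) (W 1 x) (f 0 x) (f 1 x) (e 0 x) (e 1 x) => *; rewrite !mul0r !addr0.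
have -> : \int[leb2 R]_x h (fun i j x => p i x * W j x) x =
    \int[leb2 R]_x h (fun i j x => p i x * (e 0 x * d 0 j x + e 1 x * d 1 j x)) x.
  apply: ae_eq_Rintegral; [exact: mh|exact: mh|].
  have U j := is_wpartial_unique (WW j) (WN j) tz.
  apply: (ae_imp _ (ae_and (U 0) (U 1))) => x [U0 U1].
  have [px|px] := pselect (tsupp psi x); last first.
    have q i := p0 i x px; rewrite /h !q.
    by move: (W 0 x) (W 1 x) (f 0 x) (f 1 x) (e 0 x) (e 1 x) => *; rewrite !mul0r !addr0.
  have [hh kk] := cut x px; have [z1 _] := hz x px.
  rewrite z1 (mul1r (W 0 x)) (mul1r (nu 0 x)) in U0.
  rewrite z1 (mul1r (W 1 x)) (mul1r (nu 1 x)) in U1.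
  have n0 : W 0 x = e 0 x * d 0 0 x + e 1 x * d 1 0 x.
    exact: (combo_congr (hh 0) (hh 1) (kk 0 0) (kk 1 0) U0).
  have n1 : W 1 x = e 0 x * d 0 1 x + e 1 x * d 1 1 x.
    exact: (combo_congr (hh 0) (hh 1) (kk 0 1) (kk 1 1) U1).
  by rewrite /h n0 n1.
rewrite core.
have -> : 1 / (2 * beta + 2) = (1 - gam) / 2.
  have bn : beta + 1 != 0 by rewrite gt_eqF// addr1_gt0.
  have bn2 : 2 * beta + 2 != 0 by rewrite -[X in _ + X]mulr1 -mulrDr mulf_neq0.
  by rewrite /gam; field; rewrite bn bn2.
congr (_ - gam * _); apply: eq_Rintegral => x _.
rewrite /h /e; have := rad_sqr 0 (f 0 x) (f 1 x); rewrite expr0n/= add0r => <-.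
rewrite -exprVn -/(p 0 x) -/(p 1 x).
move: (rad 0 (f 0 x) (f 1 x))^-1 (f 0 x) (f 1 x) (p 0 x) (p 1 x) (d 0 0 x) (d 0 1 x) (d 1 0 x) (d 1 1 x).
by move=> *; clear; ring.
Qed.
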